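(* Let $f$ be analytic in an open neighbourhood of the closed unit disk, having exactly $s$ zeroes in $D_1$ (counted with multiplicity), and $(s,p)$-valent in $D_1$. Let $Z$ be a subset of $D_1$ with $\rho=\rho(Z)=\inf\{\eta: Z\subset D_\eta\}<1$. Then for every $0<R<1$, $$\sup_{|z|\le R}|f(z)|\le\sigma_p(R,\rho)\,K_s(Z)\,\sup_Z|f|,\qquad \sigma_p(R,\rho)=\Big(\frac{1+R}{1-R}\cdot\frac{1+\rho}{1-\rho}\Big)^{2p}.$$
   Context: $D_r=\{z\in\mathbb C:|z|<r\}$. A function $f$ regular in a domain $\Omega$ is $(s,p)$-valent in $\Omega$ if for every polynomial $P$ of degree at most $s$ the equation $f(z)=P(z)$ has at most $p$ solutions in $\Omega$, counted with multiplicity. For $Z\subset D_1$, $d\in\mathbb N$, $\alpha>0$: $c_{d,\alpha}(Z)=\inf\{(\sum_{j=1}^q r_j^\alpha)^{1/\alpha}: Z$ is covered by $q\le d$ disks of radii $r_1,\dots,r_q>0\}$, and $K_d(Z)=\inf_{\alpha>0}\big(6e^{1/\alpha}/c_{d,\alpha}(Z)\big)^d$ (a term with $c_{d,\alpha}(Z)=0$ being $+\infty$); for $d=0$, $K_0(Z)=1$. *)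

(* Defs.v *)
From Stdlib Require Import Reals List ClassicalEpsilon.
Open Scope R_scope.

Record Cplx := mkC { Re : R ; Im : R }.
Definition RtoC (x : R) : Cplx := mkC x 0.
Definition Cadd (z w : Cplx) : Cplx := mkC (Re z + Re w) (Im z + Im w).
Definition Copp (z : Cplx) : Cplx := mkC (- Re z) (- Im z).
Definition Csub (z w : Cplx) : Cplx := Cadd z (Copp w).
Definition Cmul (z w : Cplx) : Cplx :=
  mkC (Re z * Re w - Im z * Im w) (Re z * Im w + Im z * Re w).
Fixpoint Cpow (z : Cplx) (n : nat) : Cplx :=
  match n with O => RtoC 1 | S k => Cmul z (Cpow z k) end.
Definition Cabs (z : Cplx) : R := sqrt (Re z * Re z + Im z * Im z).

Definition ball (c : Cplx) (r : R) (z : Cplx) : Prop := Cabs (Csub z c) < r.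
Definition disk (r : R) (z : Cplx) : Prop := Cabs z < r.

Definition is_open (U : Cplx -> Prop) : Prop :=
  forall z, U z -> exists r, 0 < r /\ forall w, ball z r w -> U w.

Definition cderiv (f : Cplx -> Cplx) (z l : Cplx) : Prop :=
  forall eps, 0 < eps -> exists del, 0 < del /\
    forall h, Cabs h < del ->
      Cabs (Csub (Csub (f (Cadd z h)) (f z)) (Cmul l h)) <= eps * Cabs h.

Definition holo_on (U : Cplx -> Prop) (f : Cplx -> Cplx) : Prop :=
  forall z, U z -> exists l, cderiv f z l.

Definition analytic_near_closed_unit_disk (f : Cplx -> Cplx) : Prop :=
  exists U, is_open U /\ (forall z, Cabs z <= 1 -> U z) /\ holo_on U f.

Definition vanishes_to_order (g : Cplx -> Cplx) (z0 : Cplx) (m : nat) : Prop :=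
  exists r, 0 < r /\ exists h, holo_on (ball z0 r) h /\
    forall z, ball z0 r z -> g z = Cmul (Cpow (Csub z z0) m) (h z).

Definition zeros_at_least (g : Cplx -> Cplx) (A : Cplx -> Prop) (n : nat) : Prop :=
  exists pts : list (Cplx * nat),
    NoDup (map fst pts) /\
    Forall (fun zm => A (fst zm) /\ vanishes_to_order g (fst zm) (snd zm)) pts /\
    (n <= fold_right (fun zm acc => (snd zm + acc)%nat) O pts)%nat.

Definition zeros_exactly (g : Cplx -> Cplx) (A : Cplx -> Prop) (n : nat) : Prop :=
  zeros_at_least g A n /\ ~ zeros_at_least g A (S n).

Fixpoint poly_eval (a : nat -> Cplx) (s : nat) (z : Cplx) : Cplx :=
  match s with
  | O => a O
  | S k => Cadd (poly_eval a k z) (Cmul (a (S k)) (Cpow z (S k)))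
  end.

Definition sp_valent (s p : nat) (f : Cplx -> Cplx) (A : Cplx -> Prop) : Prop :=
  forall a : nat -> Cplx,
    ~ zeros_at_least (fun z => Csub (f z) (poly_eval a s z)) A (S p).

Definition is_glb (E : R -> Prop) (m : R) : Prop :=
  (forall x, E x -> m <= x) /\ (forall b, (forall x, E x -> b <= x) -> b <= m).

Definition Rinf (E : R -> Prop) : R :=
  match excluded_middle_informative (exists m, is_glb E m) with
  | left H => proj1_sig (constructive_indefinite_description _ H)
  | right _ => 0
  end.

Definition Rsup (E : R -> Prop) : R :=
  match excluded_middle_informative (exists m, is_lub E m) with
  | left H => proj1_sig (constructive_indefinite_description _ H)
  | right _ => 0
  end.

Definition covers (Z : Cplx -> Prop) (cs : list (Cplx * R)) : Prop :=
  forall z, Z z -> exists c, In c cs /\ ball (fst c) (snd c) z.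

Definition cover_val (alpha : R) (cs : list (Cplx * R)) : R :=
  match cs with
  | nil => 0
  | _ => Rpower (fold_right (fun c acc => Rpower (snd c) alpha + acc) 0 cs) (/ alpha)
  end.

Definition c_cap (d : nat) (alpha : R) (Z : Cplx -> Prop) : R :=
  Rinf (fun v => exists cs : list (Cplx * R),
          (length cs <= d)%nat /\ Forall (fun c => 0 < snd c) cs /\
          covers Z cs /\ v = cover_val alpha cs).

(* K_d(Z) as an extended real: None stands for +infinity *)
Definition K_const (d : nat) (Z : Cplx -> Prop) : option R :=
  match d with
  | O => Some 1
  | S _ =>
    match excluded_middle_informative
            (exists alpha, 0 < alpha /\ 0 < c_cap d alpha Z) with
    | left _ => Some (Rinf (fun v => exists alpha, 0 < alpha /\ 0 < c_cap d alpha Z /\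
                         v = (6 * exp (/ alpha) / c_cap d alpha Z) ^ d))
    | right _ => None
    end
  end.

Definition rho (Z : Cplx -> Prop) : R :=
  Rinf (fun eta => 0 < eta /\ forall z, Z z -> disk eta z).

Definition sigma_p (p : nat) (Rad rh : R) : R :=
  ((1 + Rad) / (1 - Rad) * ((1 + rh) / (1 - rh))) ^ (2 * p).

(* Main.v *)
(** Write [f = P * g] with [P] the monic polynomial of the zeros of [f]. Since [f - w * P] has at most [p]
    zeros for every [w], the zero-free function [g] takes every value at most [p] times. For [P], Cartan's
    lemma gives a point of [Z] where [|P|] is at least a power of [c / (3 * exp (/ alpha))], while
    [|P| <= 2 ^ deg P] on the disk; the constant 6 is 2 * 3.

    For [g], it suffices to show [ln |g z / g 0| <= 2 * p * ln ((1 + |z|) / (1 - |z|))], also for [1 / g].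
    By Jensen's formula, averaged over the values [w] with [|w| = t], the mean of [max (ln |g|) (ln t)] over
    [|z| = r] grows at rate at most [p] with respect to [ln r], for every [t]. So the mean of [ln |g|] times a
    kernel, maximized over all rearrangements of the kernel, grows at rate at most [p] times the oscillation of
    the kernel. Next, the value of [ln |g|] at a point of [|z| = R] is a Poisson mean, of parameter [r], of the
    values on [|z| = R / r]. By Riesz's rearrangement inequality, the maximal mean over [|z| = R] against the
    Poisson kernel of parameter [rho] is therefore at most the one over [|z| = R / r] against the kernel of
    parameter [r * rho], which exceeds the one over [|z| = R] by at most [p * ln (/ r)] times the oscillation,
    hence by at most [p] times the increment of [2 * ln ((1 + x) / (1 - x))] from [r * rho] to [rho]. Iteration
    gives the bound.

    All means are taken over roots of unity, where rearrangements are permutations and Riesz's inequality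
    follows by finitely many polarizations. *)

From mathcomp Require all_boot all_order all_algebra all_fingroup Rstruct lra.
From Coquelicot Require Import Coquelicot.
Require Import Defs.
From Stdlib Require Import Reals List ClassicalEpsilon Lra Lia Psatz ZArith.

(** The bound for [g] is attained: [((1 + z) / (1 - z)) ^ (2 * p)] is the [p]-th power of a
    univalent map onto a slit plane, and on the positive axis it grows exactly as allowed. So no
    step may lose a constant. This is possible because [2 * ln ((1 + x) / (1 - x))] has the
    derivative [4 * x / (1 - x * x)] with respect to [ln x], which is the oscillation
    [(1 + x) / (1 - x) - (1 - x) / (1 + x)] of the Poisson kernel of parameter [x]. Jensen's formula
    says how the values of [ln |g|] are distributed on a circle, not where they lie on it. So the
    quantity followed is not the Poisson mean but its maximum over rearrangements of the kernel; the
    truncations at all levels [t] control it through the layers of the kernel. The iteration stays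
    on one circle and only lowers the parameter of the kernel. It ends near a constant kernel, where
    every rearrangement gives the mean of [ln |g z / g 0|], which is 0. Levels and permutations vary
    with the number of points, so the limits that involve them need thresholds uniform in them. *)

Module Rearrangement.
Import all_boot all_order all_algebra all_fingroup lra.
Set Implicit Arguments. Unset Strict Implicit. Unset Printing Implicit Defensive.
Import Order.TTheory GRing.Theory Num.Theory.
Local Open Scope ring_scope.

(** * Polarization and Riesz's rearrangement inequality on a finite abelian group *)

Section Polarization.
Variables (R : realFieldType) (X : finZmodType) (k phi : X -> R).
Hypothesis k_even : forall x, k (- x) = k x.
(** What polarization needs from the two kernels: [k] favours pairs on the same side of a
    reflection, the sides being told apart by [phi]; and by [phi_fix] a tie of [phi] occurs only if
    the reflection leaves all of [phi] invariant, or at a fixed point. *)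
Hypothesis k_sign : forall s x y, 0 <= (k (x - y) - k (x + y - s)) * ((phi x - phi (s - x)) * (phi y - phi (s - y))).
Hypothesis phi_fix : forall s, (forall x, phi (s - x) = phi x) \/ (forall x, phi (s - x) = phi x -> s - x = x).

Definition conv (a b : X -> R) : R := \sum_x \sum_y a x * b y * k (x - y).

Lemma reflK (s : X) : involutive (fun x => s - x).
Proof. by move=> x; rewrite opprB addrCA subrr addr0. Qed.

(* Splitting [a] and [b] into even and odd parts under the reflection [x -> s - x]; only the odd
   parts are affected by polarization, and termwise. *)
Lemma conv_even_odd (s : X) (a b : X -> R) :
  8%:R * conv a b = \sum_x \sum_y (2%:R * ((a x + a (s - x)) * (b y + b (s - y))) * k (x - y) +
      (a x - a (s - x)) * (b y - b (s - y)) * (k (x - y) - k (x + y - s))).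
Proof.
have bij := inv_bij (reflK s).
pose K x y := k (x - y). pose K' x y := k (x + y - s).
have KE x y : K (s - x) (s - y) = K x y.
  by rewrite /K opprB addrC addrA subrK -k_even opprB.
have KE1 x y : K (s - x) y = K' x y by rewrite /K /K' -k_even; congr k; rewrite opprB opprB addrA [y + x]addrC.
have KE2 x y : K x (s - y) = K' x y by rewrite /K /K' opprB addrA.
have KE3 x y : K' (s - x) y = K x y by rewrite -KE1 reflK.
have KE4 x y : K' x (s - y) = K x y by rewrite -KE2 reflK.
pose S (Q : X -> X -> R) (f g : X -> R) := \sum_x \sum_y f x * g y * Q x y.
have R1 (Q : X -> X -> R) f g : S Q (fun x => f (s - x)) g = S (fun x y => Q (s - x) y) f g.
  rewrite /S (reindex_inj (can_inj (reflK s))) /=; apply: eq_bigr => x _; apply: eq_bigr => y _.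
  by rewrite reflK.
have R2 (Q : X -> X -> R) f g : S Q f (fun y => g (s - y)) = S (fun x y => Q x (s - y)) f g.
  rewrite /S; apply: eq_bigr => x _; rewrite (reindex_inj (can_inj (reflK s))) /=; apply: eq_bigr => y _.
  by rewrite reflK.
have SE (Q Q' : X -> X -> R) f g : (forall x y, Q x y = Q' x y) -> S Q f g = S Q' f g.
  by move=> E; apply: eq_bigr => x _; apply: eq_bigr => y _; rewrite E.
pose a' x := a (s - x). pose b' x := b (s - x).
have E1 : S K a' b = S K' a b by rewrite R1; apply: SE.
have E2 : S K a b' = S K' a b by rewrite R2; apply: SE.
have E3 : S K a' b' = S K a b by rewrite R1 R2; apply: SE.
have E4 : S K' a' b = S K a b by rewrite R1; apply: SE.
have E5 : S K' a b' = S K a b by rewrite R2; apply: SE.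
have E6 : S K' a' b' = S K' a b by rewrite R1 R2; apply: SE => x y; rewrite KE4 KE1.
(* The eight sums reduce to [S K a b] and [S K' a b], in which this is an identity. Its coefficients
   are those of the expanded right-hand side of the lemma, so that the rest can be compared term by
   term. *)
have LHS : 8%:R * conv a b = 3%:R * (S K a b + S K a b' + S K a' b + S K a' b') + (- (S K a b' + S K a b' + S K a' b + S K a' b))
   - (S K' a b - S K' a b' - S K' a' b + S K' a' b').
  rewrite E1 E2 E3 E4 E5 E6 /conv -/(S K a b); lra.
rewrite LHS /S -!big_split /= -!sumrN -!big_split /= mulr_sumr -!big_split -sumrB /=.
apply: eq_bigr => x _.
rewrite -!big_split /= -!sumrN -!big_split /= mulr_sumr -!big_split -sumrB /=.
apply: eq_bigr => y _; rewrite /K /K' /a' /b'.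
lra.
Qed.

(** Two-point rearrangement of [a] along the reflection [x -> s - x]: the larger of two mirror
    values is to lie where [phi] is larger. Ties of [phi] are left alone. *)
Definition swapped (s : X) (a : X -> R) (x : X) : bool :=
  ((phi (s - x) < phi x) && (a x < a (s - x))) || ((phi x < phi (s - x)) && (a (s - x) < a x)).

Definition swap (s : X) (a : X -> R) (x : X) : X := if swapped s a x then s - x else x.

Lemma swapped_refl s a x : swapped s a (s - x) = swapped s a x.
Proof. by rewrite /swapped reflK orbC. Qed.

Lemma swap_inj s a : injective (swap s a).
Proof.
apply: (can_inj (g := swap s a)) => x; by rewrite /swap; case H: (swapped s a x); rewrite ?swapped_refl H ?reflK.
Qed.

Lemma swap_refl s a x : swap s a (s - x) = s - swap s a x.
Proof. by rewrite /swap swapped_refl; case: (swapped s a x). Qed.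

Lemma swap_odd s a x : let A := a x - a (s - x) in let A' := a (swap s a x) - a (s - swap s a x) in
  if phi (s - x) < phi x then A' = `|A| else if phi x < phi (s - x) then A' = - `|A| else A' = A.
Proof.
rewrite /= /swap /swapped; case: (ltgtP (phi (s - x)) (phi x)) => /= H; rewrite ?orbF.
- case: ifP => [H1|/negbT]; first by rewrite reflK ler0_norm ?opprB // subr_le0 ltW.
  by rewrite -leNgt => H1; rewrite ger0_norm // subr_ge0.
- case: ifP => [H1|/negbT]; first by rewrite reflK gtr0_norm ?opprB // subr_gt0.
  by rewrite -leNgt => H1; rewrite ler0_norm ?opprK // subr_le0.
- by [].
Qed.

Lemma swap_even s a x : a (swap s a x) + a (s - swap s a x) = a x + a (s - x).
Proof. by rewrite /swap; case: ifP => // _; rewrite reflK addrC. Qed.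

(** In [conv_even_odd] the even parts do not change, while the odd parts keep their moduli and take
    the sign of the odd part of [phi]. By [k_sign] the product of these two signs is the sign of the
    kernel difference, so every term becomes as large as it can be. *)
Lemma polarize (s : X) (a b : X -> R) : conv a b <= conv (a \o swap s a) (b \o swap s b).
Proof.
rewrite -(ler_pM2l (ltr0n R 8)) !(conv_even_odd s).
apply: ler_sum => x _; apply: ler_sum => y _ /=.
rewrite !swap_refl !swap_even lerD2l.
have := swap_odd s a x; have := swap_odd s b y => /=.
set B' := b (swap _ _ _) - b (s - _); set A' := a (swap _ _ _) - a (s - _).
set A := a x - a (s - x); set B := b y - b (s - y).
have := k_sign s x y; set c := k _ - k _.
have nA := normr_ge0 A; have nB := normr_ge0 B; have nc := normr_ge0 c.
have AB : A * B * c <= `|A| * `|B| * `|c| by rewrite -!normrM ler_norm.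
case: (ltgtP (phi (s - x)) (phi x)) => hx; case: (ltgtP (phi (s - y)) (phi y)) => hy sg -> -> //.
- have c0 : 0 <= c by rewrite -(pmulr_lge0 (x := (phi x - phi (s - x)) * (phi y - phi (s - y)))) // mulr_gt0 // subr_gt0.
  by rewrite (le_trans AB) // (ger0_norm c0).
- have c0 : c <= 0.
    by rewrite -(nmulr_lge0 (x := (phi x - phi (s - x)) * (phi y - phi (s - y)))) // pmulr_rlt0 ?subr_gt0 // subr_lt0.
  by rewrite (le_trans AB) // (ler0_norm c0) !mulrN mulNr.
(* A tie at [y] but not at [x]: [phi] is not invariant under the reflection, so [y] is a fixed point
   and the odd part of [b] vanishes there. *)
- have [E|E] := phi_fix s; first by move: hx; rewrite E ltxx.
  have B0 : B = 0 by rewrite /B E ?subrr.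
  by rewrite B0 !mulr0 !mul0r.
- have c0 : c <= 0.
    by rewrite -(nmulr_lge0 (x := (phi x - phi (s - x)) * (phi y - phi (s - y)))) // nmulr_rlt0 ?subr_gt0 // subr_lt0.
  by rewrite (le_trans AB) // (ler0_norm c0) !mulrN !mulNr.
- have c0 : 0 <= c.
    by rewrite -(pmulr_lge0 (x := (phi x - phi (s - x)) * (phi y - phi (s - y)))) // nmulr_rgt0 subr_lt0.
  by rewrite (le_trans AB) // (ger0_norm c0) !mulrNN.
- have [E|E] := phi_fix s; first by move: hx; rewrite E ltxx.
  have B0 : B = 0 by rewrite /B E ?subrr.
  by rewrite B0 !mulr0 !mul0r.
- have [E|E] := phi_fix s; first by move: hy; rewrite E ltxx.
  have A0 : A = 0 by rewrite /A E ?subrr.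
  by rewrite A0 !mul0r.
- have [E|E] := phi_fix s; first by move: hy; rewrite E ltxx.
  have A0 : A = 0 by rewrite /A E ?subrr.
  by rewrite A0 !mul0r.
Qed.

(** A permutation preserves the size of every superlevel set of [phi]. So a point that leaves such a
    set is matched by one that enters it, and the two are ordered oppositely by [phi] and
    [phi \o sg]. *)
Lemma exists_inversion (sg : {perm X}) : (exists x, phi (sg x) != phi x) ->
  exists x y, phi y < phi x /\ phi (sg x) < phi (sg y).
Proof.
case=> x1 ne.
have card c : #|[set x | c <= phi (sg x)]| = #|[set x | c <= phi x]|.
  have -> : [set x | c <= phi (sg x)] = sg @^-1: [set x | c <= phi x] by apply/setP => x; rewrite !inE.
  by apply: card_preimset; exact: perm_inj.
have ex c (P Q : {set X}) : #|P| = #|Q| -> c \in P -> c \notin Q -> exists2 y, y \in Q & y \notin P.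
  move=> E cP cQ; have : ~~ (Q \subset P).
    apply/negP => QP; move: cQ; have /eqP -> : Q == P by rewrite eqEcard QP E leqnn.
    by rewrite cP.
  by case/subsetPn => y; exists y.
case: (ltgtP (phi (sg x1)) (phi x1)) ne => // H _.
- have [||y] := ex x1 [set x | phi x1 <= phi x] [set x | phi x1 <= phi (sg x)] (esym (card _)).
  + by rewrite inE.
  + by rewrite inE -ltNge.
  by rewrite !inE -ltNge => H1 H2; exists x1, y; split; [exact: H2|exact: lt_le_trans H H1].
- have [||y] := ex x1 [set x | phi (sg x1) <= phi (sg x)] [set x | phi (sg x1) <= phi x] (card _).
  + by rewrite inE.
  + by rewrite inE -ltNge.
  by rewrite !inE -ltNge => H1 H2; exists y, x1; split; [exact: lt_le_trans H H1|exact: H2].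
Qed.

(** In a group any two points are exchanged by a reflection, here with [s = x0 + y0]. Hence every
    inversion can be removed by one polarization, which strictly raises the correlation with
    [phi]. *)
Lemma swap_improves (sg : {perm X}) (x0 y0 : X) : phi y0 < phi x0 -> phi (sg x0) < phi (sg y0) ->
  \sum_x phi x * phi (sg x) < \sum_x phi x * phi (sg (swap (x0 + y0) (phi \o sg) x)).
Proof.
move=> h1 h2; set s := x0 + y0; set a := phi \o sg.
have sx : s - x0 = y0 by rewrite /s addrC addKr.
rewrite -subr_gt0 -sumrB.
pose d x := a (swap s a x) - a x.
have dr x : d (s - x) = - d x.
  by rewrite /d swap_refl /swap; case: ifP => _; rewrite ?reflK ?opprB // !subrr.
have E : 2%:R * \sum_x (phi x * phi (sg (swap s a x)) - phi x * phi (sg x)) = \sum_x (phi x - phi (s - x)) * d x.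
  rewrite mulr_natl mulr2n {2}(reindex_inj (can_inj (reflK s))) /= -big_split /=.
  by apply: eq_bigr => x _; rewrite -!mulrBr -/(a _) -/(a x) -/(d x) -/(a (swap s a (s - x))) -/(a (s - x)) -/(d (s - x)) dr mulrN mulrBl.
rewrite -(pmulr_rgt0 _ (ltr0n R 2)) E (bigD1 x0) //=.
have t x : 0 <= (phi x - phi (s - x)) * d x.
  rewrite /d /swap /swapped; case: (ltgtP (phi (s - x)) (phi x)) => H /=; rewrite ?orbF.
  - by case: ifP => H1; rewrite ?subrr ?mulr0 // mulr_ge0 // subr_ge0 ltW.
  - by case: ifP => H1; rewrite ?subrr ?mulr0 // mulr_le0 // subr_le0 ltW.
  - by rewrite subrr mulr0.
apply: ltr_wpDr; first by apply: sumr_ge0.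
by rewrite /d /swap /swapped sx h1 h2 /= mulr_gt0 // subr_gt0.
Qed.

(** Among the finitely many pairs of permutations that do not lower [conv], take one with maximal
    correlation of [phi \o s1] with [phi]. An inversion would allow a further polarization, so
    [phi \o s1] is [phi] itself. The maximum replaces the limit of a sequence of polarizations. *)
Lemma riesz_rearrangement (b : X -> R) (sg : {perm X}) :
  exists sg' : {perm X}, conv (phi \o sg) b <= conv phi (b \o sg').
Proof.
pose T := ({perm X} * {perm X})%type.
pose P (p : T) := conv (phi \o sg) b <= conv (phi \o p.1) (b \o p.2).
pose F (p : T) := \sum_x phi x * phi (p.1 x).
have P0 : P (sg, 1%g).
  rewrite /P /=; apply: ler_sum => x _; apply: ler_sum => y _ /=; by rewrite perm1.
case: (@Order.TotalTheory.arg_maxP _ _ _ (sg, 1%g) P F P0) => -[s1 s2] Ps max.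
case: (boolP [exists x, phi (s1 x) != phi x]) => [/existsP/exists_inversion|].
  case=> x0 [y0 [h1 h2]].
  have := swap_improves h1 h2; set s := x0 + y0.
  pose p1 := perm (@swap_inj s (phi \o s1)); pose p2 := perm (@swap_inj s (b \o s2)).
  have Pp : P ((p1 * s1)%g, (p2 * s2)%g).
    apply: (le_trans Ps); apply: (le_trans (polarize s _ _)).
    by apply: ler_sum => x _; apply: ler_sum => y _ /=; rewrite !permM !permE.
  have := max _ Pp; rewrite /F /= => H1 H2.
  have : \sum_x phi x * phi ((p1 * s1)%g x) = \sum_x phi x * phi (s1 (swap s (phi \o s1) x)).
    by apply: eq_bigr => x _; rewrite permM permE.
  by move=> E; move: H1; rewrite E leNgt H2.
move/existsPn => E; exists s2; apply: (le_trans Ps).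
apply: ler_sum => x _; apply: ler_sum => y _ /=.
by have /negPn/eqP -> := E x.
Qed.
End Polarization.

(** * From truncated sums to rearranged sums *)

Section Majorization.
Variables (R : realFieldType) (X : finType).

Fixpoint layers (v0 : R) (v : seq R) (y : R) : R :=
  if v is v1 :: v' then (v1 - v0) * (v1 <= y)%R%:R + layers v1 v' y else 0.

(** The thresholds up to [y] contribute their successive differences, which telescope; the later
    ones contribute nothing. *)
Lemma layersE (v0 : R) (v : seq R) (y : R) : path <=%O v0 v -> y \in v0 :: v -> y - v0 = layers v0 v y.
Proof.
elim: v v0 => [|v1 v IH] v0 /=; first by rewrite inE => _ /eqP ->; rewrite subrr.
case/andP => h01 hp; rewrite inE => /orP[/eqP ->|yv].
  have lay0 : forall w u, path <=%O u w -> v0 <= u -> layers u w v0 = 0.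
    elim => //= w1 w IHw u /andP[h1 h2] h; rewrite (IHw w1 h2 (le_trans h h1)) addr0.
    case: (lerP w1 v0) => [h3|]; last by rewrite mulr0.
    by rewrite (_ : w1 = u) ?subrr ?mul0r //; apply/eqP; rewrite eq_le h1 (le_trans h3 h).
  rewrite subrr lay0 // addr0; case: (lerP v1 v0) => [h3|]; last by rewrite mulr0.
  by rewrite (_ : v1 = v0) ?subrr ?mul0r //; apply/eqP; rewrite eq_le h01 h3.
rewrite -IH //.
have -> : v1 <= y.
  move: yv; rewrite inE => /orP[/eqP ->|yv]; first exact: lexx.
  by move: hp; rewrite (path_sortedE le_trans) => /andP[/allP h _]; apply: h.
by rewrite mulr1; lra.
Qed.

Lemma layers_sum_le (C D U U' : X -> R) (eta : R) (v : seq R) (v0 : R) : path <=%O v0 v ->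
  (forall c, \sum_(x | c <= C x) U x <= \sum_(x | c <= D x) U' x + eta) ->
  \sum_x layers v0 v (C x) * U x <= \sum_x layers v0 v (D x) * U' x + (last v0 v - v0) * eta.
Proof.
move=> + H; elim: v v0 => [|v1 v IH] v0 /=.
  by move=> _; rewrite subrr mul0r addr0 !big1 // => x _; rewrite mul0r.
case/andP => h01 /IH IHv.
have E (F G : X -> R) : \sum_x ((v1 - v0) * (v1 <= F x)%R%:R + layers v1 v (F x)) * G x =
   (v1 - v0) * (\sum_(x | v1 <= F x) G x) + \sum_x layers v1 v (F x) * G x.
  rewrite mulr_sumr [X in _ = X + _]big_mkcond -big_split /=; apply: eq_bigr => x _.
  by case: (v1 <= F x); rewrite ?mulr1 ?mulr0 ?add0r // mulrDl.
rewrite !E.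
have := ler_wpM2l (_ : 0 <= v1 - v0) (H v1); rewrite subr_ge0 => /(_ h01); lra.
Qed.

(** The change under a transposition is a product of two differences, so a permutation that
    maximizes the pairing orders [phi] and [U] alike. *)
Lemma perm_pair_sum (phi U : X -> R) (sg : {perm X}) (x y : X) : x != y ->
  \sum_z phi ((tperm x y * sg)%g z) * U z - \sum_z phi (sg z) * U z = (phi (sg y) - phi (sg x)) * (U x - U y).
Proof.
move=> ne; rewrite -sumrB (bigD1 x) //= (bigD1 y) /=; last by rewrite eq_sym.
rewrite big1 ?addr0; last first.
  by move=> z /andP[zx zy]; rewrite permM tpermD 1?eq_sym // subrr.
by rewrite !permM tpermL tpermR; lra.
Qed.

Lemma card_perm_level (phi : X -> R) (sg sg' : {perm X}) (P : pred R) :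
  #|[pred x | P (phi (sg x))]| = #|[pred x | P (phi (sg' x))]|.
Proof.
have H (s : {perm X}) : #|[pred x | P (phi (s x))]| = #|[pred x | P (phi x)]|.
  rewrite -cardsE -[RHS]cardsE.
  have -> : [set x | P (phi (s x))] = s @^-1: [set x | P (phi x)] by apply/setP => x; rewrite !inE.
  by apply: card_preimset; exact: perm_inj.
exact: etrans (H sg) (esym (H sg')).
Qed.

(* By the layer-cake decomposition of [phi]. *)
Lemma majorization (phi U U' : X -> R) (lo hi eta : R) :
  (forall x, lo <= phi x) -> (forall x, phi x <= hi) -> lo <= hi -> 0 <= eta ->
  (forall t, \sum_x Num.max (U x) t <= \sum_x Num.max (U' x) t + eta) ->
  forall sg : {perm X}, exists sg' : {perm X},
    \sum_x phi (sg x) * U x <= \sum_x phi (sg' x) * U' x + (hi - lo) * eta + lo * (\sum_x U x - \sum_x U' x).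
Proof.
move=> hlo hhi lohi eta0 H sg.
case: (@Order.TotalTheory.arg_maxP _ _ _ (1%g : {perm X}) predT (fun s : {perm X} => \sum_x phi (s x) * U' x) isT) => sg' _ opt.
exists sg'.
have ord x y : phi (sg' x) < phi (sg' y) -> U' x <= U' y.
  move=> h; have ne : x != y by apply: contraTneq h => ->; rewrite ltxx.
  have /= := opt (tperm x y * sg')%g isT; rewrite -subr_le0 (perm_pair_sum phi U' sg' ne).
  by rewrite pmulr_rle0 ?subr_le0 // subr_gt0.
have level c : \sum_(x | c <= phi (sg x)) U x <= \sum_(x | c <= phi (sg' x)) U' x + eta.
  have Ecard := card_perm_level phi sg sg' (fun y => ~~ (c <= y)).
  case: (pickP (fun x => c <= phi (sg' x))) => [x1 hx1|none].
    case: (@Order.TotalTheory.arg_minP _ _ _ x1 (fun x => c <= phi (sg' x)) U' hx1) => x2 hx2 min2.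
    (* With [t] the least value of [U'] on the upper level set, truncation at [t] keeps [U'] on that
       set and makes it [t] elsewhere, because [sg'] is optimal. For [U] truncation can only add.
       Both level sets have the same size, so the terms [t] cancel. *)
    set t := U' x2 in min2.
    have D : \sum_x Num.max (U' x) t = \sum_(x | c <= phi (sg' x)) U' x + \sum_(x | ~~ (c <= phi (sg' x))) t.
      rewrite (bigID (fun x => c <= phi (sg' x))) /=; congr (_ + _); apply: eq_bigr => x hx.
        by apply/max_idPl; apply: min2.
      by apply/max_idPr; apply: ord; apply: lt_le_trans hx2; rewrite ltNge.
    have C : \sum_(x | c <= phi (sg x)) U x + \sum_(x | ~~ (c <= phi (sg x))) t <= \sum_x Num.max (U x) t.
      rewrite [leRHS](bigID (fun x => c <= phi (sg x))) /=; apply: lerD; apply: ler_sum => x _.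
        by rewrite le_max lexx.
      by rewrite le_max lexx orbT.
    have E : \sum_(x | ~~ (c <= phi (sg x))) t = \sum_(x | ~~ (c <= phi (sg' x))) t.
      by rewrite !sumr_const; congr (_ *+ _).
    have := H t; rewrite D; move: C; rewrite E; lra.
  rewrite [X in _ <= X + _]big_pred0 // add0r big_pred0 // => x.
  have := card_perm_level phi sg sg' (fun y => c <= y).
  rewrite [X in _ = X]eq_card0; last by move=> z; rewrite inE; exact: none.
  by move/card0_eq/(_ x); rewrite inE.
pose v := sort <=%O [seq phi x | x <- enum X].
have vP x : phi x \in v by rewrite mem_sort map_f // mem_enum.
have pv : path <=%O lo v.
  rewrite (path_sortedE le_trans) (sort_sorted le_total) andbT.
  by apply/allP => y; rewrite mem_sort => /mapP[x _ ->].
have lv : last lo v <= hi.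
  have : last lo v \in lo :: v by exact: mem_last.
  by rewrite inE => /orP[/eqP -> //|]; rewrite mem_sort => /mapP[x _ ->].
have := layers_sum_le pv level.
(* The layers start at [lo]; the constant part of the kernel is put back through the total sums,
   whence the last term of the claim. *)
have E (s : {perm X}) (V : X -> R) : \sum_x layers lo v (phi (s x)) * V x = \sum_x phi (s x) * V x - lo * \sum_x V x.
  rewrite mulr_sumr -sumrB; apply: eq_bigr => x _.
  by rewrite -layersE ?mulrBl // inE vP orbT.
rewrite !E => L.
have : (last lo v - lo) * eta <= (hi - lo) * eta by rewrite ler_wpM2r // lerB.
move: L; lra.
Qed.
End Majorization.
End Rearrangement.

Open Scope R_scope.

(* The complex field and the modulus *)
Declare Scope cplx_scope.
Delimit Scope cplx_scope with X.
Bind Scope cplx_scope with Cplx.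
Infix "+" := Cadd : cplx_scope.
Infix "-" := Csub : cplx_scope.
Infix "*" := Cmul : cplx_scope.
Notation "- z" := (Copp z) : cplx_scope.
Infix "^" := Cpow : cplx_scope.
Notation "0" := (RtoC 0) : cplx_scope.
Notation "1" := (RtoC 1) : cplx_scope.

Definition Cinv (z : Cplx) : Cplx :=
  let d := (Re z * Re z + Im z * Im z)%R in mkC (Re z / d) (- Im z / d).
Definition Cdiv (z w : Cplx) : Cplx := Cmul z (Cinv w).
Infix "/" := Cdiv : cplx_scope.

Lemma Ceq (z w : Cplx) : Re z = Re w -> Im z = Im w -> z = w.
Proof. destruct z, w; simpl; intros -> ->; reflexivity. Qed.

Lemma Csq_pos (z : Cplx) : z <> 0%X -> 0 < Re z * Re z + Im z * Im z.
Proof.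
  intros H. destruct z as [x y]; simpl.
  destruct (Req_dec x 0) as [-> | Hx]; [destruct (Req_dec y 0) as [-> | Hy] |].
  - now elim H.
  - nra.
  - nra.
Qed.

Lemma Cring : ring_theory (RtoC 0) (RtoC 1) Cadd Cmul Csub Copp eq.
Proof.
  split; intros; apply Ceq; simpl; try ring.
Qed.

Lemma Cfield : field_theory (RtoC 0) (RtoC 1) Cadd Cmul Csub Copp Cdiv Cinv eq.
Proof.
  split.
  - exact Cring.
  - intros H; apply (f_equal Re) in H; simpl in H; lra.
  - reflexivity.
  - intros z Hz. apply Csq_pos in Hz. apply Ceq; simpl; field; lra.
Qed.
Add Field Cplx_field : Cfield.

Lemma Ceq_dec (z w : Cplx) : {z = w} + {z <> w}.
Proof.
  destruct (Req_EM_T (Re z) (Re w)); [destruct (Req_EM_T (Im z) (Im w)) |].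
  - left; now apply Ceq.
  - right; congruence.
  - right; congruence.
Defined.

Lemma Cabs_Cmod (z : Cplx) : Cabs z = Cmod (Re z, Im z).
Proof. unfold Cabs, Cmod; simpl. f_equal; ring. Qed.

Lemma Cabs_mul (z w : Cplx) : Cabs (z * w) = Cabs z * Cabs w.
Proof. rewrite !Cabs_Cmod, <- Cmod_mult. reflexivity. Qed.

Lemma Cabs_add (z w : Cplx) : Cabs (z + w) <= Cabs z + Cabs w.
Proof. rewrite !Cabs_Cmod. apply (Cmod_triangle (Re z, Im z) (Re w, Im w)). Qed.

Lemma Cabs_ge0 (z : Cplx) : 0 <= Cabs z.
Proof. apply sqrt_pos. Qed.

Lemma Cabs_RtoC (x : R) : Cabs (RtoC x) = Rabs x.
Proof. unfold Cabs; simpl. rewrite <- sqrt_Rsqr_abs. f_equal; unfold Rsqr; ring. Qed.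

Lemma Cabs_0 : Cabs 0%X = 0.
Proof. rewrite Cabs_RtoC; apply Rabs_R0. Qed.

Lemma Cabs_1 : Cabs 1%X = 1.
Proof. rewrite Cabs_RtoC; apply Rabs_R1. Qed.

Lemma Cabs_opp (z : Cplx) : Cabs (- z) = Cabs z.
Proof. unfold Cabs; simpl. f_equal; ring. Qed.

Lemma Cabs_sub_sym (z w : Cplx) : Cabs (z - w) = Cabs (w - z).
Proof. unfold Cabs; simpl. f_equal; ring. Qed.

Lemma Cabs_sub (z w : Cplx) : Cabs (z - w) <= Cabs z + Cabs w.
Proof. rewrite <- (Cabs_opp w). apply Cabs_add. Qed.

Lemma Cabs_sub_ge (z w : Cplx) : Cabs z - Cabs w <= Cabs (z - w).
Proof.
  assert (H := Cabs_add (z - w) w). replace (z - w + w)%X with z in H by ring. lra.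
Qed.

Lemma Cabs_pos (z : Cplx) : z <> 0%X -> 0 < Cabs z.
Proof. intros H. apply sqrt_lt_R0, Csq_pos, H. Qed.

Lemma Cabs_eq0 (z : Cplx) : Cabs z = 0 -> z = 0%X.
Proof.
  intros H. destruct (Ceq_dec z 0%X) as [|n]; [assumption|].
  apply Cabs_pos in n; lra.
Qed.

Lemma Cabs_neq0 (z : Cplx) : 0 < Cabs z -> z <> 0%X.
Proof. intros H ->. rewrite Cabs_0 in H; lra. Qed.

Lemma Csub_neq0 (z w : Cplx) : z <> w -> (z - w)%X <> 0%X.
Proof. intros H E. apply H. replace z with (z - w + w)%X by ring. rewrite E; ring. Qed.

Lemma Csub_eq0 (z w : Cplx) : (z - w)%X = 0%X -> z = w.
Proof. intros E. replace z with (z - w + w)%X by ring. rewrite E; ring. Qed.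

Lemma Cmul_neq0 (z w : Cplx) : z <> 0%X -> w <> 0%X -> (z * w)%X <> 0%X.
Proof.
  intros Hz Hw. apply Cabs_neq0. rewrite Cabs_mul.
  apply Rmult_lt_0_compat; now apply Cabs_pos.
Qed.

Lemma Cabs_sq (z : Cplx) : Cabs z * Cabs z = Re z * Re z + Im z * Im z.
Proof. apply sqrt_sqrt. nra. Qed.

Lemma Re_le_Cabs (z : Cplx) : Rabs (Re z) <= Cabs z.
Proof.
  apply Rsqr_incr_0_var; [|apply Cabs_ge0].
  rewrite <- Rsqr_abs. unfold Rsqr. rewrite Cabs_sq. nra.
Qed.

Lemma Im_le_Cabs (z : Cplx) : Rabs (Im z) <= Cabs z.
Proof.
  apply Rsqr_incr_0_var; [|apply Cabs_ge0].
  rewrite <- Rsqr_abs. unfold Rsqr. rewrite Cabs_sq. nra.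
Qed.

Lemma Cabs_le_ReIm (z : Cplx) : Cabs z <= Rabs (Re z) + Rabs (Im z).
Proof.
  assert (H1 := Rabs_pos (Re z)). assert (H2 := Rabs_pos (Im z)).
  apply Rsqr_incr_0_var; [|lra].
  unfold Rsqr. rewrite Cabs_sq.
  assert (E1 : Re z * Re z = Rabs (Re z) * Rabs (Re z)) by (rewrite <- Rabs_mult; symmetry; apply Rabs_pos_eq; nra).
  assert (E2 : Im z * Im z = Rabs (Im z) * Rabs (Im z)) by (rewrite <- Rabs_mult; symmetry; apply Rabs_pos_eq; nra).
  nra.
Qed.

Lemma Cabs_inv (z : Cplx) : z <> 0%X -> Cabs (Cinv z) = / Cabs z.
Proof.
  intros H. assert (H1 := Cabs_pos z H).
  apply Rmult_eq_reg_l with (Cabs z); [|lra].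
  rewrite <- Cabs_mul, Rinv_r by lra.
  replace (z * Cinv z)%X with 1%X by (field; exact H). apply Cabs_1.
Qed.

Lemma Cabs_div (z w : Cplx) : w <> 0%X -> Cabs (z / w) = Cabs z / Cabs w.
Proof. intros H. unfold Cdiv. rewrite Cabs_mul, Cabs_inv by exact H. reflexivity. Qed.

Lemma Cabs_pow (z : Cplx) (n : nat) : Cabs (z ^ n) = (Cabs z ^ n)%R.
Proof. induction n; simpl; [apply Cabs_1 | rewrite Cabs_mul, IHn; reflexivity]. Qed.

Lemma Cpow_add (z : Cplx) (m n : nat) : (z ^ (m + n))%X = (z ^ m * z ^ n)%X.
Proof. induction m; simpl; [ring | rewrite IHm; ring]. Qed.

Lemma Cpow_mul_base (z w : Cplx) (n : nat) : ((z * w) ^ n)%X = (z ^ n * w ^ n)%X.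
Proof. induction n; simpl; [ring | rewrite IHn; ring]. Qed.

Lemma Cpow_neq0 (z : Cplx) (n : nat) : z <> 0%X -> (z ^ n)%X <> 0%X.
Proof.
  intros H. apply Cabs_neq0. rewrite Cabs_pow. apply pow_lt, Cabs_pos, H.
Qed.

Lemma RtoC_mul (x y : R) : RtoC (x * y) = (RtoC x * RtoC y)%X.
Proof. apply Ceq; simpl; ring. Qed.

Lemma RtoC_pow (x : R) (n : nat) : RtoC (x ^ n) = (RtoC x ^ n)%X.
Proof. induction n; simpl; [reflexivity | rewrite RtoC_mul, IHn; reflexivity]. Qed.

(** * Finite sums and products *)

Fixpoint rsum (n : nat) (f : nat -> R) : R :=
  match n with O => 0 | S k => rsum k f + f k end.

Fixpoint csum (n : nat) (F : nat -> Cplx) : Cplx :=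
  match n with O => RtoC 0 | S k => Cadd (csum k F) (F k) end.

Fixpoint cprod (n : nat) (F : nat -> Cplx) : Cplx :=
  match n with O => RtoC 1 | S k => Cmul (cprod k F) (F k) end.

Lemma rsum_ext (n : nat) (f g : nat -> R) :
  (forall k, (k < n)%nat -> f k = g k) -> rsum n f = rsum n g.
Proof. intros H. induction n; simpl; [reflexivity|]. rewrite IHn, H by auto; reflexivity. Qed.

Lemma csum_ext (n : nat) (f g : nat -> Cplx) :
  (forall k, (k < n)%nat -> f k = g k) -> csum n f = csum n g.
Proof. intros H. induction n; simpl; [reflexivity|]. rewrite IHn, H by auto; reflexivity. Qed.

Lemma cprod_ext (n : nat) (f g : nat -> Cplx) :
  (forall k, (k < n)%nat -> f k = g k) -> cprod n f = cprod n g.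
Proof. intros H. induction n; simpl; [reflexivity|]. rewrite IHn, H by auto; reflexivity. Qed.

Lemma rsum_plus (n : nat) (f g : nat -> R) : rsum n (fun k => f k + g k) = rsum n f + rsum n g.
Proof. induction n; simpl; [ring | rewrite IHn; ring]. Qed.

Lemma rsum_minus (n : nat) (f g : nat -> R) : rsum n (fun k => f k - g k) = rsum n f - rsum n g.
Proof. induction n; simpl; [ring | rewrite IHn; ring]. Qed.

Lemma rsum_scal (n : nat) (c : R) (f : nat -> R) : rsum n (fun k => c * f k) = c * rsum n f.
Proof. induction n; simpl; [ring | rewrite IHn; ring]. Qed.

Lemma rsum_const (n : nat) (c : R) : rsum n (fun _ => c) = INR n * c.
Proof. induction n; [simpl; ring | rewrite S_INR; simpl; rewrite IHn; ring]. Qed.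

Lemma rsum_le (n : nat) (f g : nat -> R) :
  (forall k, (k < n)%nat -> f k <= g k) -> rsum n f <= rsum n g.
Proof.
  intros H. induction n; simpl; [lra|].
  assert (H1 := IHn (fun k Hk => H k (Nat.lt_lt_succ_r _ _ Hk))). assert (H2 := H n (Nat.lt_succ_diag_r n)). lra.
Qed.

Lemma rsum_abs (n : nat) (f : nat -> R) : Rabs (rsum n f) <= rsum n (fun k => Rabs (f k)).
Proof.
  induction n; simpl; [rewrite Rabs_R0; lra|].
  eapply Rle_trans; [apply Rabs_triang|]. lra.
Qed.

Lemma rsum_le_const (n : nat) (f : nat -> R) (c : R) :
  (forall k, (k < n)%nat -> f k <= c) -> rsum n f <= INR n * c.
Proof. intros H. rewrite <- rsum_const. now apply rsum_le. Qed.

Lemma rsum_swap (n m : nat) (f : nat -> nat -> R) :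
  rsum n (fun i => rsum m (fun j => f i j)) = rsum m (fun j => rsum n (fun i => f i j)).
Proof.
  induction n; simpl.
  - rewrite rsum_const; ring.
  - rewrite IHn, rsum_plus; reflexivity.
Qed.

Lemma csum_plus (n : nat) (f g : nat -> Cplx) :
  csum n (fun k => (f k + g k)%X) = (csum n f + csum n g)%X.
Proof. induction n; simpl; [ring | rewrite IHn; ring]. Qed.

Lemma csum_scal (n : nat) (c : Cplx) (f : nat -> Cplx) :
  csum n (fun k => (c * f k)%X) = (c * csum n f)%X.
Proof. induction n; simpl; [ring | rewrite IHn; ring]. Qed.

Lemma csum_swap (n m : nat) (f : nat -> nat -> Cplx) :
  csum n (fun i => csum m (fun j => f i j)) = csum m (fun j => csum n (fun i => f i j)).
Proof.
  induction n; simpl.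
  - induction m; simpl; [reflexivity | rewrite <- IHm; ring].
  - rewrite IHn, csum_plus; reflexivity.
Qed.

Lemma Re_csum (n : nat) (F : nat -> Cplx) : Re (csum n F) = rsum n (fun k => Re (F k)).
Proof. induction n; simpl; [reflexivity | rewrite IHn; reflexivity]. Qed.

Lemma csum_abs (n : nat) (F : nat -> Cplx) : Cabs (csum n F) <= rsum n (fun k => Cabs (F k)).
Proof.
  induction n; simpl; [rewrite Cabs_0; lra|].
  eapply Rle_trans; [apply Cabs_add|]. lra.
Qed.

Lemma cprod_neq0 (n : nat) (F : nat -> Cplx) :
  (forall k, (k < n)%nat -> F k <> 0%X) -> cprod n F <> 0%X.
Proof.
  intros H. induction n; simpl.
  - intros E; apply (f_equal Re) in E; simpl in E; lra.
  - apply Cmul_neq0; auto.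
Qed.

Lemma ln_Cabs_cprod (n : nat) (F : nat -> Cplx) :
  (forall k, (k < n)%nat -> F k <> 0%X) ->
  ln (Cabs (cprod n F)) = rsum n (fun k => ln (Cabs (F k))).
Proof.
  intros H. induction n; simpl.
  - rewrite Cabs_1; apply ln_1.
  - rewrite Cabs_mul, ln_mult, IHn; auto using Cabs_pos.
    apply Cabs_pos, cprod_neq0; auto.
Qed.

Lemma csum_geom (n : nat) (z : Cplx) : ((1 - z) * csum n (fun k => z ^ k) = 1 - z ^ n)%X.
Proof.
  induction n; simpl; [ring|].
  transitivity ((1 - z) * csum n (fun k => z ^ k) + (1 - z) * z ^ n)%X; [ring|].
  rewrite IHn. ring.
Qed.

Lemma csum_const (n : nat) (c : Cplx) : csum n (fun _ => c) = (RtoC (INR n) * c)%X.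
Proof.
  induction n; [apply Ceq; simpl; ring|]. rewrite S_INR. simpl csum. rewrite IHn.
  replace (RtoC (INR n + 1)) with (RtoC (INR n) + 1)%X by (apply Ceq; simpl; ring). ring.
Qed.

Lemma csum_shift (n : nat) (F : nat -> Cplx) : csum (S n) F = (F O + csum n (fun k => F (S k)))%X.
Proof.
  induction n; [simpl; ring|]. change (csum (S (S n)) F) with (csum (S n) F + F (S n))%X. rewrite IHn. simpl. ring.
Qed.

(** * Roots of unity *)

Definition cis (t : R) : Cplx := mkC (cos t) (sin t).

Lemma cis_add (s t : R) : cis (s + t) = (cis s * cis t)%X.
Proof. apply Ceq; simpl; [rewrite cos_plus | rewrite sin_plus]; ring. Qed.

Lemma cis_0 : cis 0 = 1%X.
Proof. apply Ceq; simpl; [apply cos_0 | apply sin_0]. Qed.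

Lemma Cabs_cis (t : R) : Cabs (cis t) = 1.
Proof.
  unfold Cabs; simpl. replace (cos t * cos t + sin t * sin t) with 1; [apply sqrt_1|].
  rewrite <- (sin2_cos2 t). unfold Rsqr; ring.
Qed.

Lemma cis_neq0 (t : R) : cis t <> 0%X.
Proof. apply Cabs_neq0. rewrite Cabs_cis; lra. Qed.

Lemma cis_pow (t : R) (n : nat) : (cis t ^ n)%X = cis (INR n * t).
Proof.
  induction n; [simpl; rewrite Rmult_0_l, cis_0; reflexivity|].
  rewrite S_INR. simpl Cpow. rewrite IHn, <- cis_add. f_equal; ring.
Qed.

Lemma cis_2PI_nat (k : nat) : cis (2 * PI * INR k) = 1%X.
Proof.
  induction k; [simpl; rewrite Rmult_0_r; apply cis_0|].
  rewrite S_INR. replace (2 * PI * (INR k + 1)) with (2 * PI * INR k + 2 * PI) by ring.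
  rewrite cis_add, IHk. apply Ceq; simpl; rewrite ?cos_2PI, ?sin_2PI; ring.
Qed.

Lemma cos_neq1 (t : R) : 0 < t < 2 * PI -> cos t <> 1.
Proof.
  intros H E.
  replace t with (2 * (t / 2)) in E by field. rewrite cos_2a_sin in E.
  assert (0 < sin (t / 2)) by (apply sin_gt_0; lra). nra.
Qed.

Lemma cis_neq1 (t : R) : 0 < t < 2 * PI -> cis t <> 1%X.
Proof. intros H E. apply (cos_neq1 t H). now apply (f_equal Re) in E. Qed.

Lemma cis_neg_eq1 (t : R) : cis (- t) = 1%X -> cis t = 1%X.
Proof.
  intros E. replace 1%X with (cis (t + - t)) by (rewrite Rplus_opp_r; apply cis_0).
  rewrite cis_add, E. ring.
Qed.

Definition rootu (n k : nat) : Cplx := cis (2 * PI * INR k / INR n).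

Lemma rootu_pow (n k i : nat) : (rootu n k ^ i)%X = cis (INR k * (2 * PI * INR i / INR n)).
Proof. unfold rootu. rewrite cis_pow. f_equal. unfold Rdiv; ring. Qed.

Lemma Cabs_rootu (n k : nat) : Cabs (rootu n k) = 1.
Proof. apply Cabs_cis. Qed.

Lemma csum_cis (n : nat) (t : R) :
  cis t <> 1%X -> cis (INR n * t) = 1%X -> csum n (fun k => cis (INR k * t)) = 0%X.
Proof.
  intros H E.
  assert (G := csum_geom n (cis t)).
  rewrite cis_pow, E in G.
  rewrite (csum_ext n _ (fun k => (cis t ^ k)%X)) by (intros; symmetry; apply cis_pow).
  assert (Hn : (1 - cis t)%X <> 0%X) by (apply Csub_neq0; auto).
  replace (csum n (fun k => (cis t ^ k)%X)) with
    (((1 - cis t) * csum n (fun k => cis t ^ k)) / (1 - cis t))%X by (field; exact Hn).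
  rewrite G. field; exact Hn.
Qed.

Lemma csum_rootu_pow (n i : nat) :
  (0 < i < n)%nat -> csum n (fun k => (rootu n k ^ i)%X) = 0%X.
Proof.
  intros H.
  assert (Hn : 0 < INR n) by (apply lt_0_INR; lia).
  rewrite (csum_ext n _ (fun k => cis (INR k * (2 * PI * INR i / INR n)))) by (intros; apply rootu_pow).
  apply csum_cis.
  - apply cis_neq1. assert (HP := PI_RGT_0).
    assert (0 < INR i) by (apply lt_0_INR; lia).
    assert (INR i < INR n) by (apply lt_INR; lia).
    split.
    + apply Rdiv_lt_0_compat; nra.
    + apply Rmult_lt_reg_r with (INR n); [lra|]. unfold Rdiv. rewrite Rmult_assoc, Rinv_l by lra. nra.
  - replace (INR n * (2 * PI * INR i / INR n)) with (2 * PI * INR i) by (field; lra).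
    apply cis_2PI_nat.
Qed.

Lemma cprod_linear_expand (n : nat) (a : nat -> Cplx) :
  exists q : nat -> Cplx, forall x, cprod n (fun k => (x - a k)%X) = (csum n (fun i => q i * x ^ i) + x ^ n)%X.
Proof.
  induction n as [|n [q Hq]]; simpl.
  - exists (fun _ => 0%X). intros; ring.
  - exists (fun i => ((match i with O => 0%X | S j => q j end) -
                 a n * (if Nat.eqb i n then 1%X else q i))%X).
    intros x. rewrite Hq.
    assert (E : forall m, csum (S m) (fun i => (match i with O => 0%X | S j => q j end) * x ^ i)%X =
                     (x * csum m (fun i => q i * x ^ i))%X).
    { induction m; [simpl; ring|].
      change (csum (S (S m)) (fun i : nat => ((match i with O => 0%X | S j => q j end) * x ^ i)%X)) with
        (csum (S m) (fun i => (match i with O => 0%X | S j => q j end) * x ^ i)%X + q m * x ^ (S m))%X.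
      rewrite IHm. simpl. ring. }
    change (csum n (fun i => (((match i with O => 0%X | S j => q j end) - a n * (if Nat.eqb i n then 1%X else q i)) * x ^ i)%X) +
      ((match n with O => 0%X | S j => q j end) - a n * (if Nat.eqb n n then 1%X else q n)) * x ^ n)%X with
      (csum (S n) (fun i => (((match i with O => 0%X | S j => q j end) - a n * (if Nat.eqb i n then 1%X else q i)) * x ^ i)%X)).
    rewrite (csum_ext (S n) _ (fun i => ((match i with O => 0%X | S j => q j end) * x ^ i) +
         (- a n) * ((if Nat.eqb i n then 1%X else q i) * x ^ i))%X) by (intros; ring).
    rewrite csum_plus, E, csum_scal. simpl csum. rewrite ?Nat.eqb_refl.
    rewrite (csum_ext n (fun i => ((if Nat.eqb i n then 1%X else q i) * x ^ i)%X) (fun i => (q i * x ^ i)%X)).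
    + ring.
    + intros k Hk. replace (Nat.eqb k n) with false; [reflexivity|].
      symmetry; apply Nat.eqb_neq; lia.
Qed.

Lemma csum_0 (n : nat) (F : nat -> Cplx) : (forall k, (k < n)%nat -> F k = 0%X) -> csum n F = 0%X.
Proof. intros H. induction n; simpl; [reflexivity|]. rewrite IHn, H; auto; ring. Qed.

Lemma cprod_shift (n : nat) (F : nat -> Cplx) :
  cprod (S n) F = (F O * cprod n (fun k => F (S k)))%X.
Proof.
  induction n; [simpl; ring|].
  change (cprod (S (S n)) F) with (cprod (S n) F * F (S n))%X. rewrite IHn. simpl. ring.
Qed.

Lemma rootu_S (n k : nat) : (0 < n)%nat -> rootu n (S k) = (rootu n 1 * rootu n k)%X.
Proof.
  intros H. unfold rootu. rewrite <- cis_add. f_equal. rewrite S_INR. simpl INR.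
  field. apply not_0_INR; lia.
Qed.

Lemma rootu_n (n : nat) : (0 < n)%nat -> rootu n n = 1%X.
Proof.
  intros H. unfold rootu. rewrite <- (cis_2PI_nat 1). f_equal. simpl.
  field. apply not_0_INR; lia.
Qed.

Lemma rootu_0 (n : nat) : rootu n 0 = 1%X.
Proof. unfold rootu. unfold Rdiv. rewrite Rmult_0_r, Rmult_0_l. apply cis_0. Qed.

Lemma rootu_pow_n (n k : nat) : (0 < n)%nat -> (rootu n k ^ n)%X = 1%X.
Proof.
  intros H. rewrite rootu_pow. rewrite <- (cis_2PI_nat k). f_equal. field. apply not_0_INR; lia.
Qed.

Lemma cprod_const_mul (n : nat) (c : Cplx) (F : nat -> Cplx) :
  cprod n (fun k => (c * F k)%X) = (c ^ n * cprod n F)%X.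
Proof. induction n; simpl; [ring | rewrite IHn; ring]. Qed.

(** The rotation shifts the factors cyclically; the one lost at the end comes back as the factor of
    index 0. *)
Lemma cprod_rootu_rot (n : nat) (x : Cplx) :
  (0 < n)%nat -> cprod n (fun k => (rootu n 1 * x - rootu n k)%X) = cprod n (fun k => (x - rootu n k)%X).
Proof.
  intros H. destruct n as [|n]; [lia|].
  rewrite cprod_shift.
  rewrite (cprod_ext n _ (fun k => (rootu (S n) 1 * (x - rootu (S n) k))%X))
    by (intros; rewrite (rootu_S (S n) k) by lia; ring).
  rewrite cprod_const_mul.
  simpl cprod at 2.
  replace (rootu (S n) 1 * x - rootu (S n) 0)%X with (rootu (S n) 1 * (x - rootu (S n) n))%X.
  - transitivity (rootu (S n) 1 ^ (S n) * (cprod n (fun k => x - rootu (S n) k) * (x - rootu (S n) n)))%X.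
    + simpl. ring.
    + rewrite rootu_pow_n by lia. ring.
  - transitivity (rootu (S n) 1 * x - rootu (S n) 1 * rootu (S n) n)%X; [ring|].
    rewrite <- rootu_S by lia. rewrite rootu_n, rootu_0 by lia. reflexivity.
Qed.

Lemma cprod_rootu_rot_k (n j : nat) (x : Cplx) :
  (0 < n)%nat -> cprod n (fun k => (rootu n j * x - rootu n k)%X) = cprod n (fun k => (x - rootu n k)%X).
Proof.
  intros H. induction j.
  - rewrite rootu_0. apply cprod_ext; intros; ring.
  - rewrite <- IHj, <- (cprod_rootu_rot n (rootu n j * x)) by exact H.
    apply cprod_ext; intros. rewrite (rootu_S n j) by exact H. ring.
Qed.

(* Averaging over the rotations [x -> rootu n j * x], which fix the product, kills all the
   intermediate coefficients. *)
Lemma cprod_rootu (n : nat) (x : Cplx) :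
  (0 < n)%nat -> cprod n (fun k => (x - rootu n k)%X) = (x ^ n - 1)%X.
Proof.
  intros H. destruct (cprod_linear_expand n (rootu n)) as [q Hq].
  assert (Hn : RtoC (INR n) <> 0%X).
  { intros E. apply (f_equal Re) in E. apply not_0_INR in E; [exact E | lia]. }
  assert (A : forall y, cprod n (fun k => (y - rootu n k)%X) = (q O + y ^ n)%X).
  { intros y.
    assert (S1 : csum n (fun j => cprod n (fun k => (rootu n j * y - rootu n k)%X)) =
                 (RtoC (INR n) * cprod n (fun k => y - rootu n k))%X).
    { rewrite <- csum_const. apply csum_ext. intros; now apply cprod_rootu_rot_k. }
    rewrite (csum_ext n _ (fun j => (csum n (fun i => q i * y ^ i * rootu n j ^ i) + y ^ n)%X)) in S1.
    2:{ intros j _. rewrite Hq. rewrite Cpow_mul_base, rootu_pow_n by exact H.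
        replace (1 * y ^ n)%X with (y ^ n)%X by ring. f_equal.
        apply csum_ext. intros; rewrite Cpow_mul_base; ring. }
    rewrite csum_plus, csum_const, csum_swap in S1.
    rewrite (csum_ext n _ (fun i => (q i * y ^ i * csum n (fun j => rootu n j ^ i))%X)) in S1
      by (intros; apply csum_scal).
    destruct n as [|n']; [lia|].
    rewrite csum_shift in S1. simpl Cpow in S1 at 1 2.
    rewrite (csum_0 n') in S1.
    2:{ intros k Hk. rewrite csum_rootu_pow by lia. ring. }
    rewrite csum_const in S1.
    set (P := cprod (S n') (fun k : nat => (y - rootu (S n') k)%X)) in *.
    replace P with ((RtoC (INR (S n')) * P) / RtoC (INR (S n')))%X by (field; exact Hn).
    rewrite <- S1. field. exact Hn. }
  (* At 1 the factor of index 0 vanishes, which determines the constant coefficient. *)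
  assert (A1 := A 1%X).
  assert (E : cprod n (fun k => (1 - rootu n k)%X) = 0%X).
  { destruct n as [|n']; [lia|]. rewrite cprod_shift, rootu_0. ring. }
  rewrite E in A1.
  replace (1 ^ n)%X with 1%X in A1.
  - rewrite A. replace (q O) with (q O + 1 - 1)%X by ring. rewrite <- A1. ring.
  - clear. induction n; simpl; [reflexivity | rewrite <- IHn; ring].
Qed.

Lemma cprod_rootu_sub (n : nat) (x y : Cplx) :
  (0 < n)%nat -> cprod n (fun k => (x - rootu n k * y)%X) = (x ^ n - y ^ n)%X.
Proof.
  intros H. destruct (Ceq_dec y 0%X) as [-> | Hy].
  - rewrite (cprod_ext n _ (fun _ => (x * 1)%X)) by (intros; ring).
    rewrite cprod_const_mul.
    assert (E : forall m, cprod m (fun _ => 1%X) = 1%X).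
    { induction m; simpl; [reflexivity | rewrite IHm; ring]. }
    rewrite E. destruct n; [lia | simpl; ring].
  - rewrite (cprod_ext n _ (fun k => (y * (x / y - rootu n k))%X)) by (intros; field; exact Hy).
    rewrite cprod_const_mul, cprod_rootu by exact H.
    assert (E : ((x / y) ^ n * y ^ n)%X = (x ^ n)%X).
    { rewrite <- Cpow_mul_base. f_equal. field; exact Hy. }
    transitivity ((x / y) ^ n * y ^ n - y ^ n)%X; [ring | rewrite E; reflexivity].
Qed.

(** Passing to the modulus removes the sign [(-1) ^ n]. *)
Lemma cprod_sub_rootu (n : nat) (x y : Cplx) :
  (0 < n)%nat -> Cabs (cprod n (fun k => (rootu n k * x - y)%X)) = Cabs (x ^ n - y ^ n)%X.
Proof.
  intros H. rewrite (cprod_ext n _ (fun k => ((RtoC (-1)) * (y - rootu n k * x))%X))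
    by (intros; apply Ceq; simpl; ring).
  rewrite cprod_const_mul, cprod_rootu_sub by exact H.
  rewrite Cabs_mul, Cabs_pow, Cabs_RtoC.
  replace (Rabs (-1)) with 1 by (rewrite Rabs_left; lra).
  rewrite pow1, Rmult_1_l. apply Cabs_sub_sym.
Qed.

(** * Goursat's theorem *)

Lemma continuous_eps (f : R -> R) (x : R) :
  (forall eps, 0 < eps -> exists del, 0 < del /\ forall h, Rabs h < del -> Rabs (f (x + h) - f x) <= eps) ->
  continuous f x.
Proof.
  intros H. apply continuity_pt_filterlim. intros eps He.
  destruct (H (eps / 2)) as [del [Hd Hh]]; [lra|].
  exists del. split; [exact Hd|]. intros y [_ Hy]. simpl in *. unfold R_dist in *.
  specialize (Hh (y - x) Hy). replace (x + (y - x)) with y in Hh by ring. lra.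
Qed.

Lemma RInt_near_const (f : R -> R) (a b k M : R) :
  a <= b -> ex_RInt f a b -> (forall t, a <= t <= b -> Rabs (f t - k) <= M) ->
  Rabs (RInt f a b - k * (b - a)) <= M * (b - a).
Proof.
  intros Hab Hf HM.
  assert (E : RInt (fun t => f t - k) a b = RInt f a b - k * (b - a)).
  { rewrite (RInt_minus f (fun _ => k)) by (auto; apply ex_RInt_const).
    rewrite RInt_const. unfold minus, plus, opp, scal; simpl. unfold mult; simpl. ring. }
  rewrite <- E, Rmult_comm. apply abs_RInt_le_const; auto.
  apply (ex_RInt_minus f (fun _ => k)); auto. apply ex_RInt_const.
Qed.

(* Frechet differentiability of the 1-form [A dx + B dy] at a point, with [dA/dy = dB/dx] there. *)
Definition closed_at (A B : R -> R -> R) (x y : R) : Prop :=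
  exists p s u, forall eps, 0 < eps -> exists del, 0 < del /\ forall h k, Rabs h < del -> Rabs k < del ->
    Rabs (A (x + h) (y + k) - A x y - p * h - s * k) <= eps * (Rabs h + Rabs k) /\
    Rabs (B (x + h) (y + k) - B x y - s * h - u * k) <= eps * (Rabs h + Rabs k).

Definition rectint (A B : R -> R -> R) (a b c d : R) : R :=
  RInt (fun x => A x c) a b + RInt (fun y => B b y) c d
  - RInt (fun x => A x d) a b - RInt (fun y => B a y) c d.

Lemma lin_bound_continuous (f : R -> R) (x p eps0 del0 : R) :
  0 < del0 -> (forall h, Rabs h < del0 -> Rabs (f (x + h) - f x - p * h) <= eps0 * Rabs h) ->
  continuous f x.
Proof.
  intros Hd H. apply continuous_eps. intros eps He.
  assert (Hp := Rabs_pos p). assert (He0 := Rabs_pos eps0).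
  exists (Rmin del0 (eps / (Rabs p + Rabs eps0 + 1))). split.
  - apply Rmin_pos; [exact Hd | apply Rdiv_lt_0_compat; lra].
  - intros h Hh.
    assert (H1 := H h (Rlt_le_trans _ _ _ Hh (Rmin_l _ _))).
    assert (H2 : Rabs h < eps / (Rabs p + Rabs eps0 + 1)) by (eapply Rlt_le_trans; [exact Hh | apply Rmin_r]).
    apply Rlt_le in H2.
    apply (Rmult_le_compat_r (Rabs p + Rabs eps0 + 1)) in H2; [|lra].
    replace (eps / (Rabs p + Rabs eps0 + 1) * (Rabs p + Rabs eps0 + 1)) with eps in H2 by (field; lra).
    assert (H3 := Rabs_pos h).
    replace (f (x + h) - f x) with ((f (x + h) - f x - p * h) + p * h) by ring.
    eapply Rle_trans; [apply Rabs_triang|]. rewrite Rabs_mult.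
    assert (eps0 * Rabs h <= Rabs eps0 * Rabs h) by (apply Rmult_le_compat_r; [lra | apply Rle_abs]).
    nra.
Qed.

Lemma closed_at_continuous (A B : R -> R -> R) (x y : R) :
  closed_at A B x y ->
  continuous (fun t => A t y) x /\ continuous (fun t => A x t) y /\
  continuous (fun t => B t y) x /\ continuous (fun t => B x t) y.
Proof.
  intros (p & s & u & H). destruct (H 1 Rlt_0_1) as [del [Hd Hh]].
  repeat split.
  - apply (lin_bound_continuous _ x p 1 del Hd). intros h H1.
    destruct (Hh h 0 H1) as [H2 _]; [rewrite Rabs_R0; lra|].
    rewrite Rabs_R0 in H2. rewrite !Rplus_0_r in H2. rewrite Rmult_0_r, Rminus_0_r in H2. exact H2.
  - apply (lin_bound_continuous _ y s 1 del Hd). intros h H1.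
    destruct (Hh 0 h) as [H2 _]; [rewrite Rabs_R0; lra | exact H1|].
    rewrite Rabs_R0 in H2. rewrite Rplus_0_r, Rplus_0_l in H2. rewrite Rmult_0_r, Rminus_0_r in H2. exact H2.
  - apply (lin_bound_continuous _ x s 1 del Hd). intros h H1.
    destruct (Hh h 0 H1) as [_ H2]; [rewrite Rabs_R0; lra|].
    rewrite Rabs_R0 in H2. rewrite !Rplus_0_r in H2. rewrite Rmult_0_r, Rminus_0_r in H2. exact H2.
  - apply (lin_bound_continuous _ y u 1 del Hd). intros h H1.
    destruct (Hh 0 h) as [_ H2]; [rewrite Rabs_R0; lra | exact H1|].
    rewrite Rabs_R0 in H2. rewrite Rplus_0_r, Rplus_0_l in H2. rewrite Rmult_0_r, Rminus_0_r in H2. exact H2.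
Qed.

Section Rectangles.
Variables (A B : R -> R -> R) (a0 b0 c0 d0 : R).
Hypothesis Hclosed : forall x y, a0 <= x <= b0 -> c0 <= y <= d0 -> closed_at A B x y.

Definition subrect (a b c d : R) : Prop := a0 <= a /\ a <= b /\ b <= b0 /\ c0 <= c /\ c <= d /\ d <= d0.

Lemma exA (a b c d y : R) : subrect a b c d -> c <= y <= d -> ex_RInt (fun x => A x y) a b.
Proof.
  intros S Hy. apply (@ex_RInt_continuous R_CompleteNormedModule). intros x Hx. unfold subrect in S.
  rewrite Rmin_left, Rmax_right in Hx by lra.
  apply (closed_at_continuous A B x y). apply Hclosed; lra.
Qed.

Lemma exB (a b c d x : R) : subrect a b c d -> a <= x <= b -> ex_RInt (fun y => B x y) c d.
Proof.
  intros S Hx. apply (@ex_RInt_continuous R_CompleteNormedModule). intros y Hy. unfold subrect in S.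
  rewrite Rmin_left, Rmax_right in Hy by lra.
  apply (closed_at_continuous A B x y). apply Hclosed; lra.
Qed.

Lemma rectint_split (a b c d m n : R) :
  subrect a b c d -> a <= m <= b -> c <= n <= d ->
  rectint A B a b c d = rectint A B a m c n + rectint A B m b c n + rectint A B a m n d + rectint A B m b n d.
Proof.
  intros S Hm Hn. unfold rectint.
  assert (S' := S). unfold subrect in S'.
  assert (CA : forall y, c <= y <= d -> RInt (fun x => A x y) a b = RInt (fun x => A x y) a m + RInt (fun x => A x y) m b).
  { intros y Hy. symmetry. apply (RInt_Chasles (fun x => A x y) a m b);
      eapply (exA _ _ c d); unfold subrect; lra. }
  assert (CB : forall x, a <= x <= b -> RInt (fun y => B x y) c d = RInt (fun y => B x y) c n + RInt (fun y => B x y) n d).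
  { intros x Hx. symmetry. apply (RInt_Chasles (fun y => B x y) c n d);
      eapply (exB a b); unfold subrect; lra. }
  rewrite (CA c), (CA d), (CB a), (CB b) by lra. ring.
Qed.

Definition rect := (R * R * R * R)%type.
Definition rint (q : rect) : R := match q with (a, b, c, d) => rectint A B a b c d end.

(** The last quarter is the default: the boundary integral is additive, so if none of the first
    three carries a quarter of its modulus, the last one does. *)
Definition bisect (q : rect) : rect :=
  match q with (a, b, c, d) =>
    let m := (a + b) / 2 in let n := (c + d) / 2 in
    if Rle_dec (Rabs (rint q)) (4 * Rabs (rint (a, m, c, n))) then (a, m, c, n)
    else if Rle_dec (Rabs (rint q)) (4 * Rabs (rint (m, b, c, n))) then (m, b, c, n)
    else if Rle_dec (Rabs (rint q)) (4 * Rabs (rint (a, m, n, d))) then (a, m, n, d)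
    else (m, b, n, d)
  end.

Definition issub (q : rect) : Prop := match q with (a, b, c, d) => subrect a b c d end.

Definition within (q q' : rect) : Prop :=
  match q, q' with (a, b, c, d), (a', b', c', d') =>
    a <= a' /\ b' <= b /\ c <= c' /\ d' <= d /\ b' - a' = (b - a) / 2 /\ d' - c' = (d - c) / 2 end.

Lemma bisect_spec (q : rect) :
  issub q -> issub (bisect q) /\ within q (bisect q) /\ Rabs (rint q) <= 4 * Rabs (rint (bisect q)).
Proof.
  destruct q as [[[a b] c] d]. intros S. simpl in S.
  assert (S' := S). unfold subrect in S'.
  assert (E : rint (a, b, c, d) = rint (a, (a+b)/2, c, (c+d)/2) + rint ((a+b)/2, b, c, (c+d)/2) +
     rint (a, (a+b)/2, (c+d)/2, d) + rint ((a+b)/2, b, (c+d)/2, d)).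
  { apply rectint_split; [exact S | lra | lra]. }
  unfold bisect.
  destruct (Rle_dec _ _) as [H1|H1]; [|destruct (Rle_dec _ _) as [H2|H2]; [|destruct (Rle_dec _ _) as [H3|H3]]];
    (split; [simpl; unfold subrect; lra | split; [simpl; lra | try assumption]]).
  set (q := rint (a, b, c, d)) in *. set (q1 := rint (a, (a+b)/2, c, (c+d)/2)) in *.
  set (q2 := rint ((a+b)/2, b, c, (c+d)/2)) in *. set (q3 := rint (a, (a+b)/2, (c+d)/2, d)) in *.
  set (q4 := rint ((a+b)/2, b, (c+d)/2, d)) in *.
  assert (T : Rabs q <= Rabs q1 + Rabs q2 + Rabs q3 + Rabs q4).
  { rewrite E. eapply Rle_trans; [apply Rabs_triang|]. apply Rplus_le_compat_r.
    eapply Rle_trans; [apply Rabs_triang|]. apply Rplus_le_compat_r. apply Rabs_triang. }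
  lra.
Qed.

Fixpoint bisn (n : nat) : rect := match n with O => (a0, b0, c0, d0) | S k => bisect (bisn k) end.

Lemma nested_point (u v : nat -> R) :
  (forall n, u n <= u (S n)) -> (forall n, v (S n) <= v n) -> (forall n, u n <= v n) ->
  exists x, forall n, u n <= x <= v n.
Proof.
  intros Hu Hv Huv.
  assert (Mu : forall n k, u n <= u (n + k)%nat).
  { intros n k; induction k; [rewrite Nat.add_0_r; lra|]. rewrite Nat.add_succ_r. specialize (Hu (n + k)%nat). lra. }
  assert (Mv : forall n k, v (n + k)%nat <= v n).
  { intros n k; induction k; [rewrite Nat.add_0_r; lra|]. rewrite Nat.add_succ_r. specialize (Hv (n + k)%nat). lra. }
  assert (X : forall n m, u n <= v m).
  { intros n m. eapply Rle_trans; [apply (Mu n m)|]. eapply Rle_trans; [apply Huv|].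
    rewrite Nat.add_comm. apply Mv. }
  destruct (completeness (fun y => exists n, y = u n)) as [x [H1 H2]].
  - exists (v O). intros y [n ->]. apply X.
  - exists (u O); now exists O.
  - exists x. intros n. split.
    + apply H1. now exists n.
    + apply H2. intros y [m ->]. apply X.
Qed.

(** After [n] bisections the integral has lost at most the factor [4 ^ n], while the side lengths
    have shrunk by [2 ^ n]. The linear part of the form at the limit point integrates to zero, and
    the rest is small compared with the square of the side lengths. *)
Lemma Goursat : a0 <= b0 -> c0 <= d0 -> rectint A B a0 b0 c0 d0 = 0.
Proof.
  intros Hab Hcd.
  assert (SS : forall n, issub (bisn n)).
  { induction n; [simpl; unfold subrect; lra|]. now apply bisect_spec. }
  assert (W : forall n, within (bisn n) (bisn (S n))) by (intros; now apply bisect_spec).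
  assert (Q : forall n, Rabs (rectint A B a0 b0 c0 d0) <= 4 ^ n * Rabs (rint (bisn n))).
  { induction n; [simpl; lra|].
    assert (H := proj2 (proj2 (bisect_spec _ (SS n)))).
    change (bisect (bisn n)) with (bisn (S n)) in H. simpl pow.
    assert (0 < 4 ^ n) by (apply pow_lt; lra). nra. }
  set (pa := fun n => fst (fst (fst (bisn n)))). set (pb := fun n => snd (fst (fst (bisn n)))).
  set (pc := fun n => snd (fst (bisn n))). set (pd := fun n => snd (bisn n)).
  assert (EQ : forall n, bisn n = (pa n, pb n, pc n, pd n)).
  { intros n. unfold pa, pb, pc, pd. destruct (bisn n) as [[[? ?] ?] ?]; reflexivity. }
  assert (W' : forall n, pa n <= pa (S n) /\ pb (S n) <= pb n /\ pc n <= pc (S n) /\ pd (S n) <= pd n /\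
      pb (S n) - pa (S n) = (pb n - pa n) / 2 /\ pd (S n) - pc (S n) = (pd n - pc n) / 2).
  { intros n. assert (H := W n). rewrite !EQ in H. exact H. }
  assert (S' : forall n, subrect (pa n) (pb n) (pc n) (pd n)).
  { intros n. assert (H := SS n). rewrite EQ in H. exact H. }
  destruct (nested_point pa pb) as [x Hx]; try (intros n; specialize (W' n); specialize (S' n); unfold subrect in S'; lra).
  destruct (nested_point pc pd) as [y Hy]; try (intros n; specialize (W' n); specialize (S' n); unfold subrect in S'; lra).
  set (L := (b0 - a0) + (d0 - c0)).
  assert (HL : forall n, 2 ^ n * ((pb n - pa n) + (pd n - pc n)) = L).
  { induction n; [simpl; unfold L, pa, pb, pc, pd; simpl; ring|].
    specialize (W' n). rewrite <- IHn. destruct W' as (_ & _ & _ & _ & -> & ->). simpl. field. }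
  assert (HC : closed_at A B x y).
  { apply Hclosed; [specialize (Hx O) | specialize (Hy O)]; specialize (S' O); unfold subrect in S'; lra. }
  destruct HC as (p & s & u & HC).
  apply Rabs_eq_0, Rle_antisym; [|apply Rabs_pos].
  apply le_epsilon. intros eps He. rewrite Rplus_0_l.
  assert (HL0 : 0 <= L) by (unfold L; lra).
  (* The final bound is [4 ^ n * (2 * e1 * l * l) = 2 * e1 * (L * L)]. *)
  set (e1 := eps / (2 * (L * L + 1))).
  assert (He1 : 0 < e1) by (apply Rdiv_lt_0_compat; nra).
  destruct (HC e1 He1) as [del [Hd Hdel]].
  destruct (pow_lt_1_zero (/ 2)) with (y := del / (L + 1)) as [n Hn].
  { rewrite Rabs_pos_eq; lra. }
  { apply Rdiv_lt_0_compat; lra. }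
  specialize (Hn n (le_n n)). specialize (HL n). specialize (Q n). rewrite EQ in Q.
  specialize (Hx n). specialize (Hy n). specialize (S' n).
  set (a := pa n) in *. set (b := pb n) in *. set (c := pc n) in *. set (d := pd n) in *.
  set (l := (b - a) + (d - c)) in *.
  assert (P2 : 0 < 2 ^ n) by (apply pow_lt; lra).
  assert (El : l = L * (/ 2) ^ n).
  { rewrite pow_inv. rewrite <- HL. field. lra. }
  assert (Hl : l < del).
  { rewrite El. rewrite Rabs_pos_eq in Hn by (apply pow_le; lra).
    apply (Rmult_lt_compat_l (L + 1)) in Hn; [|lra].
    replace ((L + 1) * (del / (L + 1))) with del in Hn by (field; lra).
    nra. }
  assert (LOC : forall x' y', a <= x' <= b -> c <= y' <= d ->
     Rabs (A x' y' - A x y - p * (x' - x) - s * (y' - y)) <= e1 * l /\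
     Rabs (B x' y' - B x y - s * (x' - x) - u * (y' - y)) <= e1 * l).
  { intros x' y' H1 H2.
    assert (X1 : Rabs (x' - x) <= b - a) by (apply Rabs_le; lra).
    assert (X2 : Rabs (y' - y) <= d - c) by (apply Rabs_le; lra).
    destruct (Hdel (x' - x) (y' - y)) as [G1 G2].
    - unfold l in Hl; lra.
    - unfold l in Hl; lra.
    - replace (x + (x' - x)) with x' in * by ring. replace (y + (y' - y)) with y' in * by ring.
      split; eapply Rle_trans; try eassumption; apply Rmult_le_compat_l; unfold l; lra. }
  (* The same coefficient [s] occurs in both forms, so the main terms of [I1] and [I2] cancel when
     added. *)
  assert (I1 : Rabs (RInt (fun t => A t c - A t d) a b - (s * (c - d)) * (b - a)) <= (2 * e1 * l) * (b - a)).
  { apply RInt_near_const; [lra | |].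
    - apply (ex_RInt_minus (fun t => A t c) (fun t => A t d)); apply (exA a b c d); auto; lra.
    - intros t Ht. destruct (LOC t c) as [G1 _]; [lra | lra |]. destruct (LOC t d) as [G2 _]; [lra | lra |].
      replace (A t c - A t d - s * (c - d)) with
        ((A t c - A x y - p * (t - x) - s * (c - y)) - (A t d - A x y - p * (t - x) - s * (d - y))) by ring.
      eapply Rle_trans; [apply Rabs_triang|]. rewrite Rabs_Ropp. lra. }
  assert (I2 : Rabs (RInt (fun t => B b t - B a t) c d - (s * (b - a)) * (d - c)) <= (2 * e1 * l) * (d - c)).
  { apply RInt_near_const; [lra | |].
    - apply (ex_RInt_minus (fun t => B b t) (fun t => B a t)); apply (exB a b c d); auto; lra.
    - intros t Ht. destruct (LOC b t) as [_ G1]; [lra | lra |]. destruct (LOC a t) as [_ G2]; [lra | lra |].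
      replace (B b t - B a t - s * (b - a)) with
        ((B b t - B x y - s * (b - x) - u * (t - y)) - (B a t - B x y - s * (a - x) - u * (t - y))) by ring.
      eapply Rle_trans; [apply Rabs_triang|]. rewrite Rabs_Ropp. lra. }
  rewrite (RInt_minus (fun t => A t c) (fun t => A t d)) in I1 by (apply (exA a b c d); auto; lra).
  rewrite (RInt_minus (fun t => B b t) (fun t => B a t)) in I2 by (apply (exB a b c d); auto; lra).
  unfold minus, plus, opp in I1, I2; simpl in I1, I2.
  assert (I3 : Rabs (rectint A B a b c d) <= 2 * e1 * l * l).
  { unfold rectint.
    match type of I1 with Rabs ?u1 <= _ => match type of I2 with Rabs ?u2 <= _ =>
      replace (RInt (fun x0 : R => A x0 c) a b + RInt (fun y0 : R => B b y0) c d -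
        RInt (fun x0 : R => A x0 d) a b - RInt (fun y0 : R => B a y0) c d) with (u1 + u2) by ring end end.
    eapply Rle_trans; [apply Rabs_triang|]. unfold l at 2. lra. }
  eapply Rle_trans; [exact Q|].
  apply Rle_trans with (4 ^ n * (2 * e1 * l * l)).
  - apply Rmult_le_compat_l; [apply pow_le; lra | exact I3].
  - replace (4 ^ n) with (2 ^ n * 2 ^ n) by (rewrite <- Rpow_mult_distr; f_equal; lra).
    replace (2 ^ n * 2 ^ n * (2 * e1 * l * l)) with (2 * e1 * ((2 ^ n * l) * (2 ^ n * l))) by ring.
    rewrite HL. unfold e1.
    apply Rmult_le_reg_r with (L * L + 1); [nra|].
    replace (2 * (eps / (2 * (L * L + 1))) * (L * L) * (L * L + 1)) with (eps * (L * L)) by (field; nra).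
    nra.
Qed.
End Rectangles.

(** * Rules for complex derivatives *)

(** The value [h = 0] is included: this is continuity at 0 with value [l], which makes composition
    free of side conditions. *)
Definition lim0 (phi : Cplx -> Cplx) (l : Cplx) : Prop :=
  forall eps, 0 < eps -> exists del, 0 < del /\ forall h, Cabs h < del -> Cabs (phi h - l)%X <= eps.

Definition ccont (F : Cplx -> Cplx) (z : Cplx) : Prop := lim0 (fun h => F (z + h)%X) (F z).

Lemma lim0_const (c : Cplx) : lim0 (fun _ => c) c.
Proof.
  intros eps He. exists 1. split; [lra|]. intros h _.
  replace (c - c)%X with 0%X by ring. rewrite Cabs_0; lra.
Qed.

Lemma lim0_ext (phi psi : Cplx -> Cplx) (l : Cplx) : (forall h, phi h = psi h) -> lim0 phi l -> lim0 psi l.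
Proof.
  intros E H eps He. destruct (H eps He) as [del [Hd Hh]]. exists del; split; [exact Hd|].
  intros h H1. rewrite <- E. auto.
Qed.

Lemma lim0_id : lim0 (fun h => h) 0%X.
Proof.
  intros eps He. exists eps. split; [lra|]. intros h Hh.
  replace (h - 0)%X with h by ring. lra.
Qed.

Lemma lim0_add (p q : Cplx -> Cplx) (l m : Cplx) :
  lim0 p l -> lim0 q m -> lim0 (fun h => (p h + q h)%X) (l + m)%X.
Proof.
  intros Hp Hq eps He.
  destruct (Hp (eps / 2)) as [d1 [Hd1 H1]]; [lra|]. destruct (Hq (eps / 2)) as [d2 [Hd2 H2]]; [lra|].
  exists (Rmin d1 d2). split; [now apply Rmin_pos|]. intros h Hh.
  specialize (H1 h (Rlt_le_trans _ _ _ Hh (Rmin_l _ _))). specialize (H2 h (Rlt_le_trans _ _ _ Hh (Rmin_r _ _))).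
  replace (p h + q h - (l + m))%X with ((p h - l) + (q h - m))%X by ring.
  eapply Rle_trans; [apply Cabs_add|]. lra.
Qed.

Lemma lim0_mul (p q : Cplx -> Cplx) (l m : Cplx) :
  lim0 p l -> lim0 q m -> lim0 (fun h => (p h * q h)%X) (l * m)%X.
Proof.
  intros Hp Hq eps He.
  assert (A1 := Cabs_ge0 l). assert (A2 := Cabs_ge0 m).
  set (D := Cabs l + Cabs m + 1).
  set (e := Rmin 1 (eps / (2 * D))).
  assert (De : 0 < eps / (2 * D)) by (apply Rdiv_lt_0_compat; unfold D; lra).
  assert (Ee : 0 < e) by (apply Rmin_pos; lra).
  destruct (Hp e Ee) as [d1 [Hd1 H1]]. destruct (Hq e Ee) as [d2 [Hd2 H2]].
  exists (Rmin d1 d2). split; [now apply Rmin_pos|]. intros h Hh.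
  specialize (H1 h (Rlt_le_trans _ _ _ Hh (Rmin_l _ _))). specialize (H2 h (Rlt_le_trans _ _ _ Hh (Rmin_r _ _))).
  replace (p h * q h - l * m)%X with ((p h - l) * (q h - m) + (l * (q h - m) + (p h - l) * m))%X by ring.
  eapply Rle_trans; [apply Cabs_add|]. eapply Rle_trans; [apply Rplus_le_compat_l, Cabs_add|].
  rewrite !Cabs_mul.
  assert (B1 := Cabs_ge0 (p h - l)%X).
  assert (E1 : e <= 1) by apply Rmin_l. assert (E2 : e <= eps / (2 * D)) by apply Rmin_r.
  apply (Rmult_le_compat_r (2 * D)) in E2; [|unfold D; lra].
  replace (eps / (2 * D) * (2 * D)) with eps in E2 by (field; unfold D; lra).
  unfold D in E2. nra.
Qed.

Lemma lim0_comp (p k : Cplx -> Cplx) (l : Cplx) :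
  lim0 p l -> lim0 k 0%X -> lim0 (fun h => p (k h)) l.
Proof.
  intros Hp Hk eps He. destruct (Hp eps He) as [d [Hd H1]]. destruct (Hk (d / 2)) as [d2 [Hd2 H2]]; [lra|].
  exists d2; split; [exact Hd2|]. intros h Hh. apply H1. specialize (H2 h Hh).
  replace (k h - 0)%X with (k h) in H2 by ring. lra.
Qed.

Lemma lim0_inv (p : Cplx -> Cplx) (l : Cplx) :
  l <> 0%X -> lim0 p l -> lim0 (fun h => Cinv (p h)) (Cinv l).
Proof.
  intros Hl Hp eps He. assert (L := Cabs_pos l Hl).
  set (e := Rmin (Cabs l / 2) (eps * (Cabs l * Cabs l) / 2)).
  assert (Ee : 0 < e) by (apply Rmin_pos; [lra | assert (0 < Cabs l * Cabs l) by nra; nra]).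
  destruct (Hp e Ee) as [d [Hd H1]]. exists d; split; [exact Hd|]. intros h Hh. specialize (H1 h Hh).
  assert (E1 : e <= Cabs l / 2) by apply Rmin_l. assert (E2 : e <= eps * (Cabs l * Cabs l) / 2) by apply Rmin_r.
  assert (N : Cabs l / 2 <= Cabs (p h)).
  { assert (G := Cabs_sub_ge l (p h)). rewrite Cabs_sub_sym in G. lra. }
  assert (Np : p h <> 0%X) by (apply Cabs_neq0; lra).
  replace (Cinv (p h) - Cinv l)%X with ((l - p h) / (p h * l))%X by (field; split; assumption).
  rewrite Cabs_div by (apply Cmul_neq0; assumption). rewrite Cabs_mul, Cabs_sub_sym.
  apply Rmult_le_reg_r with (Cabs (p h) * Cabs l); [nra|].
  unfold Rdiv. rewrite Rmult_assoc, Rinv_l by nra. nra.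
Qed.

(* In this form of differentiability the product and chain rules are algebra. *)
Lemma cderiv_iff (f : Cplx -> Cplx) (z l : Cplx) :
  cderiv f z l <-> exists phi, (forall h, f (z + h)%X = (f z + phi h * h)%X) /\ phi 0%X = l /\ lim0 phi l.
Proof.
  split.
  - intros H. exists (fun h => if Ceq_dec h 0%X then l else ((f (z + h) - f z) / h)%X). split; [|split].
    + intros h. destruct (Ceq_dec h 0%X) as [-> | Hh].
      * replace (z + 0)%X with z by ring. ring.
      * field; exact Hh.
    + destruct (Ceq_dec 0%X 0%X); congruence.
    + intros eps He. destruct (H eps He) as [d [Hd H1]]. exists d; split; [exact Hd|]. intros h Hh.
      destruct (Ceq_dec h 0%X) as [E | Hh0].
      * replace (l - l)%X with 0%X by ring. rewrite Cabs_0; lra.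
      * specialize (H1 h Hh). assert (P := Cabs_pos h Hh0).
        replace ((f (z + h) - f z) / h - l)%X with ((f (z + h) - f z - l * h) / h)%X by (field; exact Hh0).
        rewrite Cabs_div by exact Hh0. apply Rmult_le_reg_r with (Cabs h); [exact P|].
        unfold Rdiv. rewrite Rmult_assoc, Rinv_l by lra. lra.
  - intros (phi & E & _ & L) eps He. destruct (L eps He) as [d [Hd H1]]. exists d; split; [exact Hd|].
    intros h Hh. rewrite E. replace (f z + phi h * h - f z - l * h)%X with ((phi h - l) * h)%X by ring.
    rewrite Cabs_mul. apply Rmult_le_compat_r; [apply Cabs_ge0 | auto].
Qed.

Lemma cderiv_ccont (f : Cplx -> Cplx) (z l : Cplx) : cderiv f z l -> ccont f z.
Proof.
  intros H. apply cderiv_iff in H. destruct H as (phi & E & _ & L).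
  apply lim0_ext with (fun h => (f z + phi h * h)%X); [intros; symmetry; apply E|].
  assert (G := lim0_add _ _ _ _ (lim0_const (f z)) (lim0_mul _ _ _ _ L lim0_id)).
  replace (f z + l * 0)%X with (f z) in G by ring. exact G.
Qed.

Lemma cderiv_const (c z : Cplx) : cderiv (fun _ => c) z 0%X.
Proof.
  apply cderiv_iff. exists (fun _ => 0%X). split; [intros; ring | split; [reflexivity | apply lim0_const]].
Qed.

Lemma cderiv_id (z : Cplx) : cderiv (fun w => w) z 1%X.
Proof.
  apply cderiv_iff. exists (fun _ => 1%X). split; [intros; ring | split; [reflexivity | apply lim0_const]].
Qed.

Lemma cderiv_add (f g : Cplx -> Cplx) (z l m : Cplx) :
  cderiv f z l -> cderiv g z m -> cderiv (fun w => (f w + g w)%X) z (l + m)%X.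
Proof.
  rewrite !cderiv_iff. intros (p & E1 & V1 & L1) (q & E2 & V2 & L2).
  exists (fun h => (p h + q h)%X). split; [|split].
  - intros h. rewrite E1, E2. ring.
  - congruence.
  - now apply lim0_add.
Qed.

Lemma cderiv_mul (f g : Cplx -> Cplx) (z l m : Cplx) :
  cderiv f z l -> cderiv g z m -> cderiv (fun w => (f w * g w)%X) z (l * g z + f z * m)%X.
Proof.
  rewrite !cderiv_iff. intros (p & E1 & V1 & L1) (q & E2 & V2 & L2).
  exists (fun h => (p h * g z + (f z * q h + p h * q h * h))%X). split; [|split].
  - intros h. rewrite E1, E2. ring.
  - rewrite V1, V2. ring.
  - assert (G := lim0_add _ _ _ _ (lim0_mul _ _ _ _ L1 (lim0_const (g z)))
      (lim0_add _ _ _ _ (lim0_mul _ _ _ _ (lim0_const (f z)) L2) (lim0_mul _ _ _ _ (lim0_mul _ _ _ _ L1 L2) lim0_id))).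
    replace (l * g z + (f z * m + l * m * 0))%X with (l * g z + f z * m)%X in G by ring. exact G.
Qed.

Lemma cderiv_opp (f : Cplx -> Cplx) (z l : Cplx) : cderiv f z l -> cderiv (fun w => (- f w)%X) z (- l)%X.
Proof.
  rewrite !cderiv_iff. intros (p & E1 & V1 & L1). exists (fun h => ((- (1)) * p h)%X). split; [|split].
  - intros h. rewrite E1. ring.
  - rewrite V1. ring.
  - assert (G := lim0_mul _ _ _ _ (lim0_const (- (1))%X) L1).
    replace ((- (1)) * l)%X with (- l)%X in G by ring. exact G.
Qed.

Lemma cderiv_sub (f g : Cplx -> Cplx) (z l m : Cplx) :
  cderiv f z l -> cderiv g z m -> cderiv (fun w => (f w - g w)%X) z (l - m)%X.
Proof. intros H1 H2. apply (cderiv_add f (fun w => (- g w)%X)); [exact H1 | now apply cderiv_opp]. Qed.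

Lemma cderiv_comp (f g : Cplx -> Cplx) (z l m : Cplx) :
  cderiv g z m -> cderiv f (g z) l -> cderiv (fun w => f (g w)) z (l * m)%X.
Proof.
  rewrite !cderiv_iff. intros (q & E2 & V2 & L2) (p & E1 & V1 & L1).
  exists (fun h => (p (q h * h) * q h)%X). split; [|split].
  - intros h. rewrite E2, E1. ring.
  - rewrite V2. replace (m * 0)%X with 0%X by ring. rewrite V1. reflexivity.
  - apply lim0_mul; [|exact L2]. apply (lim0_comp p (fun h => (q h * h)%X)); [exact L1|].
    assert (G := lim0_mul _ _ _ _ L2 lim0_id). replace (m * 0)%X with 0%X in G by ring. exact G.
Qed.

Lemma cderiv_ext_near (f g : Cplx -> Cplx) (z l : Cplx) (r : R) :
  0 < r -> (forall h, Cabs h < r -> f (z + h)%X = g (z + h)%X) -> cderiv f z l -> cderiv g z l.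
Proof.
  intros Hr E H eps He. destruct (H eps He) as [d [Hd H1]].
  exists (Rmin d r). split; [now apply Rmin_pos|]. intros h Hh.
  assert (E0 : f z = g z).
  { replace z with (z + 0)%X by ring. apply E. rewrite Cabs_0; exact Hr. }
  rewrite <- E0, <- E; [apply H1|]; eapply Rlt_le_trans; [exact Hh | apply Rmin_l | exact Hh | apply Rmin_r].
Qed.

Lemma ccont_nonzero_near (f : Cplx -> Cplx) (z : Cplx) :
  ccont f z -> f z <> 0%X -> exists r, 0 < r /\ forall h, Cabs h < r -> f (z + h)%X <> 0%X.
Proof.
  intros H Hz. assert (P := Cabs_pos _ Hz). destruct (H (Cabs (f z) / 2)) as [d [Hd H1]]; [lra|].
  exists d; split; [exact Hd|]. intros h Hh E. specialize (H1 h Hh). rewrite E in H1.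
  replace (0 - f z)%X with (- f z)%X in H1 by ring. rewrite Cabs_opp in H1. lra.
Qed.

Lemma cderiv_inv (f : Cplx -> Cplx) (z l : Cplx) :
  f z <> 0%X -> cderiv f z l -> cderiv (fun w => Cinv (f w)) z (- l / (f z * f z))%X.
Proof.
  intros Hz H. destruct (ccont_nonzero_near f z (cderiv_ccont _ _ _ H) Hz) as [r [Hr N]].
  assert (C := cderiv_ccont _ _ _ H). apply cderiv_iff in H. destruct H as (p & E & V & L).
  assert (LI : lim0 (fun h => ((- (1)) * p h * (Cinv (f (z + h)) * Cinv (f z)))%X) (- l / (f z * f z))%X).
  { assert (G := lim0_mul _ _ _ _ (lim0_mul _ _ _ _ (lim0_const (- (1))%X) L)
       (lim0_mul _ _ _ _ (lim0_inv _ _ Hz C) (lim0_const (Cinv (f z))))).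
    replace ((- (1)) * l * (Cinv (f z) * Cinv (f z)))%X with (- l / (f z * f z))%X in G by (field; exact Hz).
    exact G. }
  intros eps He. destruct (LI eps He) as [d [Hd H1]]. exists (Rmin d r). split; [now apply Rmin_pos|].
  intros h Hh. assert (Hn := N h (Rlt_le_trans _ _ _ Hh (Rmin_r _ _))).
  specialize (H1 h (Rlt_le_trans _ _ _ Hh (Rmin_l _ _))).
  replace (Cinv (f (z + h)) - Cinv (f z) - - l / (f z * f z) * h)%X with
     (((- (1)) * p h * (Cinv (f (z + h)) * Cinv (f z)) - - l / (f z * f z)) * h)%X.
  - rewrite Cabs_mul. apply Rmult_le_compat_r; [apply Cabs_ge0 | exact H1].
  - rewrite E in *. field. split; assumption.
Qed.

Lemma cderiv_pow (z : Cplx) (n : nat) : exists l, cderiv (fun w => (w ^ n)%X) z l.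
Proof.
  induction n as [|n [l IH]]; simpl.
  - eexists; apply cderiv_const.
  - eexists. apply (cderiv_mul (fun w => w) (fun w => (w ^ n)%X)); [apply cderiv_id | exact IH].
Qed.

Lemma cderiv_unique (f : Cplx -> Cplx) (z l m : Cplx) : cderiv f z l -> cderiv f z m -> l = m.
Proof.
  intros H1 H2. apply Csub_eq0, Cabs_eq0, Rle_antisym; [|apply Cabs_ge0].
  apply le_epsilon. intros eps He. rewrite Rplus_0_l.
  destruct (H1 (eps / 2)) as [d1 [Hd1 G1]]; [lra|]. destruct (H2 (eps / 2)) as [d2 [Hd2 G2]]; [lra|].
  set (h := RtoC (Rmin d1 d2 / 2)).
  assert (P : 0 < Rmin d1 d2) by now apply Rmin_pos.
  assert (Ah : Cabs h = Rmin d1 d2 / 2) by (unfold h; rewrite Cabs_RtoC, Rabs_pos_eq; lra).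
  assert (M1 := Rmin_l d1 d2). assert (M2 := Rmin_r d1 d2).
  specialize (G1 h ltac:(lra)). specialize (G2 h ltac:(lra)).
  apply Rmult_le_reg_r with (Cabs h); [lra|]. rewrite <- Cabs_mul.
  replace ((l - m) * h)%X with ((f (z + h) - f z - m * h) - (f (z + h) - f z - l * h))%X by ring.
  eapply Rle_trans; [apply Cabs_sub|]. lra.
Qed.

(** * Cauchy's integral formula *)

Definition cexp (z : Cplx) : Cplx := (RtoC (exp (Re z)) * cis (Im z))%X.

Lemma derivable_pt_lim_abs (f : R -> R) (x l : R) :
  derivable_pt_lim f x l -> forall eps, 0 < eps -> exists del, 0 < del /\
    forall h, Rabs h < del -> Rabs (f (x + h) - f x - l * h) <= eps * Rabs h.
Proof.
  intros H eps He. destruct (H eps He) as [del Hd]. exists del. split; [apply cond_pos|].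
  intros h Hh. destruct (Req_dec h 0) as [-> | Hh0].
  - rewrite Rplus_0_r, Rabs_R0. replace (f x - f x - l * 0) with 0 by ring. rewrite Rabs_R0; lra.
  - specialize (Hd h Hh0 Hh). assert (P := Rabs_pos_lt h Hh0).
    replace (f (x + h) - f x - l * h) with (((f (x + h) - f x) / h - l) * h) by (field; exact Hh0).
    rewrite Rabs_mult. apply Rmult_le_compat_r; lra.
Qed.

(** The derivative at 0 comes from those of [exp], [sin] and [cos]; the functional equation carries
    it to every other point. *)
Lemma cderiv_cexp (z : Cplx) : cderiv cexp z (cexp z).
Proof.
  assert (Z : cderiv cexp 0%X 1%X).
  { intros eps0 He0. set (eps := Rmin (eps0 / 14) 1).
    assert (He : 0 < eps) by (apply Rmin_pos; lra).
    assert (He1 : eps <= 1) by apply Rmin_r. assert (He2 : eps <= eps0 / 14) by apply Rmin_l.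
    destruct (derivable_pt_lim_abs exp 0 1) with (eps := eps) as [d1 [Hd1 H1]]; [|exact He|].
    { assert (X := derivable_pt_lim_exp 0). rewrite exp_0 in X. exact X. }
    destruct (derivable_pt_lim_abs sin 0 1) with (eps := eps) as [d2 [Hd2 H2]]; [|exact He|].
    { assert (X := derivable_pt_lim_sin 0). rewrite cos_0 in X. exact X. }
    destruct (derivable_pt_lim_abs cos 0 0) with (eps := eps) as [d3 [Hd3 H3]]; [|exact He|].
    { assert (X := derivable_pt_lim_cos 0). rewrite sin_0, Ropp_0 in X. exact X. }
    exists (Rmin (Rmin d1 (eps / 2)) (Rmin d2 d3)). split; [repeat apply Rmin_pos; lra|].
    intros h Hh.
    assert (X1 := Rmin_l (Rmin d1 (eps / 2)) (Rmin d2 d3)). assert (X2 := Rmin_r (Rmin d1 (eps / 2)) (Rmin d2 d3)).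
    assert (X3 := Rmin_l d1 (eps / 2)). assert (X4 := Rmin_r d1 (eps / 2)).
    assert (X5 := Rmin_l d2 d3). assert (X6 := Rmin_r d2 d3).
    assert (Y1 := Re_le_Cabs h). assert (Y2 := Im_le_Cabs h).
    set (a := Re h) in *. set (b := Im h) in *.
    assert (P1 := Rabs_pos a). assert (P2 := Rabs_pos b).
    specialize (H1 a ltac:(lra)). specialize (H2 b ltac:(lra)). specialize (H3 b ltac:(lra)).
    rewrite !Rplus_0_l in *. rewrite exp_0 in H1. rewrite sin_0 in H2. rewrite cos_0 in H3.
    rewrite Rmult_1_l in *. rewrite Rmult_0_l in H3. rewrite !Rminus_0_r in *.
    assert (EB1 : Rabs (exp a - 1) <= 2 * Rabs a).
    { replace (exp a - 1) with ((exp a - 1 - a) + a) by ring. eapply Rle_trans; [apply Rabs_triang|]. nra. }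
    assert (EB2 : Rabs (exp a) <= 2).
    { replace (exp a) with ((exp a - 1) + 1) by ring. eapply Rle_trans; [apply Rabs_triang|]. rewrite Rabs_R1. nra. }
    eapply Rle_trans; [apply Cabs_le_ReIm|].
    unfold cexp, cis; simpl. fold a b. rewrite !Rplus_0_l, exp_0, cos_0, sin_0.
    replace (exp a * cos b - 0 * sin b + - (1 * 1 - 0 * 0) + - (1 * a - 0 * b)) with
      (exp a * (cos b - 1) + (exp a - 1 - a)) by ring.
    replace (exp a * sin b + 0 * cos b + - (1 * 0 + 0 * 1) + - (1 * b + 0 * a)) with
      (exp a * (sin b - b) + (exp a - 1) * b) by ring.
    assert (Q1 := Rabs_triang (exp a * (cos b - 1)) (exp a - 1 - a)).
    assert (Q2 := Rabs_triang (exp a * (sin b - b)) ((exp a - 1) * b)).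
    rewrite !Rabs_mult in Q1. rewrite !Rabs_mult in Q2.
    assert (G1 : Rabs (exp a) * Rabs (cos b - 1) <= 2 * (eps * Rabs b)) by (apply Rmult_le_compat; auto using Rabs_pos).
    assert (G2 : Rabs (exp a) * Rabs (sin b - b) <= 2 * (eps * Rabs b)) by (apply Rmult_le_compat; auto using Rabs_pos).
    nra. }
  apply cderiv_iff in Z. destruct Z as (p & E & V & L). apply cderiv_iff.
  exists (fun h => (cexp z * p h)%X). split; [|split].
  - intros h. specialize (E h). replace (0 + h)%X with h in E by ring.
    replace (cexp (z + h)) with (cexp z * cexp h)%X.
    + rewrite E. replace (cexp 0%X) with 1%X; [ring|].
      unfold cexp; simpl. rewrite exp_0, cis_0. ring.
    + unfold cexp. simpl. rewrite exp_plus, cis_add, RtoC_mul. ring.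
  - rewrite V. ring.
  - assert (G := lim0_mul _ _ _ _ (lim0_const (cexp z)) L). replace (cexp z * 1)%X with (cexp z) in G by ring. exact G.
Qed.

Definition CInt (F : R -> Cplx) (a b : R) : Cplx := mkC (RInt (fun t => Re (F t)) a b) (RInt (fun t => Im (F t)) a b).

Definition circ (r t : R) : Cplx := (RtoC r * cis t)%X.

Lemma Cabs_circ (r t : R) : 0 <= r -> Cabs (circ r t) = r.
Proof. intros H. unfold circ. rewrite Cabs_mul, Cabs_cis, Cabs_RtoC, Rabs_pos_eq by exact H. ring. Qed.

(** The exponential maps a rectangle onto the annulus. Goursat's theorem for [F] composed with it
    compares the two vertical sides, which are the two circles; the horizontal sides cancel by
    periodicity. *)
Lemma annulus_invariance (F : Cplx -> Cplx) (r1 r2 : R) :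
  0 < r1 -> r1 <= r2 -> (forall z, r1 <= Cabs z <= r2 -> exists l, cderiv F z l) ->
  CInt (fun t => F (circ r1 t)) 0 (2 * PI) = CInt (fun t => F (circ r2 t)) 0 (2 * PI).
Proof.
  intros H1 H12 HF.
  set (G := fun x y => F (cexp (mkC x y))).
  assert (HG : forall x y, ln r1 <= x <= ln r2 -> exists L, forall eps, 0 < eps -> exists del, 0 < del /\
     forall h k, Rabs h < del -> Rabs k < del ->
     Cabs (G (x + h)%R (y + k)%R - G x y - L * mkC h k)%X <= eps * (Rabs h + Rabs k)).
  { intros x y Hx.
    assert (AE : Cabs (cexp (mkC x y)) = exp x).
    { unfold cexp; simpl. rewrite Cabs_mul, Cabs_cis, Cabs_RtoC, Rabs_pos_eq; [ring | left; apply exp_pos]. }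
    destruct (HF (cexp (mkC x y))) as [l Hl].
    { rewrite AE. split.
      - rewrite <- (exp_ln r1) by lra. destruct (Req_dec (ln r1) x) as [->|]; [lra | left; apply exp_increasing; lra].
      - rewrite <- (exp_ln r2) by lra. destruct (Req_dec (ln r2) x) as [->|]; [lra | left; apply exp_increasing; lra]. }
    assert (D := cderiv_comp F cexp (mkC x y) _ _ (cderiv_cexp _) Hl).
    eexists. intros eps He. destruct (D eps He) as [del [Hd H]]. exists (del / 2). split; [lra|].
    intros h k Hh Hk. assert (A := Cabs_le_ReIm (mkC h k)). simpl in A.
    assert (HH : Cabs (mkC h k) < del) by lra.
    specialize (H (mkC h k) HH). replace (mkC (x + h) (y + k)) with (mkC x y + mkC h k)%X by reflexivity.
    eapply Rle_trans; [exact H|]. apply Rmult_le_compat_l; lra. }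
  assert (LL : ln r1 <= ln r2).
  { destruct (Req_dec r1 r2) as [->|]; [lra | left; apply ln_increasing; lra]. }
  assert (PP := PI_RGT_0).
  (* [C1] and [C2] are the imaginary and the real part of the integral of [G dz]; the forms are
     closed by the Cauchy-Riemann equations. *)
  assert (C1 : rectint (fun x y => Im (G x y)) (fun x y => Re (G x y)) (ln r1) (ln r2) 0 (2 * PI) = 0).
  { apply Goursat; [|exact LL | lra]. intros x y Hx _. destruct (HG x y Hx) as [L HL].
    exists (Im L), (Re L), (- Im L). intros eps He. destruct (HL eps He) as [del [Hd H]]. exists del; split; [exact Hd|].
    intros h k Hh Hk. specialize (H h k Hh Hk). split; (eapply Rle_trans; [|exact H]).
    - eapply Rle_trans; [|apply Im_le_Cabs]. simpl. apply Req_le. f_equal. ring.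
    - eapply Rle_trans; [|apply Re_le_Cabs]. simpl. apply Req_le. f_equal. ring. }
  assert (C2 : rectint (fun x y => Re (G x y)) (fun x y => - Im (G x y)) (ln r1) (ln r2) 0 (2 * PI) = 0).
  { apply Goursat; [|exact LL | lra]. intros x y Hx _. destruct (HG x y Hx) as [L HL].
    exists (Re L), (- Im L), (- Re L). intros eps He. destruct (HL eps He) as [del [Hd H]]. exists del; split; [exact Hd|].
    intros h k Hh Hk. specialize (H h k Hh Hk). split; (eapply Rle_trans; [|exact H]).
    - eapply Rle_trans; [|apply Re_le_Cabs]. simpl. apply Req_le. f_equal. ring.
    - eapply Rle_trans; [|apply Im_le_Cabs]. rewrite <- Rabs_Ropp. simpl. apply Req_le. f_equal. ring. }
  assert (PER : forall x, G x 0 = G x (2 * PI)).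
  { intros x. unfold G, cexp. simpl. f_equal. f_equal. rewrite cis_0. symmetry.
    rewrite <- (cis_2PI_nat 1). f_equal. simpl; ring. }
  unfold rectint in C1, C2.
  rewrite (RInt_ext (fun x => Im (G x 0)) (fun x => Im (G x (2 * PI)))) in C1 by (intros; rewrite PER; reflexivity).
  rewrite (RInt_ext (fun x => Re (G x 0)) (fun x => Re (G x (2 * PI)))) in C2 by (intros; rewrite PER; reflexivity).
  assert (EG : forall r t, 0 < r -> G (ln r) t = F (circ r t)).
  { intros r t Hr. unfold G, cexp, circ. simpl. rewrite exp_ln by exact Hr. reflexivity. }
  assert (EX : forall r, r1 <= r <= r2 -> ex_RInt (fun y => Im (G (ln r) y)) 0 (2 * PI)).
  { intros r Hr. apply (@ex_RInt_continuous R_CompleteNormedModule). intros y _.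
    destruct (HG (ln r) y) as [L HL].
    { split.
      - destruct (Req_dec r1 r) as [->|]; [lra | left; apply ln_increasing; lra].
      - destruct (Req_dec r r2) as [->|]; [lra | left; apply ln_increasing; lra]. }
    destruct (HL 1 Rlt_0_1) as [del [Hd H]].
    apply (lin_bound_continuous _ y (Re L) 1 del Hd). intros h Hh.
    specialize (H 0 h). rewrite Rabs_R0 in H. specialize (H Hd Hh). rewrite Rplus_0_l in H.
    eapply Rle_trans; [|exact H]. eapply Rle_trans; [|apply Im_le_Cabs]. rewrite Rplus_0_r. simpl. apply Req_le; f_equal; ring. }
  apply Ceq; simpl.
  - rewrite (RInt_ext (fun t => Re (F (circ r1 t))) (fun y => Re (G (ln r1) y))) by (intros; rewrite EG by lra; reflexivity).
    rewrite (RInt_ext (fun t => Re (F (circ r2 t))) (fun y => Re (G (ln r2) y))) by (intros; rewrite EG by lra; reflexivity).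
    lra.
  - rewrite (RInt_ext (fun t => Im (F (circ r1 t))) (fun y => Im (G (ln r1) y))) by (intros; rewrite EG by lra; reflexivity).
    rewrite (RInt_ext (fun t => Im (F (circ r2 t))) (fun y => Im (G (ln r2) y))) by (intros; rewrite EG by lra; reflexivity).
    assert (O : forall r, r1 <= r <= r2 -> RInt (fun y => - Im (G (ln r) y)) 0 (2 * PI) = - RInt (fun y => Im (G (ln r) y)) 0 (2 * PI)).
    { intros r Hr. apply (RInt_opp (fun y => Im (G (ln r) y))). now apply EX. }
    rewrite !O in C2 by lra. lra.
Qed.

Lemma sin_abs_le (x : R) : Rabs (sin x) <= Rabs x.
Proof.
  assert (P : forall y, 0 < y -> Rabs (sin y) <= y).
  { intros y Hy. apply Rabs_le. split; [|left; now apply sin_lt_x].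
    destruct (Rle_dec y PI) as [H|H].
    - assert (0 <= sin y) by (apply sin_ge_0; lra). lra.
    - assert (B := SIN_bound y). assert (P1 := PI2_1). lra. }
  destruct (Rtotal_order x 0) as [H | [-> | H]].
  - rewrite (Rabs_left x H), <- Rabs_Ropp, <- sin_neg. apply P; lra.
  - rewrite sin_0, Rabs_R0; lra.
  - rewrite (Rabs_pos_eq x) by lra. now apply P.
Qed.

Lemma cis_lip (a b : R) : Cabs (cis a - cis b)%X <= 2 * Rabs (a - b).
Proof.
  eapply Rle_trans; [apply Cabs_le_ReIm|]. simpl.
  replace (cos a + - cos b) with (cos a - cos b) by ring. replace (sin a + - sin b) with (sin a - sin b) by ring.
  rewrite form2, form4, !Rabs_mult.
  assert (S := sin_abs_le ((a - b) / 2)).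
  assert (S1 : Rabs (sin ((a + b) / 2)) <= 1) by (apply Rabs_le, SIN_bound).
  assert (S2 : Rabs (cos ((a + b) / 2)) <= 1) by (apply Rabs_le, COS_bound).
  replace (Rabs ((a - b) / 2)) with (Rabs (a - b) / 2) in S
    by (unfold Rdiv; rewrite Rabs_mult; f_equal; symmetry; apply Rabs_pos_eq; lra).
  rewrite (Rabs_left (-2)), (Rabs_pos_eq 2) by lra.
  assert (Q := Rabs_pos (sin ((a - b) / 2))).
  nra.
Qed.

Lemma circ_lip (u v x y : R) : Cabs (circ u v - circ x y)%X <= Rabs (u - x) + Rabs x * (2 * Rabs (v - y)).
Proof.
  unfold circ.
  replace (RtoC u * cis v - RtoC x * cis y)%X with (RtoC (u - x) * cis v + RtoC x * (cis v - cis y))%X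
    by (apply Ceq; simpl; ring).
  eapply Rle_trans; [apply Cabs_add|]. rewrite !Cabs_mul, Cabs_cis, !Cabs_RtoC.
  assert (L := cis_lip v y). assert (P := Rabs_pos x). nra.
Qed.

Lemma ccont_circ_2d (F : Cplx -> Cplx) (x y : R) :
  ccont F (circ x y) ->
  continuity_2d_pt (fun u v => Re (F (circ u v))) x y /\ continuity_2d_pt (fun u v => Im (F (circ u v))) x y.
Proof.
  intros H.
  assert (K : forall eps : posreal, exists d : posreal, forall u v, Rabs (u - x) < d -> Rabs (v - y) < d ->
    Cabs (F (circ u v) - F (circ x y))%X < eps).
  { intros eps. destruct (H (eps / 2)) as [d [Hd H1]]; [destruct eps; simpl; lra|].
    assert (P := Rabs_pos x).
    assert (D : 0 < d / (1 + 2 * Rabs x)) by (apply Rdiv_lt_0_compat; lra).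
    exists (mkposreal _ D). simpl. intros u v Hu Hv.
    assert (L := circ_lip u v x y).
    assert (E : Cabs (circ u v - circ x y)%X < d).
    { eapply Rle_lt_trans; [exact L|].
      apply Rlt_le_trans with (d / (1 + 2 * Rabs x) * (1 + 2 * Rabs x)); [nra|]. apply Req_le; field; lra. }
    specialize (H1 _ E). replace (circ x y + (circ u v - circ x y))%X with (circ u v) in H1 by ring.
    destruct eps; simpl in *; lra. }
  split; intros eps; destruct (K eps) as [d Hd]; exists d; intros u v Hu Hv; specialize (Hd u v Hu Hv);
    eapply Rle_lt_trans; try exact Hd.
  - eapply Rle_trans; [|apply Re_le_Cabs]. apply Req_le. f_equal.
  - eapply Rle_trans; [|apply Im_le_Cabs]. apply Req_le. f_equal.
Qed.

Lemma continuity_2d_continuous (f : R -> R -> R) (x y : R) : continuity_2d_pt f x y -> continuous (f x) y.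
Proof.
  intros H. apply continuous_eps. intros eps He. destruct (H (mkposreal eps He)) as [d Hd].
  exists d. split; [apply cond_pos|]. intros h Hh. left. apply (Hd x (y + h)).
  - replace (x - x) with 0 by ring. rewrite Rabs_R0. apply cond_pos.
  - replace (y + h - y) with h by ring. exact Hh.
Qed.

Definition tint (F : R -> Cplx) (a b : R) : Prop :=
  ex_RInt (fun t => Re (F t)) a b /\ ex_RInt (fun t => Im (F t)) a b.

Lemma tint_circ (F : Cplx -> Cplx) (r a b : R) :
  (forall t, ccont F (circ r t)) -> tint (fun t => F (circ r t)) a b.
Proof.
  intros H. split; apply (@ex_RInt_continuous R_CompleteNormedModule); intros t _;
    [apply (continuity_2d_continuous (fun u v => Re (F (circ u v)))) | apply (continuity_2d_continuous (fun u v => Im (F (circ u v))))];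
    apply ccont_circ_2d, H.
Qed.

Lemma CInt_ext (F G : R -> Cplx) (a b : R) : (forall t, F t = G t) -> CInt F a b = CInt G a b.
Proof. intros H. unfold CInt. f_equal; apply RInt_ext; intros; rewrite H; reflexivity. Qed.

Lemma CInt_add (F G : R -> Cplx) (a b : R) :
  tint F a b -> tint G a b -> CInt (fun t => (F t + G t)%X) a b = (CInt F a b + CInt G a b)%X.
Proof.
  intros [F1 F2] [G1 G2]. apply Ceq; simpl.
  - apply (RInt_plus (fun t => Re (F t)) (fun t => Re (G t))); assumption.
  - apply (RInt_plus (fun t => Im (F t)) (fun t => Im (G t))); assumption.
Qed.

Lemma CInt_scal (c : Cplx) (F : R -> Cplx) (a b : R) :
  tint F a b -> CInt (fun t => (c * F t)%X) a b = (c * CInt F a b)%X.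
Proof.
  intros [F1 F2]. apply Ceq; simpl.
  - rewrite (RInt_minus (fun t => Re c * Re (F t)) (fun t => Im c * Im (F t))).
    + rewrite (RInt_scal (fun t => Re (F t))), (RInt_scal (fun t => Im (F t))) by assumption. reflexivity.
    + apply (ex_RInt_scal (fun t => Re (F t))); assumption.
    + apply (ex_RInt_scal (fun t => Im (F t))); assumption.
  - rewrite (RInt_plus (fun t => Re c * Im (F t)) (fun t => Im c * Re (F t))).
    + rewrite (RInt_scal (fun t => Re (F t))), (RInt_scal (fun t => Im (F t))) by assumption. reflexivity.
    + apply (ex_RInt_scal (fun t => Im (F t))); assumption.
    + apply (ex_RInt_scal (fun t => Re (F t))); assumption.
Qed.

Lemma tint_const (c : Cplx) (a b : R) : tint (fun _ => c) a b.
Proof. split; apply ex_RInt_const. Qed.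

Lemma tint_scal (c : Cplx) (F : R -> Cplx) (a b : R) : tint F a b -> tint (fun t => (c * F t)%X) a b.
Proof.
  intros [F1 F2]. split; simpl.
  - apply (ex_RInt_minus (fun t => Re c * Re (F t)) (fun t => Im c * Im (F t)));
      [apply (ex_RInt_scal (fun t => Re (F t))) | apply (ex_RInt_scal (fun t => Im (F t)))]; assumption.
  - apply (ex_RInt_plus (fun t => Re c * Im (F t)) (fun t => Im c * Re (F t)));
      [apply (ex_RInt_scal (fun t => Im (F t))) | apply (ex_RInt_scal (fun t => Re (F t)))]; assumption.
Qed.

Lemma tint_add (F G : R -> Cplx) (a b : R) : tint F a b -> tint G a b -> tint (fun t => (F t + G t)%X) a b.
Proof.
  intros [F1 F2] [G1 G2]. split; simpl.
  - apply (ex_RInt_plus (fun t => Re (F t)) (fun t => Re (G t))); assumption.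
  - apply (ex_RInt_plus (fun t => Im (F t)) (fun t => Im (G t))); assumption.
Qed.

Lemma CInt_const (c : Cplx) (a b : R) : CInt (fun _ => c) a b = (RtoC (b - a) * c)%X.
Proof.
  apply Ceq; simpl; rewrite RInt_const; unfold scal; simpl; unfold mult; simpl; ring.
Qed.

(** Multiplication by the conjugate of the integral turns its squared modulus into a real integral,
    so that the bound comes without an extra factor. *)
Lemma CInt_norm_le (F : R -> Cplx) (a b M : R) :
  a <= b -> tint F a b -> (forall t, Cabs (F t) <= M) -> Cabs (CInt F a b) <= (b - a) * M.
Proof.
  intros Hab HF HM. set (J := CInt F a b).
  assert (M0 : 0 <= M) by (eapply Rle_trans; [apply Cabs_ge0 | apply (HM 0)]).
  destruct (Req_dec (Cabs J) 0) as [E|E]; [rewrite E; nra|].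
  assert (P : 0 < Cabs J) by (assert (H := Cabs_ge0 J); lra).
  assert (Q : Cabs J * Cabs J = Re (mkC (Re J) (- Im J) * J)%X) by (rewrite Cabs_sq; simpl; ring).
  assert (AC : Cabs (mkC (Re J) (- Im J)) = Cabs J) by (unfold Cabs; simpl; f_equal; ring).
  assert (S := CInt_scal (mkC (Re J) (- Im J)) F a b HF).
  apply (f_equal Re) in S. fold J in S. rewrite <- Q in S.
  unfold CInt in S. change (Re (mkC (RInt (fun t => Re (mkC (Re J) (- Im J) * F t)%X) a b) (RInt (fun t => Im (mkC (Re J) (- Im J) * F t)%X) a b)))
    with (RInt (fun t => Re (mkC (Re J) (- Im J) * F t)%X) a b) in S.
  assert (B := abs_RInt_le_const (fun t => Re (mkC (Re J) (- Im J) * F t)%X) a b (Cabs J * M) Hab (proj1 (tint_scal _ _ _ _ HF))).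
  assert (B' : Rabs (RInt (fun t => Re (mkC (Re J) (- Im J) * F t)%X) a b) <= (b - a) * (Cabs J * M)).
  { apply B. intros t _. eapply Rle_trans; [apply Re_le_Cabs|]. rewrite Cabs_mul, AC.
    apply Rmult_le_compat_l; [lra | apply HM]. }
  rewrite S in B'. rewrite Rabs_pos_eq in B' by nra.
  apply Rmult_le_reg_l with (Cabs J); [exact P|]. lra.
Qed.

Lemma ccont_bounded_circ (F : Cplx -> Cplx) (r : R) :
  (forall t, ccont F (circ r t)) -> exists M, 0 <= M /\ forall t, Cabs (F (circ r t)) <= M.
Proof.
  intros H.
  assert (B : forall f : R -> R, (forall t, continuous f t) -> exists M, forall t, 0 <= t <= 2 * PI -> f t <= M).
  { intros f Hf. destruct (continuity_ab_maj f 0 (2 * PI)) as [m [Hm _]].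
    - assert (P := PI_RGT_0); lra.
    - intros c _. apply continuity_pt_filterlim, Hf.
    - exists (f m). auto. }
  assert (C1 : forall t, continuous (fun s => Re (F (circ r s))) t).
  { intros t. apply (continuity_2d_continuous (fun u v => Re (F (circ u v)))), ccont_circ_2d, H. }
  assert (C2 : forall t, continuous (fun s => Im (F (circ r s))) t).
  { intros t. apply (continuity_2d_continuous (fun u v => Im (F (circ u v)))), ccont_circ_2d, H. }
  destruct (B (fun s => Rabs (Re (F (circ r s))))) as [M1 H1].
  { intros t. apply (continuous_comp (fun s => Re (F (circ r s))) Rabs); [apply C1 | apply continuous_Rabs]. }
  destruct (B (fun s => Rabs (Im (F (circ r s))))) as [M2 H2].
  { intros t. apply (continuous_comp (fun s => Im (F (circ r s))) Rabs); [apply C2 | apply continuous_Rabs]. }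
  assert (K : forall t, 0 <= t <= 2 * PI -> Cabs (F (circ r t)) <= M1 + M2).
  { intros t Ht. eapply Rle_trans; [apply Cabs_le_ReIm|]. specialize (H1 t Ht). specialize (H2 t Ht). lra. }
  exists (M1 + M2). split.
  - eapply Rle_trans; [apply Cabs_ge0 | apply (K 0)]. assert (P := PI_RGT_0); lra.
  - intros t.
    assert (PP := PI_RGT_0).
    destruct (euclidian_division t (2 * PI)) as (k & y & E & Hy); [lra|].
    rewrite Rabs_pos_eq in Hy by lra.
    replace (circ r t) with (circ r y); [apply K; lra|].
    unfold circ. f_equal. rewrite E, cis_add.
    assert (Z : cis (IZR k * (2 * PI)) = 1%X).
    { destruct (Z.lt_ge_cases k 0) as [Hk|Hk].
      - apply Ceq; simpl.
        + rewrite <- cos_neg. replace (- (IZR k * (2 * PI))) with (2 * PI * INR (Z.to_nat (- k))).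
          * exact (f_equal Re (cis_2PI_nat _)).
          * rewrite INR_IZR_INZ, Z2Nat.id, opp_IZR by lia. ring.
        + replace (IZR k * (2 * PI)) with (- (2 * PI * INR (Z.to_nat (- k)))).
          * rewrite sin_neg. rewrite (f_equal Im (cis_2PI_nat _) : sin _ = _). simpl. ring.
          * rewrite INR_IZR_INZ, Z2Nat.id, opp_IZR by lia. ring.
      - replace (IZR k * (2 * PI)) with (2 * PI * INR (Z.to_nat k)); [apply cis_2PI_nat|].
        rewrite INR_IZR_INZ, Z2Nat.id by lia. ring. }
    rewrite Z. ring.
Qed.

Lemma circle_integral_continuous (F : Cplx -> Cplx) (r0 : R) :
  (forall t, ccont F (circ r0 t)) -> forall eps, 0 < eps ->
  exists del, 0 < del /\ forall r, Rabs (r - r0) <= del -> (forall t, ccont F (circ r t)) ->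
    Cabs (CInt (fun t => F (circ r t)) 0 (2 * PI) - CInt (fun t => F (circ r0 t)) 0 (2 * PI))%X <= eps.
Proof.
  intros H eps He. assert (PP := PI_RGT_0).
  assert (E1 : 0 < eps / (4 * PI)) by (apply Rdiv_lt_0_compat; lra).
  destruct (uniform_continuity_2d_1d' (fun u v => Re (F (circ u v))) 0 (2 * PI) r0) with (eps := mkposreal _ E1) as [d1 H1].
  { intros. now apply ccont_circ_2d. }
  destruct (uniform_continuity_2d_1d' (fun u v => Im (F (circ u v))) 0 (2 * PI) r0) with (eps := mkposreal _ E1) as [d2 H2].
  { intros. now apply ccont_circ_2d. }
  exists (Rmin d1 d2). split; [apply Rmin_pos; apply cond_pos|]. intros r Hr Hc.
  assert (M1 := Rmin_l d1 d2). assert (M2 := Rmin_r d1 d2).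
  apply Rabs_le_between in Hr.
  destruct (tint_circ F r 0 (2 * PI) Hc) as [T1 T2]. destruct (tint_circ F r0 0 (2 * PI) H) as [T3 T4].
  eapply Rle_trans; [apply Cabs_le_ReIm|]. simpl.
  assert (D1 := cond_pos d1). assert (D2 := cond_pos d2).
  assert (A1 : Rabs (RInt (fun t => Re (F (circ r t)) - Re (F (circ r0 t))) 0 (2 * PI)) <= (2 * PI - 0) * (eps / (4 * PI))).
  { apply abs_RInt_le_const; [lra | apply (ex_RInt_minus (fun t => Re (F (circ r t))) (fun t => Re (F (circ r0 t)))); assumption|].
    intros t Ht. left. apply H1; try lra. replace (t - t) with 0 by ring. rewrite Rabs_R0. exact D1. }
  assert (A2 : Rabs (RInt (fun t => Im (F (circ r t)) - Im (F (circ r0 t))) 0 (2 * PI)) <= (2 * PI - 0) * (eps / (4 * PI))).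
  { apply abs_RInt_le_const; [lra | apply (ex_RInt_minus (fun t => Im (F (circ r t))) (fun t => Im (F (circ r0 t)))); assumption|].
    intros t Ht. left. apply H2; try lra. replace (t - t) with 0 by ring. rewrite Rabs_R0. exact D2. }
  rewrite (RInt_minus (fun t => Re (F (circ r t))) (fun t => Re (F (circ r0 t)))) in A1 by assumption.
  rewrite (RInt_minus (fun t => Im (F (circ r t))) (fun t => Im (F (circ r0 t)))) in A2 by assumption.
  unfold minus, plus, opp in A1, A2; simpl in A1, A2.
  replace ((2 * PI - 0) * (eps / (4 * PI))) with (eps / 2) in A1, A2 by (field; lra). lra.
Qed.

(* Constancy on both sides of |w| and continuity across |w| replace the residue computation. *)
Lemma circle_integral_zero (K : Cplx -> Cplx) (R0 r : R) (w : Cplx) :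
  0 <= r < R0 -> (forall z, Cabs z < R0 -> ccont K z) ->
  (forall z, Cabs z < R0 -> z <> w -> exists l, cderiv K z l) ->
  CInt (fun t => (circ r t * K (circ r t))%X) 0 (2 * PI) = 0%X.
Proof.
  intros Hr HC HD. set (F := fun z => (z * K z)%X). set (I := fun r => CInt (fun t => F (circ r t)) 0 (2 * PI)).
  assert (FC : forall z, Cabs z < R0 -> ccont F z).
  { intros z Hz. apply (lim0_mul (fun h => (z + h)%X) (fun h => K (z + h)%X)); [|now apply HC].
    apply (cderiv_ccont (fun w => w) z 1%X), cderiv_id. }
  assert (FCr : forall s t, 0 <= s < R0 -> ccont F (circ s t)).
  { intros s t Hs. apply FC. rewrite Cabs_circ; lra. }
  assert (FD : forall z, Cabs z < R0 -> z <> w -> exists l, cderiv F z l).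
  { intros z Hz Hw. destruct (HD z Hz Hw) as [l Hl]. eexists. apply (cderiv_mul (fun w => w)); [apply cderiv_id | exact Hl]. }
  assert (I0 : I 0 = 0%X).
  { unfold I. rewrite (CInt_ext _ (fun _ => 0%X)).
    - rewrite CInt_const. ring.
    - intros t. unfold F, circ. ring. }
  assert (CONST : forall s1 s2, 0 < s1 <= s2 -> s2 < R0 -> (forall z, s1 <= Cabs z <= s2 -> z <> w) -> I s1 = I s2).
  { intros s1 s2 H1 H2 H3. apply annulus_invariance; try lra. intros z Hz. apply FD; [lra | auto]. }
  assert (CLOSE : forall r0 x, 0 <= r0 < R0 -> (forall eps, 0 < eps -> exists r', 0 <= r' < R0 /\ Rabs (r' - r0) <= eps /\ I r' = x) -> I r0 = x).
  { intros r0 x Hr0 Hx. symmetry. apply Csub_eq0, Cabs_eq0, Rle_antisym; [|apply Cabs_ge0].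
    apply le_epsilon. intros eps He. rewrite Rplus_0_l.
    destruct (circle_integral_continuous F r0) with (eps := eps) as [d [Hd H1]]; [intros; now apply FCr | exact He|].
    destruct (Hx d Hd) as (r' & H2 & H3 & H4). specialize (H1 r' H3). unfold I in H4. rewrite H4 in H1. apply H1.
    intros; now apply FCr. }
  set (a := Cabs w). assert (Ha : 0 <= a) by apply Cabs_ge0.
  assert (SMALL : forall s, 0 <= s < R0 -> s < a -> I s = 0%X).
  { intros s Hs Hsa. destruct (Req_dec s 0) as [-> | Hs0]; [exact I0|].
    symmetry. rewrite <- I0. apply CLOSE; [lra|]. intros eps He. exists (Rmin s eps).
    assert (M1 := Rmin_l s eps). assert (M2 := Rmin_r s eps). assert (M3 : 0 < Rmin s eps) by (apply Rmin_pos; lra).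
    split; [lra|]. split; [rewrite Rabs_pos_eq; lra|]. apply CONST; [lra | lra|].
    intros z Hz ->. fold a in Hz. lra. }
  assert (AT : a < R0 -> I a = 0%X).
  { intros HaR. destruct (Req_dec a 0) as [-> | Ha0]; [exact I0|].
    apply CLOSE; [lra|]. intros eps He. exists (a - Rmin (a / 2) eps).
    assert (M1 := Rmin_l (a / 2) eps). assert (M2 := Rmin_r (a / 2) eps). assert (M3 : 0 < Rmin (a / 2) eps) by (apply Rmin_pos; lra).
    split; [lra|]. split; [rewrite Rabs_left; lra|]. apply SMALL; lra. }
  fold (F (circ r 0)). change (I r = 0%X).
  destruct (Rlt_le_dec r a) as [H|H]; [now apply SMALL|].
  destruct (Req_dec r a) as [-> | H']; [apply AT; lra|].
  symmetry. rewrite <- AT by lra. apply CLOSE; [lra|]. intros eps He. exists (a + Rmin (r - a) eps).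
  assert (M1 := Rmin_l (r - a) eps). assert (M2 := Rmin_r (r - a) eps). assert (M3 : 0 < Rmin (r - a) eps) by (apply Rmin_pos; lra).
  split; [lra|]. split; [rewrite Rabs_pos_eq; lra|]. apply CONST; [lra | lra|].
  intros z Hz ->. fold a in Hz. lra.
Qed.

Lemma cderiv_shift (z w : Cplx) : cderiv (fun x => (x - w)%X) z 1%X.
Proof.
  assert (H := cderiv_sub _ _ _ _ _ (cderiv_id z) (cderiv_const w z)).
  replace (1 - 0)%X with 1%X in H by ring. exact H.
Qed.

Lemma cderiv_div (f g : Cplx -> Cplx) (z l m : Cplx) :
  g z <> 0%X -> cderiv f z l -> cderiv g z m -> exists d, cderiv (fun x => (f x / g x)%X) z d.
Proof.
  intros Hz Hf Hg. eexists. apply (cderiv_mul f (fun x => Cinv (g x))); [exact Hf | apply cderiv_inv; eassumption].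
Qed.

(** By invariance the radius may tend to infinity. There [z / (z - w) = 1 + w / (z - w)], and the
    second term tends to 0. *)
Lemma CInt_cauchy_kernel (r : R) (w : Cplx) :
  Cabs w < r -> CInt (fun t => (circ r t / (circ r t - w))%X) 0 (2 * PI) = RtoC (2 * PI).
Proof.
  intros Hw. assert (A0 := Cabs_ge0 w). assert (PP := PI_RGT_0).
  set (F := fun z => (z / (z - w))%X). set (G := fun z => (w / (z - w))%X).
  assert (NZ : forall z, Cabs w < Cabs z -> (z - w)%X <> 0%X).
  { intros z Hz E. apply Csub_eq0 in E. subst; lra. }
  assert (FD : forall z, Cabs w < Cabs z -> exists l, cderiv F z l).
  { intros z Hz. apply (cderiv_div (fun x => x) (fun x => (x - w)%X) z 1%X 1%X); [now apply NZ | apply cderiv_id | apply cderiv_shift]. }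
  assert (GD : forall z, Cabs w < Cabs z -> exists l, cderiv G z l).
  { intros z Hz. apply (cderiv_div (fun x => w) (fun x => (x - w)%X) z 0%X 1%X); [now apply NZ | apply cderiv_const | apply cderiv_shift]. }
  change (CInt (fun t => F (circ r t)) 0 (2 * PI) = RtoC (2 * PI)).
  apply Csub_eq0, Cabs_eq0, Rle_antisym; [|apply Cabs_ge0].
  apply le_epsilon. intros eps He. rewrite Rplus_0_l.
  set (s := Rmax r (Cabs w + 2 * PI * (Cabs w + 1) / eps)).
  assert (S1 : r <= s) by apply Rmax_l. assert (S2 : Cabs w + 2 * PI * (Cabs w + 1) / eps <= s) by apply Rmax_r.
  rewrite (annulus_invariance F r s); [| lra | lra | intros z Hz; apply FD; lra].
  assert (Z : forall t, Cabs w < Cabs (circ s t)) by (intros; rewrite Cabs_circ; lra).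
  assert (TG : tint (fun t => G (circ s t)) 0 (2 * PI)).
  { apply tint_circ. intros t. destruct (GD (circ s t) (Z t)) as [l Hl]. exact (cderiv_ccont _ _ _ Hl). }
  rewrite (CInt_ext _ (fun t => (1 + G (circ s t))%X)).
  2:{ intros t. unfold F, G. field. apply NZ, Z. }
  rewrite (CInt_add (fun _ => 1%X)); [| apply tint_const | exact TG].
  rewrite CInt_const. replace (RtoC (2 * PI - 0) * 1 + CInt (fun t => G (circ s t)) 0 (2 * PI) - RtoC (2 * PI))%X with
    (CInt (fun t => G (circ s t)) 0 (2 * PI)) by (rewrite Rminus_0_r; ring).
  eapply Rle_trans; [apply (CInt_norm_le _ 0 (2 * PI) (Cabs w / (s - Cabs w))); [lra | exact TG|]|].
  - intros t. unfold G. rewrite Cabs_div by apply NZ, Z.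
    assert (L := Cabs_sub_ge (circ s t) w). rewrite Cabs_circ in L by lra.
    apply Rmult_le_compat_l; [lra|]. apply Rinv_le_contravar; lra.
  - apply Rmult_le_reg_r with (s - Cabs w); [lra|].
    replace ((2 * PI - 0) * (Cabs w / (s - Cabs w)) * (s - Cabs w)) with (2 * PI * Cabs w) by (field; lra).
    apply Rle_trans with (eps * (2 * PI * (Cabs w + 1) / eps)).
    + replace (eps * (2 * PI * (Cabs w + 1) / eps)) with (2 * PI * (Cabs w + 1)) by (field; lra). nra.
    + apply Rmult_le_compat_l; lra.
Qed.

(** The difference quotient [K] of [f] at [w] is continuous at [w] and differentiable elsewhere, so
    [circle_integral_zero] applies to it. What remains is [f w] times the integral of the kernel. *)
Lemma cauchy_formula (f : Cplx -> Cplx) (R0 r : R) (w : Cplx) :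
  holo_on (disk R0) f -> Cabs w < r < R0 ->
  CInt (fun t => (f (circ r t) * (circ r t / (circ r t - w)))%X) 0 (2 * PI) = (RtoC (2 * PI) * f w)%X.
Proof.
  intros Hf Hr. assert (A0 := Cabs_ge0 w).
  destruct (Hf w) as [l Hl]; [unfold disk; lra|].
  assert (HPHI := Hl). apply cderiv_iff in HPHI. destruct HPHI as (phi & E & V & L).
  set (K := fun z => phi (z - w)%X).
  assert (KE : forall z, z <> w -> K z = ((f z - f w) / (z - w))%X).
  { intros z Hz. unfold K. specialize (E (z - w)%X). replace (w + (z - w))%X with z in E by ring. rewrite E.
    field. now apply Csub_neq0. }
  assert (KD : forall z, Cabs z < R0 -> z <> w -> exists d, cderiv K z d).
  { intros z Hz Hw. destruct (Hf z Hz) as [m Hm].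
    destruct (cderiv_div (fun x => (f x - f w)%X) (fun x => (x - w)%X) z (m - 0)%X 1%X) as [d Hd].
    - now apply Csub_neq0.
    - apply cderiv_sub; [exact Hm | apply cderiv_const].
    - apply cderiv_shift.
    - exists d. assert (P := Cabs_pos _ (Csub_neq0 _ _ Hw)). apply cderiv_ext_near with (fun x => ((f x - f w) / (x - w))%X) (Cabs (z - w)%X); [exact P | | exact Hd].
      intros h Hh. symmetry. apply KE. intros Eq. assert (h = (w - z)%X) by (rewrite <- Eq; ring). subst h.
      rewrite Cabs_sub_sym in Hh. lra. }
  assert (KC : forall z, Cabs z < R0 -> ccont K z).
  { intros z Hz. destruct (Ceq_dec z w) as [-> | Hw].
    - unfold ccont, K. replace (w - w)%X with 0%X by ring. rewrite V.
      apply lim0_ext with phi; [|exact L]. intros h. f_equal. ring.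
    - destruct (KD z Hz Hw) as [d Hd]. exact (cderiv_ccont _ _ _ Hd). }
  assert (Z := circle_integral_zero K R0 r w ltac:(lra) KC KD).
  assert (NZ : forall t, (circ r t - w)%X <> 0%X).
  { intros t Eq. apply Csub_eq0 in Eq. assert (H := Cabs_circ r t ltac:(lra)). rewrite Eq in H. lra. }
  assert (T1 : tint (fun t => (circ r t * K (circ r t))%X) 0 (2 * PI)).
  { apply (tint_circ (fun z => (z * K z)%X)). intros t.
    apply (lim0_mul (fun h => (circ r t + h)%X) (fun h => K (circ r t + h)%X)).
    - apply (cderiv_ccont (fun w => w) _ 1%X), cderiv_id.
    - apply KC. rewrite Cabs_circ; lra. }
  assert (T2 : tint (fun t => (circ r t / (circ r t - w))%X) 0 (2 * PI)).
  { apply (tint_circ (fun z => (z / (z - w))%X)). intros t.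
    destruct (cderiv_div (fun x => x) (fun x => (x - w)%X) (circ r t) 1%X 1%X (NZ t) (cderiv_id _) (cderiv_shift _ _)) as [d Hd].
    exact (cderiv_ccont _ _ _ Hd). }
  rewrite (CInt_ext _ (fun t => (circ r t * K (circ r t) + f w * (circ r t / (circ r t - w)))%X)).
  - rewrite CInt_add; [| exact T1 | now apply tint_scal].
    rewrite CInt_scal by exact T2. rewrite Z, CInt_cauchy_kernel by lra. ring.
  - intros t. rewrite KE by (intros Eq; apply (NZ t); rewrite Eq; ring). field. apply NZ.
Qed.

Lemma tint_csum (n : nat) (F : nat -> R -> Cplx) (a b : R) :
  (forall i, tint (F i) a b) -> tint (fun t => csum n (fun i => F i t)) a b /\
  CInt (fun t => csum n (fun i => F i t)) a b = csum n (fun i => CInt (F i) a b).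
Proof.
  intros H. induction n as [|n [IH1 IH2]]; simpl.
  - split; [apply tint_const | rewrite CInt_const; ring].
  - split; [now apply tint_add |]. rewrite CInt_add, IH2; auto.
Qed.

(** The Cauchy kernel is expanded as a finite geometric sum with its exact remainder. Partial sums
    with an explicit error bound are all that is used later, so no infinite series is formed. *)
Lemma power_expansion (f : Cplx -> Cplx) (R0 r M : R) :
  holo_on (disk R0) f -> 0 < r < R0 -> (forall z, Cabs z = r -> Cabs (f z) <= M) ->
  exists c : nat -> Cplx, (forall i, Cabs (c i) * r ^ i <= M) /\
    forall n w, Cabs w < r ->
      Cabs (f w - csum n (fun i => c i * w ^ i))%X <= M * (Cabs w / r) ^ n * (r / (r - Cabs w)).
Proof.
  intros Hf Hr HM. assert (PP := PI_RGT_0).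
  assert (NZ0 : forall t, circ r t <> 0%X) by (intros t; apply Cabs_neq0; rewrite Cabs_circ; lra).
  assert (PIn : RtoC (2 * PI) <> 0%X) by (intros E; apply (f_equal Re) in E; simpl in E; lra).
  assert (FD : forall t, exists l, cderiv f (circ r t) l) by (intros t; apply Hf; unfold disk; rewrite Cabs_circ; lra).
  assert (TC : forall i, tint (fun t => (f (circ r t) / (circ r t ^ i))%X) 0 (2 * PI)).
  { intros i. apply (tint_circ (fun z => (f z / z ^ i)%X)). intros t.
    destruct (FD t) as [l Hl]. destruct (cderiv_pow (circ r t) i) as [m Hm].
    destruct (cderiv_div f (fun x => (x ^ i)%X) (circ r t) l m) as [d Hd]; try assumption.
    - apply Cpow_neq0, NZ0.
    - exact (cderiv_ccont _ _ _ Hd). }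
  set (c := fun i => (CInt (fun t => (f (circ r t) / (circ r t ^ i))%X) 0 (2 * PI) / RtoC (2 * PI))%X).
  assert (A2 : Cabs (RtoC (2 * PI)) = 2 * PI) by (rewrite Cabs_RtoC, Rabs_pos_eq; lra).
  exists c. split.
  - intros i. unfold c. rewrite Cabs_div, A2 by exact PIn.
    assert (P : 0 < r ^ i) by (apply pow_lt; lra).
    assert (B : Cabs (CInt (fun t => (f (circ r t) / (circ r t ^ i))%X) 0 (2 * PI)) <= (2 * PI - 0) * (M / r ^ i)).
    { apply CInt_norm_le; [lra | apply TC|]. intros t. rewrite Cabs_div by apply Cpow_neq0, NZ0.
      rewrite Cabs_pow, Cabs_circ by lra. apply Rmult_le_compat_r.
      - left; now apply Rinv_0_lt_compat.
      - apply HM. apply Cabs_circ; lra. }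
    apply Rmult_le_reg_r with (2 * PI / r ^ i); [apply Rdiv_lt_0_compat; lra|].
    replace (Cabs (CInt (fun t => (f (circ r t) / (circ r t ^ i))%X) 0 (2 * PI)) / (2 * PI) * r ^ i * (2 * PI / r ^ i)) with
      (Cabs (CInt (fun t => (f (circ r t) / (circ r t ^ i))%X) 0 (2 * PI))) by (field; lra).
    lra.
  - intros n w Hw. assert (A0 := Cabs_ge0 w).
    assert (NZ : forall t, (circ r t - w)%X <> 0%X).
    { intros t Eq. apply Csub_eq0 in Eq. assert (H := Cabs_circ r t ltac:(lra)). rewrite Eq in H. lra. }
    assert (CF := cauchy_formula f R0 r w Hf ltac:(lra)).
    set (T := fun t => (w ^ n * (f (circ r t) / circ r t ^ n * (circ r t / (circ r t - w))))%X).
    assert (TT : tint T 0 (2 * PI)).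
    { apply tint_scal. apply (tint_circ (fun z => (f z / z ^ n * (z / (z - w)))%X)). intros t.
      destruct (FD t) as [l Hl]. destruct (cderiv_pow (circ r t) n) as [m Hm].
      destruct (cderiv_div f (fun x => (x ^ n)%X) (circ r t) l m) as [d Hd]; [apply Cpow_neq0, NZ0 | assumption | assumption |].
      destruct (cderiv_div (fun x => x) (fun x => (x - w)%X) (circ r t) 1%X 1%X (NZ t) (cderiv_id _) (cderiv_shift _ _)) as [d' Hd'].
      exact (cderiv_ccont _ _ _ (cderiv_mul _ _ _ _ _ Hd Hd')). }
    destruct (tint_csum n (fun i t => (w ^ i * (f (circ r t) / circ r t ^ i))%X) 0 (2 * PI)) as [TS ES].
    { intros i. apply tint_scal, TC. }
    rewrite (CInt_ext _ (fun t => (csum n (fun i => w ^ i * (f (circ r t) / circ r t ^ i)) + T t)%X)) in CF.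
    2:{ intros t. unfold T.
        assert (G := csum_geom n (w / circ r t)%X).
        rewrite (csum_ext n (fun i => (w ^ i * (f (circ r t) / circ r t ^ i))%X) (fun i => (f (circ r t) * (w / circ r t) ^ i)%X)).
        - rewrite csum_scal.
          assert (P1 : ((w / circ r t) ^ n * circ r t ^ n)%X = (w ^ n)%X).
          { rewrite <- Cpow_mul_base. f_equal. field. apply NZ0. }
          change (fun k => ((w / circ r t) ^ k)%X) with (Cpow (w / circ r t)) in G.
          assert (G2 : csum n (Cpow (w / circ r t)%X) = ((1 - (w / circ r t) ^ n) / (1 - w / circ r t))%X)
            by (rewrite <- G; field; split; [apply NZ0 | apply NZ]).
          rewrite G2.
          rewrite <- P1. assert (N2 := Cpow_neq0 _ n (NZ0 t)).
          set (x := ((w / circ r t) ^ n)%X). clearbody x. set (y := (circ r t ^ n)%X) in *. clearbody y.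
          field. repeat split; try apply NZ; try apply NZ0; exact N2.
        - intros k _.
          assert (P1 : ((w / circ r t) ^ k * circ r t ^ k)%X = (w ^ k)%X).
          { rewrite <- Cpow_mul_base. f_equal. field. apply NZ0. }
          rewrite <- P1. assert (N2 := Cpow_neq0 _ k (NZ0 t)).
          set (x := ((w / circ r t) ^ k)%X). clearbody x. field. exact N2. }
    rewrite CInt_add, ES in CF by assumption.
    assert (EC : csum n (fun i => CInt (fun t => (w ^ i * (f (circ r t) / circ r t ^ i))%X) 0 (2 * PI)) =
                 (RtoC (2 * PI) * csum n (fun i => c i * w ^ i))%X).
    { rewrite <- csum_scal. apply csum_ext. intros i _. rewrite CInt_scal by apply TC. unfold c. field. exact PIn. }
    rewrite EC in CF.
    assert (EQ : (f w - csum n (fun i => c i * w ^ i))%X = (CInt T 0 (2 * PI) / RtoC (2 * PI))%X).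
    { assert (X : (CInt T 0 (2 * PI))%X = (RtoC (2 * PI) * f w - RtoC (2 * PI) * csum n (fun i => c i * w ^ i))%X).
      { rewrite <- CF. ring. }
      rewrite X. field. exact PIn. }
    rewrite EQ, Cabs_div, A2 by exact PIn.
    set (B := M * (Cabs w / r) ^ n * (r / (r - Cabs w))).
    assert (BB : Cabs (CInt T 0 (2 * PI)) <= (2 * PI - 0) * B).
    { apply CInt_norm_le; [lra | exact TT|]. intros t. unfold T, B.
      rewrite !Cabs_mul, Cabs_pow, !Cabs_div, Cabs_pow, Cabs_circ by (try apply NZ; try apply Cpow_neq0, NZ0; lra).
      assert (M1 : Cabs (f (circ r t)) <= M) by (apply HM, Cabs_circ; lra).
      assert (L := Cabs_sub_ge (circ r t) w). rewrite Cabs_circ in L by lra.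
      assert (P : 0 < r ^ n) by (apply pow_lt; lra). assert (P2 : 0 <= Cabs w ^ n) by (apply pow_le; lra).
      replace ((Cabs w / r) ^ n) with (Cabs w ^ n / r ^ n) by (unfold Rdiv; rewrite Rpow_mult_distr, pow_inv; reflexivity).
      replace (M * (Cabs w ^ n / r ^ n) * (r / (r - Cabs w))) with (Cabs w ^ n * (M / r ^ n * (r / (r - Cabs w)))) by (field; lra).
      apply Rmult_le_compat_l; [exact P2|].
      apply Rmult_le_compat.
      - apply Rmult_le_pos; [apply Cabs_ge0 | left; now apply Rinv_0_lt_compat].
      - apply Rmult_le_pos; [lra|]. left; apply Rinv_0_lt_compat; lra.
      - apply Rmult_le_compat_r; [left; now apply Rinv_0_lt_compat | exact M1].
      - apply Rmult_le_compat_l; [lra|]. apply Rinv_le_contravar; lra. }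
    apply Rmult_le_reg_l with (2 * PI); [lra|]. unfold Rdiv.
    replace (2 * PI * (Cabs (CInt T 0 (2 * PI)) * / (2 * PI))) with (Cabs (CInt T 0 (2 * PI))) by (field; lra). lra.
Qed.

(** Bounds over angles become bounds over points: a point of the circle has the angle
    [acos (Re z / r)] or its opposite, real points being treated apart. *)
Lemma holo_bounded_circle (f : Cplx -> Cplx) (R0 r : R) :
  holo_on (disk R0) f -> 0 < r < R0 -> exists M, 0 <= M /\ forall z, Cabs z = r -> Cabs (f z) <= M.
Proof.
  intros Hf Hr. destruct (ccont_bounded_circ f r) as [M [H0 HM]].
  - intros t. destruct (Hf (circ r t)) as [l Hl]; [unfold disk; rewrite Cabs_circ; lra | exact (cderiv_ccont _ _ _ Hl)].
  - exists M. split; [exact H0|]. intros z Hz.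
    destruct (Req_dec (Im z) 0) as [E|E].
    + assert (Q := Cabs_sq z). rewrite Hz, E in Q.
      assert (C : (Re z - r) * (Re z + r) = 0) by lra.
      apply Rmult_integral in C. destruct C as [C|C].
      * replace z with (circ r 0); [apply HM|]. unfold circ. rewrite cis_0. apply Ceq; simpl; lra.
      * replace z with (circ r PI); [apply HM|]. apply Ceq; simpl; rewrite ?cos_PI, ?sin_PI; lra.
    + assert (Q := Cabs_sq z). rewrite Hz in Q.
      assert (HB : -1 <= Re z / r <= 1).
      { split; apply Rmult_le_reg_r with r; try lra; unfold Rdiv; rewrite Rmult_assoc, Rinv_l by lra; nra. }
      set (a := acos (Re z / r)).
      assert (CA : cos a = Re z / r) by (apply cos_acos; lra).
      assert (SA : sin a * sin a = 1 - (Re z / r) * (Re z / r)).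
      { assert (S := sin2_cos2 a). unfold Rsqr in S. rewrite CA in S. lra. }
      assert (SI : (r * sin a - Im z) * (r * sin a + Im z) = 0).
      { replace ((r * sin a - Im z) * (r * sin a + Im z)) with (r * r * (sin a * sin a) - Im z * Im z) by ring.
        rewrite SA. replace (r * r * (1 - Re z / r * (Re z / r))) with (r * r - Re z * Re z) by (field; lra). lra. }
      apply Rmult_integral in SI. destruct SI as [SI|SI].
      * replace z with (circ r a); [apply HM|]. apply Ceq; simpl; rewrite ?CA; [field_simplify; lra | lra].
      * replace z with (circ r (- a)); [apply HM|]. unfold circ, cis. rewrite cos_neg, sin_neg. apply Ceq; simpl; rewrite ?CA; [field_simplify; lra | lra].
Qed.

(** * Consequences of the power series expansion *)

Lemma holo_sub (U : Cplx -> Prop) (f g : Cplx -> Cplx) :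
  holo_on U f -> holo_on U g -> holo_on U (fun z => (f z - g z)%X).
Proof. intros Hf Hg z Hz. destruct (Hf z Hz) as [l Hl]. destruct (Hg z Hz) as [m Hm]. eexists. apply cderiv_sub; eassumption. Qed.

Lemma holo_mul (U : Cplx -> Prop) (f g : Cplx -> Cplx) :
  holo_on U f -> holo_on U g -> holo_on U (fun z => (f z * g z)%X).
Proof. intros Hf Hg z Hz. destruct (Hf z Hz) as [l Hl]. destruct (Hg z Hz) as [m Hm]. eexists. apply cderiv_mul; eassumption. Qed.

Lemma holo_div (U : Cplx -> Prop) (f g : Cplx -> Cplx) :
  holo_on U f -> holo_on U g -> (forall z, U z -> g z <> 0%X) -> holo_on U (fun z => (f z / g z)%X).
Proof. intros Hf Hg Hn z Hz. destruct (Hf z Hz) as [l Hl]. destruct (Hg z Hz) as [m Hm]. eapply cderiv_div; eauto. Qed.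

Lemma holo_const (U : Cplx -> Prop) (c : Cplx) : holo_on U (fun _ => c).
Proof. intros z _. eexists; apply cderiv_const. Qed.

Lemma holo_id (U : Cplx -> Prop) : holo_on U (fun z => z).
Proof. intros z _. eexists; apply cderiv_id. Qed.

Lemma holo_sub_set (U V : Cplx -> Prop) (f : Cplx -> Cplx) :
  (forall z, V z -> U z) -> holo_on U f -> holo_on V f.
Proof. intros H Hf z Hz. apply Hf, H, Hz. Qed.

Lemma cderiv_translate (f : Cplx -> Cplx) (a z l : Cplx) :
  cderiv f (a + z)%X l <-> cderiv (fun w => f (a + w)%X) z l.
Proof.
  split; intros H eps He; destruct (H eps He) as [d [Hd H1]]; exists d; (split; [exact Hd|]); intros h Hh; specialize (H1 h Hh).
  - replace (a + (z + h))%X with (a + z + h)%X by ring. exact H1.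
  - replace (a + (z + h))%X with (a + z + h)%X in H1 by ring. exact H1.
Qed.

Lemma holo_translate (f : Cplx -> Cplx) (R0 r : R) (a : Cplx) :
  Cabs a + r <= R0 -> holo_on (disk R0) f -> holo_on (disk r) (fun w => f (a + w)%X).
Proof.
  intros Hr Hf w Hw. unfold disk in Hw. destruct (Hf (a + w)%X) as [l Hl].
  - unfold disk. assert (H := Cabs_add a w). lra.
  - exists l. now apply (cderiv_translate f a w l).
Qed.

(** This takes the place of the maximum principle, at the price of the factor [r / (r - Cabs w)]. It
    is the case of the empty partial sum. *)
Lemma holo_bound (f : Cplx -> Cplx) (R0 r M : R) (w : Cplx) :
  holo_on (disk R0) f -> 0 < r < R0 -> (forall z, Cabs z = r -> Cabs (f z) <= M) ->
  Cabs w < r -> Cabs (f w) <= M * (r / (r - Cabs w)).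
Proof.
  intros Hf Hr HM Hw. destruct (power_expansion f R0 r M Hf Hr HM) as [c [_ H]].
  specialize (H O w Hw). simpl in H. replace (f w - 0)%X with (f w) in H by ring. lra.
Qed.

(** The second coefficient gives the derivative of the difference quotient in [divide_zero] and that
    of the derivative in [holo_derivative]; a cubic remainder is what makes these derivatives
    exist. *)
Lemma cubic_expansion (f : Cplx -> Cplx) (rho : R) :
  0 < rho -> holo_on (disk rho) f -> exists b1 b2 K del, 0 < del <= rho /\ 0 <= K /\
    forall h, Cabs h < del -> Cabs (f h - (f 0%X + b1 * h + b2 * (h * h)))%X <= K * (Cabs h * Cabs h * Cabs h).
Proof.
  intros Hr Hf. destruct (holo_bounded_circle f rho (rho / 2) Hf) as [M [M0 HM]]; [lra|].
  destruct (power_expansion f rho (rho / 2) M Hf) as [c [_ H]]; [lra | exact HM|].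
  assert (E0 : c O = f 0%X).
  { specialize (H 1%nat 0%X). rewrite Cabs_0 in H. specialize (H ltac:(lra)).
    simpl in H. symmetry. apply Csub_eq0, Cabs_eq0, Rle_antisym; [|apply Cabs_ge0].
    replace (f 0 - (0 + c O * 1))%X with (f 0 - c O)%X in H by ring. unfold Rdiv in H. rewrite Rmult_0_l, Rmult_0_l in H. lra. }
  exists (c 1%nat), (c 2%nat), (M * (2 / rho * (2 / rho) * (2 / rho)) * 2), (rho / 4).
  assert (0 < / rho) by (apply Rinv_0_lt_compat; lra).
  split; [lra|]. split; [unfold Rdiv; repeat apply Rmult_le_pos; lra|].
  intros h Hh. specialize (H 3%nat h ltac:(lra)). simpl in H.
  replace (0 + c O * 1 + c 1%nat * (h * 1) + c 2%nat * (h * (h * 1)))%X with (f 0 + c 1%nat * h + c 2%nat * (h * h))%X in H by (rewrite E0; ring).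
  eapply Rle_trans; [exact H|].
  assert (A := Cabs_ge0 h).
  replace (M * (Cabs h / (rho / 2) * (Cabs h / (rho / 2) * (Cabs h / (rho / 2) * 1)))) with
     (M * (2 / rho * (2 / rho) * (2 / rho)) * (Cabs h * Cabs h * Cabs h)) by (field; lra).
  assert (Q : rho / 2 / (rho / 2 - Cabs h) <= 2).
  { apply Rmult_le_reg_r with (rho / 2 - Cabs h); [lra|].
    replace (rho / 2 / (rho / 2 - Cabs h) * (rho / 2 - Cabs h)) with (rho / 2) by (field; lra). lra. }
  set (X := M * (2 / rho * (2 / rho) * (2 / rho))).
  assert (0 <= X) by (unfold X, Rdiv; repeat apply Rmult_le_pos; lra).
  assert (0 <= Cabs h * Cabs h * Cabs h) by (repeat apply Rmult_le_pos; lra).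
  replace (X * 2 * (Cabs h * Cabs h * Cabs h)) with (X * (Cabs h * Cabs h * Cabs h) * 2) by ring.
  apply Rmult_le_compat_l; [nra | exact Q].
Qed.

Lemma quadratic_cderiv (f : Cplx -> Cplx) (z l : Cplx) (K del : R) :
  0 < del -> 0 <= K -> (forall h, Cabs h < del -> Cabs (f (z + h) - f z - l * h)%X <= K * (Cabs h * Cabs h)) -> cderiv f z l.
Proof.
  intros Hd HK H eps He. exists (Rmin del (eps / (K + 1))). split.
  - apply Rmin_pos; [exact Hd | apply Rdiv_lt_0_compat; lra].
  - intros h Hh. assert (A := Cabs_ge0 h).
    assert (H1 := H h (Rlt_le_trans _ _ _ Hh (Rmin_l _ _))).
    assert (H2 : Cabs h <= eps / (K + 1)) by (eapply Rle_trans; [left; exact Hh | apply Rmin_r]).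
    apply (Rmult_le_compat_l (K + 1)) in H2; [|lra].
    replace ((K + 1) * (eps / (K + 1))) with eps in H2 by (field; lra). nra.
Qed.

Lemma cubic_cderiv (f : Cplx -> Cplx) (b1 b2 : Cplx) (K del : R) :
  0 < del -> 0 <= K ->
  (forall h, Cabs h < del -> Cabs (f h - (f 0 + b1 * h + b2 * (h * h)))%X <= K * (Cabs h * Cabs h * Cabs h)) ->
  cderiv f 0%X b1.
Proof.
  intros Hd HK H. apply quadratic_cderiv with (K * del + Cabs b2) del; [exact Hd | |].
  - assert (A := Cabs_ge0 b2). nra.
  - intros h Hh. specialize (H h Hh).
    replace (f (0 + h) - f 0 - b1 * h)%X with ((f h - (f 0 + b1 * h + b2 * (h * h))) + b2 * (h * h))%X
      by (replace (0 + h)%X with h by ring; ring).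
    eapply Rle_trans; [apply Cabs_add|]. rewrite !Cabs_mul.
    assert (K * (Cabs h * Cabs h * Cabs h) <= K * del * (Cabs h * Cabs h)).
    { replace (K * del * (Cabs h * Cabs h)) with (K * (Cabs h * Cabs h * del)) by ring.
      apply Rmult_le_compat_l; [lra|]. apply Rmult_le_compat_l; [nra | lra]. }
    lra.
Qed.

Lemma divide_zero (f : Cplx -> Cplx) (R0 : R) (a : Cplx) :
  holo_on (disk R0) f -> disk R0 a -> f a = 0%X ->
  exists H, holo_on (disk R0) H /\ forall z, f z = ((z - a) * H z)%X.
Proof.
  intros Hf Ha E0. unfold disk in Ha.
  assert (HT := holo_translate f R0 (R0 - Cabs a) a ltac:(lra) Hf).
  destruct (cubic_expansion _ (R0 - Cabs a) ltac:(lra) HT) as (b1 & b2 & K & del & Hd & HK & HB).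
  replace (a + 0)%X with a in HB by ring. rewrite E0 in HB.
  set (H := fun z => if Ceq_dec z a then b1 else (f z / (z - a))%X).
  exists H. split.
  - intros z Hz. destruct (Ceq_dec z a) as [-> | Hza].
    + exists b2. apply quadratic_cderiv with K del; [lra | exact HK|]. intros h Hh.
      specialize (HB h Hh). unfold H.
      destruct (Ceq_dec a a) as [_|]; [|congruence].
      destruct (Ceq_dec (a + h)%X a) as [E|E].
      * replace h with (a + h - a)%X by ring. rewrite E.
        replace (b1 - b1 - b2 * (a - a))%X with 0%X by ring. replace (a - a)%X with 0%X by ring. rewrite Cabs_0. lra.
      * assert (Hh0 : h <> 0%X) by (intros ->; apply E; ring).
        assert (P := Cabs_pos h Hh0).
        replace (f (a + h) / (a + h - a) - b1 - b2 * h)%X with ((f (a + h) - (0 + b1 * h + b2 * (h * h))) / h)%X.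
        -- rewrite Cabs_div by exact Hh0. apply Rmult_le_reg_r with (Cabs h); [exact P|].
           unfold Rdiv. rewrite Rmult_assoc, Rinv_l by lra. lra.
        -- replace (a + h - a)%X with h by ring. field. exact Hh0.
    + destruct (Hf z Hz) as [l Hl]. assert (P := Cabs_pos _ (Csub_neq0 _ _ Hza)).
      destruct (cderiv_div f (fun x => (x - a)%X) z l 1%X (Csub_neq0 _ _ Hza) Hl (cderiv_shift z a)) as [d Hd'].
      exists d. apply cderiv_ext_near with (fun x => (f x / (x - a))%X) (Cabs (z - a)%X); [exact P | | exact Hd'].
      intros h Hh. unfold H. destruct (Ceq_dec (z + h)%X a) as [E|]; [|reflexivity].
      exfalso. assert (h = (a - z)%X) by (rewrite <- E; ring). subst h. rewrite Cabs_sub_sym in Hh. lra.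
  - intros z. unfold H. destruct (Ceq_dec z a) as [-> | Hza].
    + rewrite E0. ring.
    + field. now apply Csub_neq0.
Qed.

Lemma cauchy_estimate (f : Cplx -> Cplx) (R0 r M : R) (l : Cplx) :
  holo_on (disk R0) f -> 0 < r < R0 -> (forall z, Cabs z = r -> Cabs (f z) <= M) -> cderiv f 0%X l -> Cabs l <= M / r.
Proof.
  intros Hf Hr HM Hl. destruct (power_expansion f R0 r M Hf Hr HM) as [c [Hc H]].
  assert (E0 : c O = f 0%X).
  { specialize (H 1%nat 0%X). rewrite Cabs_0 in H. specialize (H ltac:(lra)).
    simpl in H. symmetry. apply Csub_eq0, Cabs_eq0, Rle_antisym; [|apply Cabs_ge0].
    replace (f 0 - (0 + c O * 1))%X with (f 0 - c O)%X in H by ring. unfold Rdiv in H. rewrite Rmult_0_l, Rmult_0_l in H. lra. }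
  assert (M0 : 0 <= M).
  { eapply Rle_trans; [apply Cabs_ge0 | apply (HM (circ r 0)), Cabs_circ; lra]. }
  assert (D : cderiv f 0%X (c 1%nat)).
  { assert (0 < / r) by (apply Rinv_0_lt_compat; lra).
    apply quadratic_cderiv with (M * (/ r * / r) * 2) (r / 2); [lra | repeat apply Rmult_le_pos; lra|].
    intros h Hh. specialize (H 2%nat h ltac:(lra)). simpl in H.
    replace (f (0 + h) - f 0 - c 1%nat * h)%X with (f h - (0 + c O * 1 + c 1%nat * (h * 1)))%X
      by (rewrite E0; replace (0 + h)%X with h by ring; ring).
    eapply Rle_trans; [exact H|]. assert (A := Cabs_ge0 h).
    replace (M * (Cabs h / r * (Cabs h / r * 1)) * (r / (r - Cabs h))) with
      (M * (/ r * / r) * (Cabs h * Cabs h) * (r / (r - Cabs h))) by (field; lra).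
    replace (M * (/ r * / r) * 2 * (Cabs h * Cabs h)) with (M * (/ r * / r) * (Cabs h * Cabs h) * 2) by ring.
    apply Rmult_le_compat_l; [repeat apply Rmult_le_pos; lra|].
    apply Rmult_le_reg_r with (r - Cabs h); [lra|].
    replace (r / (r - Cabs h) * (r - Cabs h)) with r by (field; lra). lra. }
  rewrite (cderiv_unique _ _ _ _ Hl D). specialize (Hc 1%nat).
  apply Rmult_le_reg_r with r; [lra|]. unfold Rdiv. rewrite Rmult_assoc, Rinv_l by lra. lra.
Qed.

(** The remainder of the quadratic expansion at [a] is at most [K * (2 * |h|) ^ 3] on the circle of
    radius [|h|] about [h]. Cauchy's estimate there bounds its derivative at [h] by
    [8 * K * |h| ^ 2]. *)
Lemma holo_derivative (f : Cplx -> Cplx) (R0 : R) :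
  holo_on (disk R0) f -> exists f', (forall z, disk R0 z -> cderiv f z (f' z)) /\ holo_on (disk R0) f'.
Proof.
  intros Hf.
  set (f' := fun z => epsilon (inhabits 0%X) (fun l => cderiv f z l)).
  assert (D : forall z, disk R0 z -> cderiv f z (f' z)).
  { intros z Hz. apply epsilon_spec, Hf, Hz. }
  exists f'. split; [exact D|]. intros a Ha. unfold disk in Ha.
  set (F := fun w => f (a + w)%X).
  assert (HT : holo_on (disk (R0 - Cabs a)) F) by (apply (holo_translate f R0); [lra | exact Hf]).
  destruct (cubic_expansion F (R0 - Cabs a) ltac:(lra) HT) as (b1 & b2 & K & del & Hd & HK & HB).
  assert (Db : cderiv F 0%X b1) by (apply (cubic_cderiv F b1 b2 K del); [lra | lra | exact HB]).
  assert (E1 : f' a = b1).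
  { apply (cderiv_unique f a); [apply D; exact Ha|]. replace a with (a + 0)%X by ring.
    apply (cderiv_translate f a 0%X b1). exact Db. }
  exists (b2 + b2)%X. apply quadratic_cderiv with (8 * K) (del / 2); [lra | lra|].
  intros h Hh. rewrite E1. assert (A := Cabs_ge0 h).
  destruct (Req_dec (Cabs h) 0) as [Z|Z].
  { apply Cabs_eq0 in Z. subst h. replace (a + 0)%X with a by ring. rewrite E1.
    replace (b1 - b1 - (b2 + b2) * 0)%X with 0%X by ring. rewrite Cabs_0. lra. }
  set (Q := fun w => (F 0%X + b1 * w + b2 * (w * w))%X).
  set (G := fun w => (F (h + w) - Q (h + w))%X).
  assert (HF2 : holo_on (disk (R0 - Cabs a - Cabs h)) (fun w => F (h + w)%X)) by (apply (holo_translate F (R0 - Cabs a)); [lra | exact HT]).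
  assert (DQ : forall w, cderiv Q w (b1 + (b2 + b2) * w)%X).
  { intros w.
    assert (X := cderiv_add _ _ _ _ _ (cderiv_add _ _ _ _ _ (cderiv_const (F 0%X) w) (cderiv_mul _ _ _ _ _ (cderiv_const b1 w) (cderiv_id w)))
       (cderiv_mul _ _ _ _ _ (cderiv_const b2 w) (cderiv_mul _ _ _ _ _ (cderiv_id w) (cderiv_id w)))).
    cbv beta in X.
    replace (b1 + (b2 + b2) * w)%X with (0 + (0 * w + b1 * 1) + (0 * (w * w) + b2 * (1 * w + w * 1)))%X by ring. exact X. }
  assert (HG : holo_on (disk (R0 - Cabs a - Cabs h)) G).
  { apply holo_sub; [exact HF2|]. intros w _. eexists. apply (cderiv_translate Q h w), DQ. }
  assert (EG : Cabs (f' (a + h)%X - (b1 + (b2 + b2) * h))%X <= K * (2 * Cabs h * (2 * Cabs h) * (2 * Cabs h)) / Cabs h).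
  { apply (cauchy_estimate G (R0 - Cabs a - Cabs h)); [exact HG | lra | |].
    - intros w Hw.
      assert (B := Cabs_add h w). rewrite Hw in B.
      eapply Rle_trans; [apply HB; lra|]. apply Rmult_le_compat_l; [exact HK|].
      assert (P := Cabs_ge0 (h + w)%X).
      apply Rmult_le_compat; try lra; [nra|]. apply Rmult_le_compat; lra.
    - apply cderiv_sub.
      + apply (cderiv_translate F h 0%X). apply (cderiv_translate f a (h + 0)%X).
        replace (a + (h + 0))%X with (a + h)%X by ring. apply D. unfold disk. assert (B := Cabs_add a h). lra.
      + apply (cderiv_translate Q h 0%X). replace (h + 0)%X with h by ring. apply DQ. }
  replace (f' (a + h) - b1 - (b2 + b2) * h)%X with (f' (a + h) - (b1 + (b2 + b2) * h))%X by ring.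
  eapply Rle_trans; [exact EG|]. apply Req_le. field. exact Z.
Qed.

(** * The logarithm of the modulus of a zero-free function *)

Lemma ln_Cabs_derivative (g : Cplx -> Cplx) (z v l : Cplx) (t : R) :
  g (z + RtoC t * v)%X <> 0%X -> cderiv g (z + RtoC t * v)%X l ->
  derivable_pt_lim (fun s => ln (Cabs (g (z + RtoC s * v)%X))) t (Re (v * (l / g (z + RtoC t * v)))%X).
Proof.
  intros Hn Hl. set (p := (z + RtoC t * v)%X) in *.
  assert (D : forall eps, 0 < eps -> exists del, 0 < del /\ forall h, Rabs h < del ->
     Cabs (g (z + RtoC (t + h) * v) - g p - l * v * RtoC h)%X <= eps * Rabs h).
  { intros eps He. assert (A := Cabs_ge0 v).
    assert (E : 0 < eps / (Cabs v + 1)) by (apply Rdiv_lt_0_compat; lra).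
    destruct (Hl _ E) as [d [Hd H]]. exists (d / (Cabs v + 1)). split; [apply Rdiv_lt_0_compat; lra|].
    intros h Hh. assert (P := Rabs_pos h).
    assert (AH : Cabs (RtoC h * v)%X < d).
    { rewrite Cabs_mul, Cabs_RtoC. apply Rle_lt_trans with (Rabs h * (Cabs v + 1)); [nra|].
      apply Rlt_le_trans with (d / (Cabs v + 1) * (Cabs v + 1)); [nra | apply Req_le; field; lra]. }
    specialize (H _ AH). replace (z + RtoC (t + h) * v)%X with (p + RtoC h * v)%X by (unfold p; apply Ceq; simpl; ring).
    replace (l * v * RtoC h)%X with (l * (RtoC h * v))%X by ring.
    eapply Rle_trans; [exact H|]. rewrite Cabs_mul, Cabs_RtoC.
    replace (eps * Rabs h) with (eps / (Cabs v + 1) * (Rabs h * (Cabs v + 1))) by (field; lra).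
    apply Rmult_le_compat_l; [lra | nra]. }
  assert (DR : derivable_pt_lim (fun s => Re (g (z + RtoC s * v)%X)) t (Re (l * v)%X)).
  { intros eps He. destruct (D (eps / 2)) as [d [Hd H]]; [lra|]. exists (mkposreal d Hd). intros h Hh0 Hh.
    specialize (H h Hh). assert (P := Rabs_pos_lt h Hh0). fold p.
    match goal with |- Rabs ?x < _ => replace x with ((Re (g (z + RtoC (t + h) * v) - g p - l * v * RtoC h)%X) / h)
      by (unfold p; simpl; field; exact Hh0) end.
    unfold Rdiv. rewrite Rabs_mult, Rabs_inv. assert (Q := Re_le_Cabs (g (z + RtoC (t + h) * v) - g p - l * v * RtoC h)%X).
    apply Rmult_lt_reg_r with (Rabs h); [exact P|]. rewrite Rmult_assoc, Rinv_l by lra. nra. }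
  assert (DI : derivable_pt_lim (fun s => Im (g (z + RtoC s * v)%X)) t (Im (l * v)%X)).
  { intros eps He. destruct (D (eps / 2)) as [d [Hd H]]; [lra|]. exists (mkposreal d Hd). intros h Hh0 Hh.
    specialize (H h Hh). assert (P := Rabs_pos_lt h Hh0). fold p.
    match goal with |- Rabs ?x < _ => replace x with ((Im (g (z + RtoC (t + h) * v) - g p - l * v * RtoC h)%X) / h)
      by (unfold p; simpl; field; exact Hh0) end.
    unfold Rdiv. rewrite Rabs_mult, Rabs_inv. assert (Q := Im_le_Cabs (g (z + RtoC (t + h) * v) - g p - l * v * RtoC h)%X).
    apply Rmult_lt_reg_r with (Rabs h); [exact P|]. rewrite Rmult_assoc, Rinv_l by lra. nra. }
  apply is_derive_Reals in DR. apply is_derive_Reals in DI. apply is_derive_Reals.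
  assert (SQ := Csq_pos _ Hn).
  set (x := fun s => Re (g (z + RtoC s * v)%X)) in *. set (y := fun s => Im (g (z + RtoC s * v)%X)) in *.
  apply (is_derive_ext (fun s => ln (sqrt (x s * x s + y s * y s)))); [reflexivity|].
  assert (SX : 0 < x t * x t + y t * y t) by exact SQ.
  auto_derive.
  - repeat split; try (eexists; eassumption); [exact SX | now apply sqrt_lt_R0].
  - assert (UX : Derive x t = Re (l * v)%X) by (apply is_derive_unique, DR).
    assert (UY : Derive y t = Im (l * v)%X) by (apply is_derive_unique, DI).
    change (Derive (fun s : R => x s) t) with (Derive x t). change (Derive (fun s : R => y s) t) with (Derive y t).
    rewrite UX, UY.
    assert (S2 := sqrt_lt_R0 _ SX). assert (S3 := sqrt_sqrt _ (Rlt_le _ _ SX)).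
    set (s := sqrt (x t * x t + y t * y t)) in *.
    replace (Re (v * (l / g p))%X) with ((x t * Re (l * v)%X + y t * Im (l * v)%X) / (s * s)).
    + field. lra.
    + rewrite S3. unfold x, y. fold p. simpl. field. exact (Rgt_not_eq _ _ SQ).
Qed.

Definition zerofree (g : Cplx -> Cplx) : Prop := forall z, disk 1 z -> g z <> 0%X.

(** Here [d = g' / g]. Differentiating [ln |g|] along segments avoids the choice of a branch of the
    logarithm. *)
Lemma log_derivative (g : Cplx -> Cplx) :
  holo_on (disk 1) g -> zerofree g -> exists d, holo_on (disk 1) d /\
    forall z v t, disk 1 (z + RtoC t * v)%X ->
      derivable_pt_lim (fun s => ln (Cabs (g (z + RtoC s * v)%X))) t (Re (v * d (z + RtoC t * v))%X).
Proof.
  intros Hg Hz. destruct (holo_derivative g 1 Hg) as [g' [D H']].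
  exists (fun z => (g' z / g z)%X). split; [now apply holo_div|].
  intros z v t Ht. apply ln_Cabs_derivative; auto.
Qed.

Lemma ln_Cabs_lipschitz (g : Cplx -> Cplx) (R0 : R) :
  holo_on (disk 1) g -> zerofree g -> 0 < R0 < 1 ->
  exists K, 0 <= K /\ forall z w, Cabs z <= R0 -> Cabs w <= R0 ->
    Rabs (ln (Cabs (g z)) - ln (Cabs (g w))) <= K * Cabs (z - w)%X.
Proof.
  intros Hg Hz HR. destruct (log_derivative g Hg Hz) as (d & Hd & D).
  set (r := (R0 + 1) / 2).
  destruct (holo_bounded_circle d 1 r Hd) as [M [M0 HM]]; [unfold r; lra|].
  exists (M * (r / (r - R0))).
  assert (0 < r / (r - R0)) by (apply Rdiv_lt_0_compat; unfold r; lra).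
  split; [nra|]. intros z w Az Aw.
  assert (IN : forall c, 0 <= c <= 1 -> Cabs (w + RtoC c * (z - w))%X <= R0).
  { intros c Hc. replace (w + RtoC c * (z - w))%X with (RtoC (1 - c) * w + RtoC c * z)%X by (apply Ceq; simpl; ring).
    eapply Rle_trans; [apply Cabs_add|]. rewrite !Cabs_mul, !Cabs_RtoC, !Rabs_pos_eq by lra. nra. }
  destruct (MVT_abs (fun s => ln (Cabs (g (w + RtoC s * (z - w))%X))) (fun t => Re ((z - w) * d (w + RtoC t * (z - w)))%X) 0 1) as [c [Hc1 Hc2]].
  { intros c. rewrite Rmin_left, Rmax_right by lra. intros Hc. apply D. unfold disk. specialize (IN c Hc). lra. }
  rewrite Rmin_left, Rmax_right in Hc2 by lra.
  replace (w + RtoC 1 * (z - w))%X with z in Hc1 by ring.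
  replace (w + RtoC 0 * (z - w))%X with w in Hc1 by ring.
  rewrite Hc1. replace (1 - 0) with 1 by ring. rewrite Rabs_R1, Rmult_1_r.
  eapply Rle_trans; [apply Re_le_Cabs|]. rewrite Cabs_mul, Rmult_comm.
  apply Rmult_le_compat_r; [apply Cabs_ge0|]. specialize (IN c Hc2).
  eapply Rle_trans; [apply (holo_bound d 1 r M); [exact Hd | unfold r; lra | exact HM | unfold r; lra]|].
  apply Rmult_le_compat_l; [exact M0|]. apply Rmult_le_compat_l; [unfold r; lra|].
  apply Rinv_le_contravar; [unfold r; lra|]. lra.
Qed.

(** This encodes harmonic functions: real parts of power series, with uniform convergence on smaller
    disks. *)
Definition real_series (r : R) (v : Cplx -> R) (l : nat -> Cplx) : Prop :=
  forall R0, 0 < R0 < r -> forall eps, 0 < eps -> exists D, forall n, (D <= n)%nat ->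
    forall z, Cabs z <= R0 -> Rabs (v z - Re (csum n (fun i => l i * z ^ i)%X)) <= eps.

Lemma geometric_small (q K eps : R) : 0 <= q < 1 -> 0 < eps -> exists D, forall n, (D <= n)%nat -> K * q ^ n <= eps.
Proof.
  intros Hq He. assert (P := Rabs_pos K).
  destruct (pow_lt_1_zero q) with (y := eps / (Rabs K + 1)) as [D HD].
  - rewrite Rabs_pos_eq; lra.
  - apply Rdiv_lt_0_compat; lra.
  - exists D. intros n Hn. specialize (HD n Hn). assert (Q : 0 <= q ^ n) by (apply pow_le; lra).
    rewrite Rabs_pos_eq in HD by exact Q.
    apply (Rmult_lt_compat_l (Rabs K + 1)) in HD; [|lra].
    replace ((Rabs K + 1) * (eps / (Rabs K + 1))) with eps in HD by (field; lra).
    assert (K <= Rabs K) by apply Rle_abs. nra.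
Qed.

Lemma derivable_rsum (n : nat) (f f' : nat -> R -> R) (t : R) :
  (forall i, derivable_pt_lim (f i) t (f' i t)) -> derivable_pt_lim (fun s => rsum n (fun i => f i s)) t (rsum n (fun i => f' i t)).
Proof.
  intros H. induction n; simpl.
  - apply derivable_pt_lim_const.
  - apply (derivable_pt_lim_plus (fun s => rsum n (fun i => f i s)) (f n)); auto.
Qed.

(** The series of [g' / g] is integrated term by term along the ray to [z]. The mean value theorem,
    applied to the difference with the integrated partial sum, carries over the error bound. *)
Lemma ln_Cabs_series (g : Cplx -> Cplx) (r : R) :
  holo_on (disk 1) g -> zerofree g -> 0 < r < 1 ->
  exists l, l O = RtoC (ln (Cabs (g 0%X))) /\ real_series r (fun z => ln (Cabs (g z))) l.
Proof.
  intros Hg Hz Hr. destruct (log_derivative g Hg Hz) as (d & Hd & D).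
  destruct (holo_bounded_circle d 1 r Hd Hr) as [M [M0 HM]].
  destruct (power_expansion d 1 r M Hd Hr HM) as [c [Hc HX]].
  exists (fun i => match i with O => RtoC (ln (Cabs (g 0%X))) | S j => (RtoC (/ INR (S j)) * c j)%X end).
  split; [reflexivity|]. intros R0 HR0 eps He.
  destruct (geometric_small (R0 / r) (M * (r / (r - R0))) eps) as [D0 HD0].
  { split; [apply Rmult_le_pos; [lra | left; apply Rinv_0_lt_compat; lra]|].
    apply Rmult_lt_reg_r with r; [lra|]. unfold Rdiv; rewrite Rmult_assoc, Rinv_l by lra. lra. }
  { exact He. }
  exists (S D0). intros n Hn z Az. destruct n as [|n]; [lia|].
  assert (A0 := Cabs_ge0 z).
  set (h := fun i (s : R) => / INR (S i) * s ^ (S i) * Re (c i * z ^ (S i))%X).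
  set (h' := fun i (s : R) => s ^ i * Re (c i * z ^ (S i))%X).
  destruct (MVT_abs (fun s => ln (Cabs (g (0 + RtoC s * z)%X)) - rsum n (fun i => h i s))
     (fun t => Re (z * d (0 + RtoC t * z))%X - rsum n (fun i => h' i t)) 0 1) as [t [Ht1 Ht2]].
  { intros t. rewrite Rmin_left, Rmax_right by lra. intros Ht.
    apply (derivable_pt_lim_minus (fun s => ln (Cabs (g (0 + RtoC s * z)%X))) (fun s => rsum n (fun i => h i s))).
    - apply D. unfold disk. replace (0 + RtoC t * z)%X with (RtoC t * z)%X by ring.
      rewrite Cabs_mul, Cabs_RtoC, Rabs_pos_eq by lra. nra.
    - apply derivable_rsum. intros i. unfold h, h'. assert (INR (S i) <> 0) by (apply not_0_INR; lia).
      generalize (Re (c i * z ^ S i)%X). intros k. apply is_derive_Reals. auto_derive; [trivial|].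
      change (match i with O => 1 | S _ => INR i + 1 end) with (INR (S i)). field. assumption. }
  rewrite Rmin_left, Rmax_right in Ht2 by lra.
  replace (0 + RtoC 1 * z)%X with z in Ht1 by ring. replace (0 + RtoC 0 * z)%X with 0%X in Ht1 by ring.
  rewrite (rsum_ext n (fun i => h i 0) (fun _ => 0)) in Ht1 by (intros; unfold h; simpl; ring).
  rewrite rsum_const in Ht1.
  assert (E : Re (csum (S n) (fun i => (match i with O => RtoC (ln (Cabs (g 0%X))) | S j => (RtoC (/ INR (S j)) * c j) end * z ^ i))%X)
     = ln (Cabs (g 0%X)) + rsum n (fun i => h i 1)).
  { rewrite Re_csum.
    assert (SH : forall m F, rsum (S m) F = F O + rsum m (fun k => F (S k))).
    { induction m; intros F; [simpl; ring|]. change (rsum (S (S m)) F) with (rsum (S m) F + F (S m)). rewrite IHm. simpl; ring. }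
    rewrite SH. f_equal; [simpl; ring|]. apply rsum_ext. intros k _. unfold h. rewrite pow1.
    match goal with |- Re (RtoC ?x * ?cc * ?zz)%X = _ => replace (RtoC x * cc * zz)%X with (RtoC x * (cc * zz))%X by ring;
       generalize (cc * zz)%X; intros u; generalize x; intros y; simpl; ring end. }
  rewrite E.
  replace (ln (Cabs (g z)) - (ln (Cabs (g 0%X)) + rsum n (fun i => h i 1))) with
    (ln (Cabs (g z)) - rsum n (fun i => h i 1) - (ln (Cabs (g 0%X)) - INR n * 0)) by ring.
  rewrite Ht1. replace (1 - 0) with 1 by ring. rewrite Rabs_R1, Rmult_1_r.
  replace (0 + RtoC t * z)%X with (RtoC t * z)%X by ring.
  assert (E2 : Re (z * d (RtoC t * z))%X - rsum n (fun i => h' i t) =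
     Re (z * (d (RtoC t * z) - csum n (fun i => c i * (RtoC t * z) ^ i)))%X).
  { replace (z * (d (RtoC t * z) - csum n (fun i => c i * (RtoC t * z) ^ i)))%X with
      (z * d (RtoC t * z) - z * csum n (fun i => c i * (RtoC t * z) ^ i))%X by ring.
    rewrite <- csum_scal.
    match goal with |- _ = Re (?A - ?B)%X => change (Re (A - B)%X) with (Re A + - Re B) end.
    rewrite Re_csum. unfold Rminus. f_equal. f_equal. apply rsum_ext. intros i _. unfold h'.
    rewrite Cpow_mul_base, <- RtoC_pow.
    replace (z * (c i * (RtoC (t ^ i) * z ^ i)))%X with (RtoC (t ^ i) * (c i * z ^ S i))%X by (simpl Cpow; ring).
    generalize (c i * z ^ S i)%X; intros u. generalize (t ^ i); intros y; simpl; ring. }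
  rewrite E2. eapply Rle_trans; [apply Re_le_Cabs|]. rewrite Cabs_mul.
  assert (AT : Cabs (RtoC t * z)%X <= R0) by (rewrite Cabs_mul, Cabs_RtoC, Rabs_pos_eq by lra; nra).
  specialize (HX n (RtoC t * z)%X ltac:(lra)).
  specialize (HD0 n ltac:(lia)).
  set (x := Cabs (RtoC t * z)%X) in *.
  assert (X0 : 0 <= x) by apply Cabs_ge0.
  assert (B : M * (x / r) ^ n * (r / (r - x)) <= M * (r / (r - R0)) * (R0 / r) ^ n).
  { replace (M * (r / (r - R0)) * (R0 / r) ^ n) with (M * (R0 / r) ^ n * (r / (r - R0))) by ring.
    assert (IR : 0 < / r) by (apply Rinv_0_lt_compat; lra).
    assert (0 <= x / r) by (apply Rmult_le_pos; lra).
    apply Rmult_le_compat.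
    - apply Rmult_le_pos; [exact M0 | apply pow_le; assumption].
    - apply Rmult_le_pos; [lra | left; apply Rinv_0_lt_compat; lra].
    - apply Rmult_le_compat_l; [exact M0|]. apply pow_incr. split; [assumption | apply Rmult_le_compat_r; lra].
    - apply Rmult_le_compat_l; [lra|]. apply Rinv_le_contravar; lra. }
  nra.
Qed.

(** * Extraction of zeros *)

Fixpoint prodl (l : list Cplx) (z : Cplx) : Cplx :=
  match l with nil => RtoC 1 | a :: t => Cmul (z - a)%X (prodl t z) end.

Lemma holo_prodl (U : Cplx -> Prop) (l : list Cplx) : holo_on U (prodl l).
Proof.
  induction l as [|a l IH]; simpl.
  - apply holo_const.
  - apply (holo_mul U (fun z => (z - a)%X)); [|exact IH].
    apply (holo_sub U (fun z => z)); [apply holo_id | apply holo_const].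
Qed.

Definition factors (F : Cplx -> Cplx) (l : list Cplx) (H : Cplx -> Cplx) : Prop :=
  holo_on (disk 1) H /\ Forall (disk 1) l /\ forall z, disk 1 z -> F z = (prodl l z * H z)%X.

Lemma prodl_split (a : Cplx) (l : list Cplx) (z : Cplx) :
  prodl l z = ((z - a) ^ (count_occ Ceq_dec l a) * prodl (remove Ceq_dec a l) z)%X.
Proof.
  induction l as [|b l IH]; simpl; [ring|].
  destruct (Ceq_dec b a) as [-> | Hb].
  - destruct (Ceq_dec a a); [|congruence]. rewrite IH. simpl. ring.
  - destruct (Ceq_dec a b); [congruence|]. simpl. rewrite IH. ring.
Qed.

Lemma sum_count_occ (S l : list Cplx) :
  NoDup S -> incl l S -> fold_right (fun a acc => (count_occ Ceq_dec l a + acc)%nat) O S = length l.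
Proof.
  intros HS. induction l as [|b l IH]; intros Hl.
  - clear. induction S; simpl; auto.
  - simpl length. rewrite <- IH by (intros x Hx; apply Hl; now right).
    assert (Hb : In b S) by (apply Hl; now left). clear IH Hl.
    induction S as [|c S IHS]; [easy|]. inversion HS as [|? ? Hc HS']; subst.
    simpl. destruct (Ceq_dec b c) as [-> | Hbc].
    + simpl. f_equal. f_equal. clear - Hc. induction S as [|d S IH]; simpl; [reflexivity|].
      rewrite IH by (intros X; apply Hc; now right).
      destruct (Ceq_dec c d) as [-> |]; [exfalso; apply Hc; now left | reflexivity].
    + destruct Hb as [E|Hb]; [congruence|]. specialize (IHS HS' Hb). simpl in IHS. rewrite IHS. lia.
Qed.

Lemma ball_in_disk (a z : Cplx) : ball a (1 - Cabs a) z -> disk 1 z.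
Proof.
  unfold ball, disk. intros H. assert (B := Cabs_add (z - a) a). replace (z - a + a)%X with z in B by ring. lra.
Qed.

(** [zeros_at_least] asks for distinct points with orders, so repeated entries of [l] are collected
    into multiplicities. *)
Lemma factors_zeros_at_least (F : Cplx -> Cplx) (l : list Cplx) (H : Cplx -> Cplx) :
  factors F l H -> zeros_at_least F (disk 1) (length l).
Proof.
  intros (HH & Hl & E).
  exists (map (fun a => (a, count_occ Ceq_dec l a)) (nodup Ceq_dec l)). split; [|split].
  - rewrite map_map. rewrite map_id. apply NoDup_nodup.
  - apply Forall_forall. intros [a m] Ha. apply in_map_iff in Ha. destruct Ha as (b & Eb & Hb).
    inversion Eb; subst. simpl. apply nodup_In in Hb.
    rewrite Forall_forall in Hl. assert (Da := Hl a Hb). split; [exact Da|].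
    unfold disk in Da. exists (1 - Cabs a). split; [lra|].
    exists (fun z => (prodl (remove Ceq_dec a l) z * H z)%X). split.
    + apply holo_mul; [apply holo_prodl|]. apply (holo_sub_set (disk 1)); [apply ball_in_disk | exact HH].
    + intros z Hz. rewrite E by now apply (ball_in_disk a). rewrite (prodl_split a l z). ring.
  - apply Nat.eq_le_incl. symmetry.
    rewrite <- (sum_count_occ (nodup Ceq_dec l) l) by (try apply NoDup_nodup; intros x Hx; now apply nodup_In).
    generalize (nodup Ceq_dec l) as S. induction S; simpl; [reflexivity | now rewrite IHS].
Qed.

(** Zeros are divided out one at a time. The process stops after at most [n] divisions, since
    [n + 1] linear factors would exhibit [n + 1] zeros. *)
Lemma factorization (F : Cplx -> Cplx) (n : nat) :
  holo_on (disk 1) F -> ~ zeros_at_least F (disk 1) (S n) ->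
  exists l H, factors F l H /\ (length l <= n)%nat /\ zerofree H.
Proof.
  intros HF HZ.
  assert (K : forall k, (exists l H, factors F l H /\ (length l <= n)%nat /\ zerofree H) \/
                   (exists l H, factors F l H /\ length l = k)).
  { induction k as [|k [IH | (l & H & HL & Hk)]].
    - right. exists nil, F. split; [|reflexivity]. split; [exact HF|]. split; [constructor|]. intros; simpl; ring.
    - now left.
    - destruct (excluded_middle_informative (zerofree H)) as [Z | NZ].
      + left. exists l, H. split; [exact HL|]. split; [|exact Z].
        destruct (le_lt_dec (length l) n) as [|Hn]; [assumption|]. exfalso. apply HZ.
        destruct (factors_zeros_at_least F l H HL) as (pts & P1 & P2 & P3). exists pts. repeat split; auto; lia.
      + right. assert (NZ' : exists a, disk 1 a /\ H a = 0%X).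
        { apply NNPP. intros C. apply NZ. intros z Hz E. apply C. now exists z. }
        destruct NZ' as (a & Ha & E). destruct HL as (HH & Hl & EF).
        destruct (divide_zero H 1 a HH Ha E) as (H' & HH' & E').
        exists (a :: l), H'. split; [|simpl; now rewrite Hk]. split; [exact HH'|]. split; [now constructor|].
        intros z Hz. rewrite (EF z Hz), E'. simpl. ring. }
  destruct (K (S n)) as [R | (l & H & HL & Hk)]; [exact R|].
  exfalso. apply HZ. rewrite <- Hk. eapply factors_zeros_at_least; eassumption.
Qed.

Lemma poly_eval_ext (a b : nat -> Cplx) (s : nat) (z : Cplx) :
  (forall k, (k <= s)%nat -> a k = b k) -> poly_eval a s z = poly_eval b s z.
Proof.
  intros H. induction s; simpl; [apply H; lia|]. rewrite IHs by (intros; apply H; lia). rewrite (H (S s)) by lia. reflexivity.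
Qed.

Lemma poly_eval_mul_X (a : nat -> Cplx) (s : nat) (z : Cplx) :
  poly_eval (fun k => match k with O => 0%X | S j => a j end) (S s) z = (z * poly_eval a s z)%X.
Proof.
  induction s; [simpl; ring|].
  change (poly_eval (fun k => match k with O => 0%X | S j => a j end) (S (S s)) z) with
    (poly_eval (fun k => match k with O => 0%X | S j => a j end) (S s) z + a (S s) * z ^ S (S s))%X.
  rewrite IHs. simpl. ring.
Qed.

Lemma poly_eval_lin (a b : nat -> Cplx) (c : Cplx) (s : nat) (z : Cplx) :
  poly_eval (fun k => (a k - c * b k)%X) s z = (poly_eval a s z - c * poly_eval b s z)%X.
Proof. induction s; simpl; [reflexivity | rewrite IHs; ring]. Qed.

Lemma poly_eval_pad (a : nat -> Cplx) (s : nat) (z : Cplx) :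
  poly_eval (fun k => if Nat.leb k s then a k else 0%X) (S s) z = poly_eval a s z.
Proof.
  change (poly_eval (fun k => if Nat.leb k s then a k else 0%X) s z + (if Nat.leb (S s) s then a (S s) else 0) * z ^ (S s) = poly_eval a s z)%X.
  replace (Nat.leb (S s) s) with false by (symmetry; apply Nat.leb_gt; lia).
  rewrite (poly_eval_ext (fun k => if Nat.leb k s then a k else 0%X) a).
  - ring.
  - intros k Hk. apply Nat.leb_le in Hk. now rewrite Hk.
Qed.

Lemma prodl_poly (c : Cplx) (l : list Cplx) (s : nat) :
  (length l <= s)%nat -> exists a, forall z, (c * prodl l z)%X = poly_eval a s z.
Proof.
  revert s. induction l as [|b l IH]; intros s Hs.
  - exists (fun k => match k with O => c | _ => 0%X end). intros z. simpl. clear.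
    induction s; simpl; [ring | rewrite <- IHs; ring].
  - simpl in Hs. destruct s as [|s]; [lia|]. destruct (IH s ltac:(lia)) as [a Ha].
    exists (fun k => ((match k with O => 0%X | S j => a j end) - b * (if Nat.leb k s then a k else 0%X))%X).
    intros z. rewrite (poly_eval_lin (fun k => match k with O => 0%X | S j => a j end)).
    rewrite poly_eval_mul_X, poly_eval_pad, <- Ha. simpl. ring.
Qed.

(* [g] takes every value at most [q] times, in factored form. *)
Definition valent (q : nat) (g : Cplx -> Cplx) : Prop :=
  forall w, exists l H, factors (fun z => (g z - w)%X) l H /\ (length l <= q)%nat /\ zerofree H.

Lemma zeros_at_least_mul (P g F : Cplx -> Cplx) (n : nat) :
  holo_on (disk 1) P -> (forall z, disk 1 z -> F z = (P z * g z)%X) ->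
  zeros_at_least g (disk 1) n -> zeros_at_least F (disk 1) n.
Proof.
  intros HP E (pts & P1 & P2 & P3). exists pts. split; [exact P1|]. split; [|exact P3].
  rewrite Forall_forall in *. intros [a m] Ha. destruct (P2 _ Ha) as (Da & r & Hr & h & Hh & Eh). simpl in *.
  split; [exact Da|]. unfold disk in Da. exists (Rmin r (1 - Cabs a)). split; [apply Rmin_pos; lra|].
  exists (fun z => (P z * h z)%X).
  assert (B1 : forall z, ball a (Rmin r (1 - Cabs a)) z -> ball a r z).
  { intros z Hz. eapply Rlt_le_trans; [exact Hz | apply Rmin_l]. }
  assert (B2 : forall z, ball a (Rmin r (1 - Cabs a)) z -> disk 1 z).
  { intros z Hz. apply (ball_in_disk a). eapply Rlt_le_trans; [exact Hz | apply Rmin_r]. }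
  split.
  - apply holo_mul; [now apply (holo_sub_set (disk 1)) | now apply (holo_sub_set (ball a r))].
  - intros z Hz. rewrite E by auto. rewrite Eh by auto. ring.
Qed.

(** A zero of [g - w] is a zero of [f - w * P] of at least the same order, and [w * P] is a
    polynomial of degree at most [s], hence admissible in the definition of valence. *)
Lemma sp_valent_factor (f : Cplx -> Cplx) (s p : nat) :
  holo_on (disk 1) f -> ~ zeros_at_least f (disk 1) (S s) -> sp_valent s p f (disk 1) ->
  exists l g, factors f l g /\ (length l <= s)%nat /\ zerofree g /\ valent p g.
Proof.
  intros Hf HZ HV. destruct (factorization f s Hf HZ) as (l & g & HL & Hs & Zg).
  exists l, g. split; [exact HL|]. split; [exact Hs|]. split; [exact Zg|].
  destruct HL as (Hg & _ & E). intros w.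
  apply factorization; [apply holo_sub; [exact Hg | apply holo_const]|].
  intros Z. destruct (prodl_poly w l s Hs) as [a Ha]. apply (HV a).
  apply (zeros_at_least_mul (prodl l) (fun z => (g z - w)%X)); [apply holo_prodl | | exact Z].
  intros z Hz. rewrite (E z Hz), <- Ha. ring.
Qed.

(** For [w] other than 0, [1 / g - w = - w * (1 / g) * (g - 1 / w)], so the zeros are those of
    [g - 1 / w]. *)
Lemma valent_inv (q : nat) (g : Cplx -> Cplx) :
  holo_on (disk 1) g -> zerofree g -> valent q g -> valent q (fun z => Cinv (g z)).
Proof.
  intros Hg Zg V w.
  assert (HI : holo_on (disk 1) (fun z => Cinv (g z))).
  { intros z Hz. destruct (Hg z Hz) as [m Hm]. eexists. apply cderiv_inv; [now apply Zg | exact Hm]. }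
  destruct (Ceq_dec w 0%X) as [-> | Hw].
  - exists nil, (fun z => Cinv (g z)). split; [|split].
    + split; [exact HI|]. split; [constructor|]. intros; simpl; ring.
    + simpl; lia.
    + intros z Hz E. specialize (Zg z Hz). apply Cabs_pos in Zg as P.
      assert (X : Cabs (Cinv (g z)) = 0) by (rewrite E; apply Cabs_0). rewrite Cabs_inv in X by exact Zg.
      assert (0 < / Cabs (g z)) by now apply Rinv_0_lt_compat. lra.
  - destruct (V (Cinv w)) as (l & H & (HH & Hl & E) & Hq & Z).
    exists l, (fun z => ((- w) * Cinv (g z) * H z)%X). split; [|split].
    + split; [|split; [exact Hl|]].
      * apply holo_mul; [|exact HH]. apply (holo_mul (disk 1) (fun _ => (- w)%X)); [apply holo_const | exact HI].
      * intros z Hz. specialize (E z Hz). specialize (Zg z Hz).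
        replace (prodl l z * (- w * Cinv (g z) * H z))%X with ((- w * Cinv (g z)) * (prodl l z * H z))%X by ring.
        rewrite <- E. field. split; assumption.
    + exact Hq.
    + intros z Hz. specialize (Zg z Hz). specialize (Z z Hz).
      apply Cmul_neq0; [|exact Z]. apply Cmul_neq0.
      * intros E0. apply Hw. replace w with (- - w)%X by ring. rewrite E0. ring.
      * apply Cabs_neq0. rewrite Cabs_inv by exact Zg. apply Rinv_0_lt_compat, Cabs_pos, Zg.
Qed.

(** A zero [a] with [|a| < |k|] moves to [a / k]; the other zeros leave the disk, and their factors
    join the zero-free one. *)
Lemma valent_scale (q : nat) (g : Cplx -> Cplx) (k : Cplx) :
  k <> 0%X -> Cabs k <= 1 -> valent q g -> valent q (fun z => g (k * z)%X).
Proof.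
  intros Hk Ak V w. destruct (V w) as (l & H & (HH & Hl & E) & Hq & Z).
  assert (DK : forall z, disk 1 z -> disk 1 (k * z)%X).
  { unfold disk. intros z Hz. rewrite Cabs_mul. assert (A := Cabs_ge0 z). nra. }
  assert (PK := Cabs_pos k Hk).
  assert (G : exists l' Q, holo_on (disk 1) Q /\ zerofree Q /\ Forall (disk 1) l' /\ (length l' <= length l)%nat /\
            forall z, prodl l (k * z)%X = (prodl l' z * Q z)%X).
  { clear E Hq. induction l as [|a l IH].
    - exists nil, (fun _ => 1%X). split; [apply holo_const|]. split; [|split; [constructor|split; [simpl; lia|]]].
      + intros z _. apply Cabs_neq0. rewrite Cabs_1; lra.
      + intros; simpl; ring.
    - inversion Hl as [|? ? Ha Hl']; subst. destruct (IH Hl') as (l' & Q & HQ & ZQ & Fl & Ln & EQ).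
      destruct (Rlt_le_dec (Cabs a) (Cabs k)) as [Hak | Hak].
      + exists ((a / k)%X :: l'), (fun z => (k * Q z)%X). split; [|split; [|split; [|split]]].
        * apply (holo_mul (disk 1) (fun _ => k)); [apply holo_const | exact HQ].
        * intros z Hz. apply Cmul_neq0; auto.
        * constructor; [|exact Fl]. unfold disk. rewrite Cabs_div by exact Hk.
          apply Rmult_lt_reg_r with (Cabs k); [exact PK|]. unfold Rdiv. rewrite Rmult_assoc, Rinv_l by lra. lra.
        * simpl; lia.
        * intros z. simpl. rewrite EQ. field. exact Hk.
      + exists l', (fun z => ((k * z - a) * Q z)%X). split; [|split; [|split; [|split]]].
        * apply holo_mul; [|exact HQ]. apply (holo_sub (disk 1) (fun z => (k * z)%X)); [|apply holo_const].
          apply (holo_mul (disk 1) (fun _ => k)); [apply holo_const | apply holo_id].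
        * intros z Hz. apply Cmul_neq0; auto. intros E0. apply Csub_eq0 in E0. unfold disk in Hz.
          apply (f_equal Cabs) in E0. rewrite Cabs_mul in E0. nra.
        * exact Fl.
        * simpl; lia.
        * intros z. simpl. rewrite EQ. ring. }
  destruct G as (l' & Q & HQ & ZQ & Fl & Ln & EQ).
  exists l', (fun z => (Q z * H (k * z))%X). split; [|split].
  - split; [|split; [exact Fl|]].
    + apply holo_mul; [exact HQ|]. intros z Hz. destruct (HH _ (DK z Hz)) as [m Hm].
      eexists. apply (cderiv_comp H (fun z => (k * z)%X)); [|exact Hm].
      apply (cderiv_mul (fun _ => k) (fun z => z)); [apply cderiv_const | apply cderiv_id].
    + intros z Hz. rewrite (E _ (DK z Hz)), EQ. ring.
  - lia.
  - intros z Hz. apply Cmul_neq0; auto.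
Qed.

(** * Discrete averages of harmonic functions *)

Definition pt (n : nat) (r : R) (k : nat) : Cplx := (RtoC r * rootu n k)%X.

Lemma Cabs_pt (n : nat) (r : R) (k : nat) : 0 <= r -> Cabs (pt n r k) = r.
Proof. intros H. unfold pt. rewrite Cabs_mul, Cabs_rootu, Cabs_RtoC, Rabs_pos_eq by exact H. ring. Qed.

Lemma csum_split (n m : nat) (F : nat -> Cplx) : csum (n + m) F = (csum n F + csum m (fun k => F (n + k)%nat))%X.
Proof. induction m; [rewrite Nat.add_0_r; simpl; ring|]. rewrite Nat.add_succ_r. simpl. rewrite IHm. ring. Qed.

Lemma rsum_split (n m : nat) (F : nat -> R) : rsum (n + m) F = rsum n F + rsum m (fun k => F (n + k)%nat).
Proof. induction m; [rewrite Nat.add_0_r; simpl; ring|]. rewrite Nat.add_succ_r. simpl. rewrite IHm. ring. Qed.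

Lemma csum_poly_pt (n m : nat) (l : nat -> Cplx) (r : R) :
  (1 <= m <= n)%nat -> csum n (fun k => csum m (fun i => l i * pt n r k ^ i)%X) = (RtoC (INR n) * l O)%X.
Proof.
  intros H. rewrite csum_swap. destruct m as [|m]; [lia|]. rewrite csum_shift.
  rewrite (csum_0 m).
  - rewrite (csum_ext n _ (fun _ => l O)) by (intros; simpl; ring). rewrite csum_const. ring.
  - intros i Hi. rewrite (csum_ext n _ (fun k => (l (S i) * RtoC r ^ S i * rootu n k ^ S i)%X)).
    + rewrite csum_scal, csum_rootu_pow by lia. ring.
    + intros k _. unfold pt. rewrite Cpow_mul_base. ring.
Qed.

Definition Cbar (z : Cplx) : Cplx := mkC (Re z) (- Im z).

Lemma Re_mul_Re (x y : Cplx) : Re x * Re y = / 2 * Re (x * y)%X + / 2 * Re (x * Cbar y)%X.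
Proof. simpl. field. Qed.

Lemma Cbar_mul (x y : Cplx) : Cbar (x * y)%X = (Cbar x * Cbar y)%X.
Proof. apply Ceq; simpl; ring. Qed.

Lemma Cbar_cis (t : R) : Cbar (cis t) = cis (- t).
Proof. apply Ceq; simpl; [symmetry; apply cos_neg | rewrite sin_neg; ring]. Qed.

Lemma csum_rootu_pow_bar (n i j : nat) :
  (i < n)%nat -> (j < n)%nat -> i <> j -> csum n (fun k => (rootu n k ^ i * Cbar (rootu n k ^ j))%X) = 0%X.
Proof.
  intros Hi Hj Hij. assert (Hn : 0 < INR n) by (apply lt_0_INR; lia). assert (PP := PI_RGT_0).
  rewrite (csum_ext n _ (fun k => cis (INR k * (2 * PI * (INR i - INR j) / INR n)))).
  2:{ intros k _. rewrite !rootu_pow, Cbar_cis, <- cis_add. f_equal. field. lra. }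
  assert (Li : INR i < INR n) by (apply lt_INR; lia). assert (Lj : INR j < INR n) by (apply lt_INR; lia).
  assert (Pi0 := pos_INR i). assert (Pj0 := pos_INR j).
  assert (INR i <> INR j) by (apply not_INR; exact Hij).
  assert (B : forall x, 0 < x < INR n -> 0 < 2 * PI * x / INR n < 2 * PI).
  { intros x Hx. split.
    - apply Rdiv_lt_0_compat; nra.
    - apply Rmult_lt_reg_r with (INR n); [lra|]. unfold Rdiv. rewrite Rmult_assoc, Rinv_l by lra. nra. }
  assert (FL : forall i j : nat, cis (2 * PI * (INR i - INR j)) = 1%X).
  { intros a b. replace (2 * PI * (INR a - INR b)) with (2 * PI * INR a + - (2 * PI * INR b)) by ring.
    rewrite cis_add, <- Cbar_cis, !cis_2PI_nat. apply Ceq; simpl; ring. }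
  apply csum_cis.
  - destruct (Rlt_le_dec (INR j) (INR i)).
    + apply cis_neq1, B. lra.
    + intros E. apply (cis_neq1 (2 * PI * (INR j - INR i) / INR n)); [apply B; lra|].
      apply cis_neg_eq1. rewrite <- E. f_equal. field. lra.
  - replace (INR n * (2 * PI * (INR i - INR j) / INR n)) with (2 * PI * (INR i - INR j)) by (field; lra). apply FL.
Qed.

(** The product of two real parts has the frequencies [i + j] and [i - j]. The condition [i + j < n]
    keeps both from being multiples of [n]. *)
Lemma rsum_corr_neq (n i j : nat) (a b : Cplx) :
  (i + j < n)%nat -> i <> j -> rsum n (fun k => Re (a * rootu n k ^ i)%X * Re (b * rootu n k ^ j)%X) = 0.
Proof.
  intros H Hij.
  rewrite (rsum_ext n _ (fun k => / 2 * Re (a * b * rootu n k ^ (i + j))%X + / 2 * Re (a * Cbar b * (rootu n k ^ i * Cbar (rootu n k ^ j)))%X)).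
  - rewrite rsum_plus, !rsum_scal.
    rewrite <- (Re_csum n (fun k => (a * b * rootu n k ^ (i + j))%X)), <- (Re_csum n (fun k => (a * Cbar b * (rootu n k ^ i * Cbar (rootu n k ^ j)))%X)).
    rewrite !csum_scal, csum_rootu_pow, csum_rootu_pow_bar by lia. simpl. ring.
  - intros k _. rewrite Re_mul_Re, Cbar_mul, Cpow_add. f_equal; f_equal; f_equal; ring.
Qed.

Lemma rsum_corr_eq (n i : nat) (a b : Cplx) :
  (0 < i)%nat -> (i + i < n)%nat -> rsum n (fun k => Re (a * rootu n k ^ i)%X * Re (b * rootu n k ^ i)%X) = INR n * (/ 2 * Re (a * Cbar b)%X).
Proof.
  intros Hi H.
  rewrite (rsum_ext n _ (fun k => / 2 * Re (a * b * rootu n k ^ (i + i))%X + / 2 * Re (a * Cbar b)%X)).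
  - rewrite rsum_plus, rsum_scal, rsum_const.
    rewrite <- (Re_csum n (fun k => (a * b * rootu n k ^ (i + i))%X)).
    rewrite !csum_scal, csum_rootu_pow by lia. simpl. ring.
  - intros k _. rewrite Re_mul_Re, Cbar_mul, Cpow_add. f_equal; f_equal; f_equal; [ring|].
    assert (E : (rootu n k ^ i * Cbar (rootu n k ^ i))%X = 1%X).
    { rewrite rootu_pow, Cbar_cis, <- cis_add, Rplus_opp_r. apply cis_0. }
    transitivity (a * Cbar b * (rootu n k ^ i * Cbar (rootu n k ^ i)))%X; [ring | rewrite E; ring].
Qed.

(* By averaging the positive function [C - v] against [1 + Re (u z^i)]. *)
Lemma coefficient_bound (r R3 C : R) (v : Cplx -> R) (l : nat -> Cplx) (i : nat) :
  real_series r v l -> 0 < R3 < r -> (forall z, Cabs z <= R3 -> v z <= C) -> (0 < i)%nat ->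
  Cabs (l i) * R3 ^ i <= 2 * (C - Re (l O)).
Proof.
  intros HS HR HC Hi. apply le_epsilon. intros eps He.
  destruct (HS R3 HR (eps / 2)) as [D HD]; [lra|].
  (* Twice the truncation degree, so that [i + j < n] for every frequency [j] of the partial sum. *)
  set (m := (D + i + 1)%nat). set (n := (2 * m)%nat).
  assert (Hm : (D <= m)%nat) by (unfold m; lia). specialize (HD m Hm).
  assert (Hn : 0 < INR n) by (apply lt_0_INR; unfold n, m; lia).
  (* The unit that makes [l i * Cbar u] equal to [|l i|]. *)
  set (u := if Ceq_dec (l i) 0%X then 1%X else (l i / RtoC (Cabs (l i)))%X).
  assert (Au : Cabs u = 1 /\ Re (l i * Cbar u)%X = Cabs (l i)).
  { unfold u. destruct (Ceq_dec (l i) 0%X) as [E|E].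
    - rewrite E, Cabs_1, Cabs_0. split; [reflexivity | simpl; ring].
    - assert (P := Cabs_pos _ E).
      assert (N : RtoC (Cabs (l i)) <> 0%X) by (intros X; apply (f_equal Re) in X; simpl in X; lra).
      split.
      + rewrite Cabs_div by exact N. rewrite Cabs_RtoC, Rabs_pos_eq by lra. field. lra.
      + replace (Re (l i * Cbar (l i / RtoC (Cabs (l i))))%X) with ((Re (l i) * Re (l i) + Im (l i) * Im (l i)) / Cabs (l i)).
        * rewrite <- Cabs_sq. field. lra.
        * set (c := Cabs (l i)) in *. clearbody c. simpl. field. lra. }
  destruct Au as [Au Lu].
  set (P := fun z => Re (csum m (fun j => l j * z ^ j)%X)) in *.
  set (W := fun k => 1 + Re (u * rootu n k ^ i)%X).
  assert (W0 : forall k, 0 <= W k).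
  { intros k. unfold W. assert (Q := Re_le_Cabs (u * rootu n k ^ i)%X).
    rewrite Cabs_mul, Au, Cabs_pow, Cabs_rootu, pow1, Rmult_1_r in Q. apply Rabs_le_between in Q. lra. }
  assert (POS : 0 <= rsum n (fun k => (C - P (pt n R3 k) + eps / 2) * W k)).
  { replace 0 with (INR n * 0) at 1 by ring. rewrite <- rsum_const. apply rsum_le. intros k _.
    apply Rmult_le_pos; [|apply W0]. specialize (HD (pt n R3 k)). specialize (HC (pt n R3 k)).
    rewrite Cabs_pt in HD, HC by lra. specialize (HD (Rle_refl _)). specialize (HC (Rle_refl _)).
    apply Rabs_le_between in HD. fold (P (pt n R3 k)) in HD. lra. }
  assert (SW : rsum n (fun k => Re (u * rootu n k ^ i)%X) = 0).
  { rewrite <- (Re_csum n (fun k => (u * rootu n k ^ i)%X)), csum_scal, csum_rootu_pow by (unfold n, m; lia). simpl; ring. }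
  assert (SP : rsum n (fun k => P (pt n R3 k)) = INR n * Re (l O)).
  { unfold P. rewrite <- (Re_csum n (fun k => csum m (fun j => (l j * pt n R3 k ^ j)%X))).
    rewrite csum_poly_pt by (unfold n, m; lia). simpl; ring. }
  assert (SPW : rsum n (fun k => P (pt n R3 k) * Re (u * rootu n k ^ i)%X) = INR n * (/ 2 * (Cabs (l i) * R3 ^ i))).
  { rewrite (rsum_ext n _ (fun k => rsum m (fun j => Re (l j * RtoC R3 ^ j * rootu n k ^ j)%X * Re (u * rootu n k ^ i)%X))).
    2:{ intros k _. unfold P. rewrite Re_csum, Rmult_comm, <- rsum_scal. apply rsum_ext. intros j _.
        rewrite Rmult_comm. f_equal. unfold pt. rewrite Cpow_mul_base. f_equal. ring. }
    rewrite rsum_swap.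
    assert (Hn2 : n = (2 * m)%nat) by reflexivity.
    assert (Hm2 : m = (D + i + 1)%nat) by reflexivity. clearbody n m.
    assert (Hmi : m = (i + S (m - S i))%nat) by lia.
    rewrite Hmi at 1. rewrite rsum_split.
    assert (SH : forall q F, rsum (S q) F = F O + rsum q (fun k => F (S k))).
    { induction q; intros F; [simpl; ring|]. change (rsum (S (S q)) F) with (rsum (S q) F + F (S q)). rewrite IHq. simpl; ring. }
    rewrite SH.
    rewrite (rsum_ext i _ (fun _ => 0)).
    2:{ intros j Hj. apply rsum_corr_neq; lia. }
    rewrite (rsum_ext (m - S i) _ (fun _ => 0)).
    2:{ intros j Hj. apply rsum_corr_neq; lia. }
    rewrite !rsum_const, Nat.add_0_r.
    rewrite rsum_corr_eq by lia.
    replace (l i * RtoC R3 ^ i * Cbar u)%X with (RtoC (R3 ^ i) * (l i * Cbar u))%X by (rewrite RtoC_pow; ring).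
    replace (Re (RtoC (R3 ^ i) * (l i * Cbar u))%X) with (R3 ^ i * Re (l i * Cbar u)%X) by (generalize (l i * Cbar u)%X; intros; simpl; ring).
    rewrite Lu. ring. }
  rewrite (rsum_ext n _ (fun k => (C + eps / 2) + (C + eps / 2) * Re (u * rootu n k ^ i)%X - (P (pt n R3 k) + P (pt n R3 k) * Re (u * rootu n k ^ i)%X))) in POS
    by (intros; unfold W; ring).
  rewrite rsum_minus, !rsum_plus, rsum_scal, !rsum_const, SW, SP, SPW in POS.
  assert (0 <= (C + eps / 2) - Re (l O) - / 2 * (Cabs (l i) * R3 ^ i)).
  { apply Rmult_le_reg_l with (INR n); [exact Hn|]. rewrite Rmult_0_r. eapply Rle_trans; [exact POS|]. apply Req_le; ring. }
  lra.
Qed.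

Lemma geom_tail (q : R) (n m : nat) : 0 <= q < 1 -> rsum m (fun k => q ^ (n + k)) <= q ^ n / (1 - q).
Proof.
  intros Hq. assert (E : rsum m (fun k => q ^ (n + k)) * (1 - q) = q ^ n * (1 - q ^ m)).
  { induction m; [simpl; ring|]. simpl. rewrite Rmult_plus_distr_r, IHm, pow_add. ring. }
  apply Rmult_le_reg_r with (1 - q); [lra|]. unfold Rdiv. rewrite Rmult_assoc, Rinv_l, E by lra.
  assert (0 <= q ^ n) by (apply pow_le; lra). assert (0 <= q ^ m) by (apply pow_le; lra). nra.
Qed.

(** Only the coefficients of index at least [n] can disturb the mean over [n] points, and
    [coefficient_bound] makes them a geometric tail. The error depends on [v] through [C] and [l 0]
    alone; this uniformity is what [jensen_values] needs for its family of functions. *)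
Lemma harmonic_average_le (r R0 R3 C : R) (v : Cplx -> R) (l : nat -> Cplx) (n : nat) :
  real_series r v l -> 0 < R0 < R3 -> R3 < r -> (forall z, Cabs z <= R3 -> v z <= C) -> (0 < n)%nat ->
  rsum n (fun k => v (pt n R0 k)) <= INR n * (Re (l O) + 2 * (C - Re (l O)) * ((R0 / R3) ^ n / (1 - R0 / R3))).
Proof.
  intros HS HR HR3 HC Hn.
  assert (Hn' : 0 < INR n) by (apply lt_0_INR; lia).
  apply le_epsilon. intros eps He.
  destruct (HS R0 ltac:(lra) (eps / INR n)) as [D HD]; [apply Rdiv_lt_0_compat; lra|].
  specialize (HD (n + D)%nat ltac:(lia)).
  set (q := R0 / R3).
  assert (Hq : 0 <= q < 1).
  { unfold q. split; [apply Rmult_le_pos; [lra | left; apply Rinv_0_lt_compat; lra]|].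
    apply Rmult_lt_reg_r with R3; [lra|]. unfold Rdiv; rewrite Rmult_assoc, Rinv_l by lra. lra. }
  set (B := 2 * (C - Re (l O))) in *.
  assert (CB : forall i, (0 < i)%nat -> Cabs (l i) * R3 ^ i <= B) by (intros; apply (coefficient_bound r R3 C v); auto; lra).
  assert (B0 : 0 <= B).
  { eapply Rle_trans; [|apply (CB 1%nat); lia]. apply Rmult_le_pos; [apply Cabs_ge0 | apply pow_le; lra]. }
  apply Rle_trans with (rsum n (fun k => Re (csum n (fun i => l i * pt n R0 k ^ i)%X) + (B * (q ^ n / (1 - q)) + eps / INR n))).
  - apply rsum_le. intros k _. specialize (HD (pt n R0 k)). rewrite Cabs_pt in HD by lra. specialize (HD (Rle_refl _)).
    apply Rabs_le_between in HD. rewrite csum_split in HD.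
    match type of HD with _ <= _ - Re (?X + ?Y)%X <= _ => change (Re (X + Y)%X) with (Re X + Re Y) in HD; assert (T : Re Y <= B * (q ^ n / (1 - q))) end.
    { eapply Rle_trans; [apply Rle_abs|]. eapply Rle_trans; [apply Re_le_Cabs|]. eapply Rle_trans; [apply csum_abs|].
      apply Rle_trans with (rsum D (fun i => B * q ^ (n + i))).
      - apply rsum_le. intros i _. rewrite Cabs_mul, Cabs_pow, Cabs_pt by lra.
        specialize (CB (n + i)%nat ltac:(lia)).
        assert (E : R0 ^ (n + i) = R3 ^ (n + i) * q ^ (n + i)).
        { rewrite <- Rpow_mult_distr. f_equal. unfold q. field. lra. }
        rewrite E, <- Rmult_assoc. apply Rmult_le_compat_r; [apply pow_le; lra | exact CB].
      - rewrite rsum_scal. apply Rmult_le_compat_l; [exact B0 | now apply geom_tail]. }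
    lra.
  - rewrite rsum_plus, rsum_const.
    rewrite <- (Re_csum n (fun k => csum n (fun i => (l i * pt n R0 k ^ i)%X))), csum_poly_pt by lia.
    apply Req_le. replace (Re (RtoC (INR n) * l O)%X) with (INR n * Re (l O)) by (simpl; ring).
    field. lra.
Qed.

Lemma harmonic_average_tendsto (r R0 : R) (v : Cplx -> R) (l : nat -> Cplx) :
  real_series r v l -> 0 < R0 < r -> forall eps, 0 < eps -> exists N0, forall N, (N0 <= N)%nat ->
  Rabs (rsum N (fun k => v (pt N R0 k)) - INR N * Re (l O)) <= INR N * eps.
Proof.
  intros HS HR eps He. destruct (HS R0 HR eps He) as [D HD]. exists (D + 1)%nat. intros N HN.
  specialize (HD (D + 1)%nat ltac:(lia)).
  assert (E : INR N * Re (l O) = rsum N (fun k => Re (csum (D + 1) (fun i => l i * pt N R0 k ^ i)%X))).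
  { rewrite <- (Re_csum N (fun k => csum (D + 1) (fun i => (l i * pt N R0 k ^ i)%X))), csum_poly_pt by lia. simpl; ring. }
  rewrite E, <- rsum_minus. eapply Rle_trans; [apply rsum_abs|]. apply rsum_le_const.
  intros k _. apply HD. rewrite Cabs_pt; lra.
Qed.

(** * Jensen's formula on roots of unity *)

Fixpoint lsum {A : Type} (F : A -> R) (l : list A) : R := match l with nil => 0 | a :: t => F a + lsum F t end.

Lemma lsum_le {A : Type} (F G : A -> R) (l : list A) : (forall a, In a l -> F a <= G a) -> lsum F l <= lsum G l.
Proof.
  intros H. induction l as [|a l IH]; simpl; [lra|].
  assert (F a <= G a) by (apply H; now left). assert (lsum F l <= lsum G l) by (apply IH; intros; apply H; now right). lra.
Qed.

Lemma lsum_le_const {A : Type} (F : A -> R) (c : R) (l : list A) : (forall a, In a l -> F a <= c) -> lsum F l <= INR (length l) * c.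
Proof.
  intros H. induction l as [|a l IH]; [simpl; lra|]. simpl length. rewrite S_INR. simpl.
  assert (F a <= c) by (apply H; now left). assert (lsum F l <= INR (length l) * c) by (apply IH; intros; apply H; now right). lra.
Qed.

Lemma lsum_rsum {A : Type} (n : nat) (F : nat -> A -> R) (l : list A) :
  rsum n (fun k => lsum (F k) l) = lsum (fun a => rsum n (fun k => F k a)) l.
Proof.
  induction l as [|a l IH]; simpl; [rewrite rsum_const; ring|]. rewrite rsum_plus, IH. reflexivity.
Qed.

Lemma lsum_minus {A : Type} (F G : A -> R) (l : list A) : lsum (fun a => F a - G a) l = lsum F l - lsum G l.
Proof. induction l; simpl; [ring | rewrite IHl; ring]. Qed.

Lemma lsum_scal {A : Type} (c : R) (F : A -> R) (l : list A) : lsum (fun a => c * F a) l = c * lsum F l.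
Proof. induction l; simpl; [ring | rewrite IHl; ring]. Qed.

Lemma ln_prodl (l : list Cplx) (z : Cplx) :
  (forall a, In a l -> z <> a) -> prodl l z <> 0%X /\ ln (Cabs (prodl l z)) = lsum (fun a => ln (Cabs (z - a)%X)) l.
Proof.
  induction l as [|a l IH]; intros H; simpl.
  - split; [|rewrite Cabs_1; apply ln_1]. apply Cabs_neq0. rewrite Cabs_1; lra.
  - destruct IH as [I1 I2]; [intros; apply H; now right|].
    assert (N : (z - a)%X <> 0%X) by (apply Csub_neq0, H; now left).
    split; [now apply Cmul_neq0|]. rewrite Cabs_mul, ln_mult, I2 by now apply Cabs_pos. reflexivity.
Qed.

Lemma prodl_neq0_notin (l : list Cplx) (z : Cplx) : prodl l z <> 0%X -> forall a, In a l -> z <> a.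
Proof.
  induction l as [|b l IH]; intros H a Ha; [easy|]. simpl in H. destruct Ha as [-> | Ha].
  - intros ->. apply H. ring.
  - apply IH; [|exact Ha]. intros E. apply H. rewrite E. ring.
Qed.

Lemma ln_le (x y : R) : 0 < x -> x <= y -> ln x <= ln y.
Proof. intros Hx [H | ->]; [left; now apply ln_increasing | lra]. Qed.

Lemma ln_pow_nat (x : R) (n : nat) : 0 < x -> ln (x ^ n) = INR n * ln x.
Proof.
  intros Hx. induction n; [simpl; rewrite ln_1; ring|]. rewrite S_INR. simpl.
  rewrite ln_mult, IHn by (try apply pow_lt; exact Hx). ring.
Qed.

Lemma ln_diff_pow_le (x y : Cplx) (n : nat) :
  (x ^ n - y ^ n)%X <> 0%X -> 0 < Cabs x -> ln (Cabs (x ^ n - y ^ n)%X) <= ln 2 + INR n * ln (Rmax (Cabs x) (Cabs y)).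
Proof.
  intros HN Hx. assert (Mx := Rmax_l (Cabs x) (Cabs y)). assert (My := Rmax_r (Cabs x) (Cabs y)).
  rewrite <- ln_pow_nat by lra. rewrite <- ln_mult by (try apply pow_lt; lra).
  apply ln_le; [now apply Cabs_pos|]. eapply Rle_trans; [apply Cabs_sub|]. rewrite !Cabs_pow.
  assert (B := Cabs_ge0 y).
  assert (Cabs x ^ n <= Rmax (Cabs x) (Cabs y) ^ n) by (apply pow_incr; lra).
  assert (Cabs y ^ n <= Rmax (Cabs x) (Cabs y) ^ n) by (apply pow_incr; lra). lra.
Qed.

(** The constant is [- ln (1 - q)] with [q] the ratio of the smaller to the larger modulus. It does
    not depend on [n], so it disappears after division by [n]. *)
Lemma ln_diff_pow_ge (x y : Cplx) :
  Cabs x <> Cabs y -> exists c, 0 <= c /\ forall n, (0 < n)%nat ->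
    (x ^ n - y ^ n)%X <> 0%X /\ INR n * ln (Rmax (Cabs x) (Cabs y)) - c <= ln (Cabs (x ^ n - y ^ n)%X).
Proof.
  assert (W : forall x y, Cabs y < Cabs x -> exists c, 0 <= c /\ forall n, (0 < n)%nat ->
    (x ^ n - y ^ n)%X <> 0%X /\ INR n * ln (Cabs x) - c <= ln (Cabs (x ^ n - y ^ n)%X)).
  { clear. intros x y H. assert (B := Cabs_ge0 y). set (q := Cabs y / Cabs x).
    assert (Hq : 0 <= q < 1).
    { unfold q. split; [apply Rmult_le_pos; [lra | left; apply Rinv_0_lt_compat; lra]|].
      apply Rmult_lt_reg_r with (Cabs x); [lra|]. unfold Rdiv; rewrite Rmult_assoc, Rinv_l by lra. lra. }
    exists (- ln (1 - q)). split.
    { assert (ln (1 - q) <= ln 1) by (apply ln_le; lra). rewrite ln_1 in *. lra. }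
    intros n Hn.
    assert (P : 0 < Cabs x ^ n) by (apply pow_lt; lra).
    assert (L : Cabs x ^ n * (1 - q) <= Cabs (x ^ n - y ^ n)%X).
    { eapply Rle_trans; [|apply Cabs_sub_ge]. rewrite !Cabs_pow.
      assert (E : Cabs y ^ n = Cabs x ^ n * q ^ n) by (rewrite <- Rpow_mult_distr; f_equal; unfold q; field; lra).
      assert (q ^ n <= q).
      { destruct n; [lia|]. simpl.
        assert (q ^ n <= 1) by (rewrite <- (pow1 n); apply pow_incr; lra). nra. }
      rewrite E. nra. }
    assert (P1 : 0 < Cabs x ^ n * (1 - q)) by (apply Rmult_lt_0_compat; lra).
    split; [apply Cabs_neq0; lra|].
    rewrite <- ln_pow_nat by lra. unfold Rminus at 1. rewrite Ropp_involutive, <- ln_mult by lra.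
    apply ln_le; lra. }
  intros H. destruct (Rlt_le_dec (Cabs y) (Cabs x)) as [L|L].
  - destruct (W x y L) as [c [Hc Hn]]. exists c. split; [exact Hc|]. intros n Hn0. rewrite Rmax_left by lra. now apply Hn.
  - destruct (W y x ltac:(lra)) as [c [Hc Hn]]. exists c. split; [exact Hc|]. intros n Hn0. rewrite Rmax_right by lra.
    destruct (Hn n Hn0) as [H1 H2]. rewrite Cabs_sub_sym. split; [|exact H2].
    apply Cabs_neq0. rewrite Cabs_sub_sym. now apply Cabs_pos.
Qed.

(** An exact discrete mean of [ln |z - a|]. With the bounds on [ln |x ^ n - y ^ n|] it yields the
    classical value [ln (max r |a|)] up to [O(1/n)]. *)
Lemma rsum_ln_linear (n : nat) (r : R) (a : Cplx) :
  (0 < n)%nat -> (forall k, (k < n)%nat -> pt n r k <> a) ->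
  (RtoC r ^ n - a ^ n)%X <> 0%X /\ rsum n (fun k => ln (Cabs (pt n r k - a)%X)) = ln (Cabs (RtoC r ^ n - a ^ n)%X).
Proof.
  intros Hn H.
  assert (N : forall k, (k < n)%nat -> (rootu n k * RtoC r - a)%X <> 0%X).
  { intros k Hk. replace (rootu n k * RtoC r)%X with (pt n r k) by (unfold pt; ring). apply Csub_neq0. auto. }
  assert (E := cprod_sub_rootu n (RtoC r) a Hn). split.
  - apply Cabs_neq0. rewrite <- E. apply Cabs_pos, cprod_neq0, N.
  - rewrite <- E, ln_Cabs_cprod by exact N. apply rsum_ext. intros k _. unfold pt. f_equal. f_equal. ring.
Qed.

(** The point is a constant independent of [a]. If [a] is far from the small disk, division is
    harmless; otherwise [H] is bounded on a circle that stays away from [a], and the bound is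
    carried inwards. *)
Lemma quotient_bound_linear (a : Cplx) (h H : Cplx -> Cplx) (R1 R2 M : R) :
  0 < R1 < R2 -> R2 < 1 -> 0 <= M -> holo_on (disk 1) H -> (forall z, disk 1 z -> h z = ((z - a) * H z)%X) ->
  (forall z, Cabs z <= R2 -> Cabs (h z) <= M) -> forall z, Cabs z <= R1 -> Cabs (H z) <= 8 / ((R2 - R1) * (R2 - R1)) * M.
Proof.
  intros HR HR2 HM HH E B z Hz. set (e := R2 - R1). assert (He : 0 < e < 1) by (unfold e; lra).
  assert (D : forall w c, 0 < c -> Cabs w <= R2 -> c <= Cabs (w - a)%X -> Cabs (H w) <= M / c).
  { intros w c Hc Hw Hca. specialize (B w Hw). rewrite E in B by (unfold disk; lra). rewrite Cabs_mul in B.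
    apply Rmult_le_reg_r with c; [exact Hc|].
    unfold Rdiv. rewrite Rmult_assoc, Rinv_l by lra. nra. }
  destruct (Rle_dec ((R1 + R2) / 2) (Cabs a)) as [Ha|Ha].
  - apply Rle_trans with (M / (e / 2)).
    + apply D; [lra | lra|]. rewrite Cabs_sub_sym. assert (G := Cabs_sub_ge a z). unfold e. lra.
    + replace (8 / (e * e) * M) with (M / (e / 2) * (4 / e)) by (field; lra).
      rewrite <- (Rmult_1_r (M / (e / 2))) at 1. apply Rmult_le_compat_l.
      * apply Rmult_le_pos; [lra | left; apply Rinv_0_lt_compat; lra].
      * apply Rmult_le_reg_r with e; [lra|]. unfold Rdiv. rewrite Rmult_assoc, Rinv_l by lra. lra.
  (* Halfway between [(R1 + R2) / 2], which exceeds [|a|] here, and [R2]. *)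
  - set (R3 := (R1 + 3 * R2) / 4).
    assert (B3 : forall w, Cabs w = R3 -> Cabs (H w) <= M / (e / 4)).
    { intros w Hw. apply D; [lra | unfold R3 in Hw; lra|]. assert (G := Cabs_sub_ge w a). unfold e, R3 in *. lra. }
    eapply Rle_trans; [apply (holo_bound H 1 R3 (M / (e / 4))); [exact HH | unfold R3; lra | exact B3 | unfold R3; lra]|].
    replace (8 / (e * e) * M) with (M / (e / 4) * (2 / e)) by (field; lra).
    apply Rmult_le_compat_l.
    + apply Rmult_le_pos; [lra | left; apply Rinv_0_lt_compat; lra].
    + apply Rle_trans with (1 / (R3 - R1)).
      * apply Rmult_le_compat; [unfold R3; lra | left; apply Rinv_0_lt_compat; unfold R3; lra | unfold R3; lra|].
        apply Rinv_le_contravar; unfold R3; lra.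
      * replace (R3 - R1) with (3 * e / 4) by (unfold R3, e; field).
        apply Rmult_le_reg_r with e; [lra|]. replace (1 / (3 * e / 4) * e) with (4 / 3) by (field; lra).
        replace (2 / e * e) with 2 by (field; lra). lra.
Qed.

(** One factor is removed at a time, each removal using half of the remaining gap between the radii,
    so [K] depends only on [q] and the radii and not on the zeros. *)
Lemma quotient_bound (q : nat) (R1 R2 : R) :
  0 < R1 < R2 -> R2 < 1 -> exists K, 1 <= K /\ forall l h H M, (length l <= q)%nat -> 0 <= M -> holo_on (disk 1) H ->
    (forall z, disk 1 z -> h z = (prodl l z * H z)%X) -> (forall z, Cabs z <= R2 -> Cabs (h z) <= M) ->
    forall z, Cabs z <= R1 -> Cabs (H z) <= K * M.
Proof.
  revert R1 R2. induction q as [|q IH]; intros R1 R2 HR HR2.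
  - exists 1. split; [lra|]. intros l h H M Hl HM HH E B z Hz. destruct l; [|simpl in Hl; lia].
    specialize (B z ltac:(lra)). rewrite E in B by (unfold disk; lra). simpl in B.
    replace (1 * H z)%X with (H z) in B by ring. lra.
  - destruct (IH R1 ((R1 + R2) / 2)) as [K [HK1 HK]]; [lra | lra|].
    set (e := R2 - (R1 + R2) / 2). assert (He : 0 < e < 1) by (unfold e; lra).
    set (K1 := 8 / (e * e)).
    assert (HK2 : 1 <= K1).
    { unfold K1. apply Rmult_le_reg_r with (e * e); [nra|]. unfold Rdiv. rewrite Rmult_assoc, Rinv_l by nra. nra. }
    exists (K * K1). split; [nra|]. intros l h H M Hl HM HH E B z Hz. destruct l as [|a l].
    + specialize (B z ltac:(lra)). rewrite E in B by (unfold disk; lra). simpl in B.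
      replace (1 * H z)%X with (H z) in B by ring. assert (1 <= K * K1) by nra. nra.
    + simpl in Hl. rewrite Rmult_assoc.
      apply (HK l (fun z => (prodl l z * H z)%X) H (K1 * M)); try lia; auto; [nra|].
      intros w Hw. apply (quotient_bound_linear a h (fun z => (prodl l z * H z)%X) ((R1 + R2) / 2) R2 M); auto; [lra | |].
      * apply holo_mul; [apply holo_prodl | exact HH].
      * intros x Hx. rewrite (E x Hx). simpl. ring.
Qed.

Lemma holo_bounded_disk (f : Cplx -> Cplx) (r : R) :
  holo_on (disk 1) f -> 0 < r < 1 -> exists M, 0 < M /\ forall z, Cabs z <= r -> Cabs (f z) <= M.
Proof.
  intros Hf Hr. set (r2 := (r + 1) / 2). destruct (holo_bounded_circle f 1 r2 Hf) as [M [M0 HM]]; [unfold r2; lra|].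
  assert (P : 0 < r2 / (r2 - r)) by (apply Rdiv_lt_0_compat; unfold r2; lra).
  exists (M * (r2 / (r2 - r)) + 1). split; [nra|]. intros z Hz.
  apply Rle_trans with (M * (r2 / (r2 - r))); [|lra].
  eapply Rle_trans; [apply (holo_bound f 1 r2 M); auto; unfold r2; lra|].
  apply Rmult_le_compat_l; [exact M0|]. apply Rmult_le_compat_l; [unfold r2; lra|].
  apply Rinv_le_contravar; unfold r2; lra.
Qed.

Lemma uniform_threshold {A : Type} (l : list A) (P : A -> nat -> Prop) :
  (forall a, In a l -> exists N0, forall N, (N0 <= N)%nat -> P a N) ->
  exists N0, forall a, In a l -> forall N, (N0 <= N)%nat -> P a N.
Proof.
  induction l as [|a l IH]; intros H.
  - exists O. intros a [].
  - destruct IH as [N1 H1]; [intros; apply H; now right|]. destruct (H a) as [N2 H2]; [now left|].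
    exists (Nat.max N1 N2). intros b [-> | Hb] N HN; [apply H2; lia | apply H1; [exact Hb | lia]].
Qed.

Lemma linear_average_tendsto (r : R) (a : Cplx) : 0 < r -> r <> Cabs a -> forall eps, 0 < eps ->
  exists N0, forall N, (N0 <= N)%nat ->
    Rabs (rsum N (fun k => ln (Cabs (pt N r k - a)%X)) - INR N * ln (Rmax r (Cabs a))) <= INR N * eps.
Proof.
  intros Hr Ha eps He.
  assert (AR : Cabs (RtoC r) = r) by (rewrite Cabs_RtoC, Rabs_pos_eq; lra).
  destruct (ln_diff_pow_ge (RtoC r) a) as [c [Hc Hn]]; [rewrite AR; exact Ha|].
  assert (L2 : 0 < ln 2) by (rewrite <- ln_1; apply ln_increasing; lra).
  destruct (INR_unbounded ((c + ln 2) / eps)) as [N0 HN0].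
  exists (S N0). intros N HN.
  assert (HNp : (0 < N)%nat) by lia. destruct (Hn N HNp) as [NZ GE].
  destruct (rsum_ln_linear N r a HNp) as [_ EQ].
  { intros k _ E. apply Ha. rewrite <- E, Cabs_pt; lra. }
  assert (LE := ln_diff_pow_le (RtoC r) a N NZ ltac:(lra)). rewrite AR in *. rewrite EQ.
  assert (INR N0 <= INR N) by (apply le_INR; lia).
  assert (Q : c + ln 2 <= INR N * eps).
  { apply Rmult_le_reg_r with (/ eps); [now apply Rinv_0_lt_compat|].
    replace (INR N * eps * / eps) with (INR N) by (field; lra). lra. }
  apply Rabs_le. lra.
Qed.

(* [J w rho] is the value of Jensen's formula for [g - w] on the circle of radius [rho]: an upper bound
   for the averages over roots of unity, up to errors that do not depend on [w], and their limit on
   circles without zeros. *)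
Lemma jensen_values (g : Cplx -> Cplx) (q : nat) (R0 T : R) :
  holo_on (disk 1) g -> valent q g -> 0 < R0 < 1 -> 0 < T ->
  exists C th, 0 <= th < 1 /\ forall w, Cabs w <= T -> g 0%X <> w -> exists (J : R -> R) (bad : list R),
    (forall n, (0 < n)%nat -> (forall k, (k < n)%nat -> g (pt n R0 k) <> w) ->
       rsum n (fun k => ln (Cabs (g (pt n R0 k) - w)%X)) <=
       INR n * (J R0 + 2 * (th ^ n / (1 - th)) * (C - ln (Cabs (g 0%X - w)%X))) + INR q * ln 2) /\
    (forall r, 0 < r < R0 -> ~ In r bad -> (forall z, Cabs z = r -> g z <> w) /\ forall eps, 0 < eps -> exists N0, forall N, (N0 <= N)%nat ->
       Rabs (rsum N (fun k => ln (Cabs (g (pt N r k) - w)%X)) - INR N * J r) <= INR N * eps) /\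
    (forall r, 0 < r <= R0 -> J R0 - J r <= INR q * ln (R0 / r)).
Proof.
  intros Hg HV HR HT.
  set (R3 := (2 * R0 + 1) / 3). set (R2 := (R0 + 2) / 3).
  destruct (holo_bounded_disk g R2 Hg) as [M [M0 HM]]; [unfold R2; lra|].
  destruct (quotient_bound q R3 R2) as [K [K1 HK]]; [unfold R2, R3; lra | unfold R2; lra|].
  (* A common upper bound for [ln |H|] over all [w] with [|w| <= T]; it is fixed before [w] is
     chosen. *)
  set (C := ln (K * (M + T))).
  exists C, (R0 / R3).
  assert (Hth : 0 <= R0 / R3 < 1).
  { split; [apply Rmult_le_pos; [lra | left; apply Rinv_0_lt_compat; unfold R3; lra]|].
    apply Rmult_lt_reg_r with R3; [unfold R3; lra|]. unfold Rdiv; rewrite Rmult_assoc, Rinv_l by (unfold R3; lra). unfold R3; lra. }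
  split; [exact Hth|]. intros w Hw Hgw.
  destruct (HV w) as (l & H & (HH & Hl & E) & Hq & Z).
  assert (D0 : disk 1 0%X) by (unfold disk; rewrite Cabs_0; lra).
  destruct (ln_Cabs_series H R2 HH Z) as (c & Hc0 & HS); [unfold R2; lra|].
  set (v := fun z => ln (Cabs (H z))) in *. set (v0 := ln (Cabs (H 0%X))) in *.
  assert (Rc0 : Re (c O) = v0) by (rewrite Hc0; reflexivity).
  assert (vC : forall z, Cabs z <= R3 -> v z <= C).
  { intros z Hz. apply ln_le; [apply Cabs_pos, Z; unfold disk, R3 in *; lra|].
    apply (HK l (fun z => (g z - w)%X) H (M + T)); auto; [lra|]. intros x Hx.
    eapply Rle_trans; [apply Cabs_sub|]. specialize (HM x Hx). lra. }
  assert (SPLIT : forall z, disk 1 z -> g z <> w -> (forall a, In a l -> z <> a) /\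
     ln (Cabs (g z - w)%X) = lsum (fun a => ln (Cabs (z - a)%X)) l + v z).
  { intros z Hz Hzw. assert (N := Csub_neq0 _ _ Hzw). rewrite (E z Hz) in N |- *.
    assert (P1 : prodl l z <> 0%X) by (intros X; apply N; rewrite X; ring).
    assert (P2 := prodl_neq0_notin l z P1). split; [exact P2|].
    rewrite Cabs_mul, ln_mult by (apply Cabs_pos; auto). rewrite (proj2 (ln_prodl l z P2)). reflexivity. }
  (* All zeros lie in the unit disk, so their factors only lower [|g 0 - w|]. This lets the error be
     expressed by [g 0 - w] instead of the unknown [H 0]. *)
  assert (V0 : ln (Cabs (g 0%X - w)%X) <= v0).
  { destruct (SPLIT 0%X D0 Hgw) as [S1 ->]. assert (X : lsum (fun a => ln (Cabs (0 - a)%X)) l <= INR (length l) * 0).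
    { apply lsum_le_const. intros a Ha. rewrite Forall_forall in Hl. specialize (Hl a Ha). unfold disk in Hl.
      apply Rle_trans with (ln 1); [|rewrite ln_1; lra].
      apply ln_le; [apply Cabs_pos, Csub_neq0; auto|]. rewrite Cabs_sub_sym.
      replace (a - 0)%X with a by ring. lra. }
    unfold v, v0 in *. lra. }
  (* The mean of [ln |z - a|] over [|z| = r] is [ln (max r |a|)]. The bad radii are those that carry
     a zero. *)
  exists (fun r => v0 + lsum (fun a => ln (Rmax r (Cabs a))) l), (map Cabs l).
  split; [|split].
  - intros n Hn HN.
    assert (Hn' : 0 < INR n) by (apply lt_0_INR; lia).
    assert (DP : forall k, disk 1 (pt n R0 k)) by (intros k; unfold disk; rewrite Cabs_pt; lra).
    rewrite (rsum_ext n _ (fun k => lsum (fun a => ln (Cabs (pt n R0 k - a)%X)) l + v (pt n R0 k))).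
    2:{ intros k Hk. apply SPLIT; auto. }
    rewrite rsum_plus, lsum_rsum.
    assert (A1 : rsum n (fun k => v (pt n R0 k)) <= INR n * (v0 + 2 * (C - v0) * ((R0 / R3) ^ n / (1 - R0 / R3)))).
    { rewrite <- Rc0. apply (harmonic_average_le R2); auto; unfold R2, R3; lra. }
    assert (A2 : lsum (fun a => rsum n (fun k => ln (Cabs (pt n R0 k - a)%X))) l <= lsum (fun a => ln 2 + INR n * ln (Rmax R0 (Cabs a))) l).
    { apply lsum_le. intros a Ha. destruct (rsum_ln_linear n R0 a Hn) as [NZ EQ].
      { intros k Hk. apply (SPLIT (pt n R0 k)); auto. }
      rewrite EQ. assert (AR : Cabs (RtoC R0) = R0) by (rewrite Cabs_RtoC, Rabs_pos_eq; lra).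
      rewrite <- AR at 2. apply ln_diff_pow_le; [exact NZ | lra]. }
    assert (A3 : lsum (fun a => ln 2 + INR n * ln (Rmax R0 (Cabs a))) l = INR (length l) * ln 2 + INR n * lsum (fun a => ln (Rmax R0 (Cabs a))) l).
    { clear. induction l as [|a l IH]; [simpl; ring|]. simpl length. rewrite S_INR. simpl. rewrite IH. ring. }
    assert (A4 : INR (length l) * ln 2 <= INR q * ln 2).
    { apply Rmult_le_compat_r; [|now apply le_INR]. rewrite <- ln_1. apply ln_le; lra. }
    set (kap := (R0 / R3) ^ n / (1 - R0 / R3)) in *.
    assert (K0 : 0 <= kap) by (apply Rmult_le_pos; [apply pow_le; lra | left; apply Rinv_0_lt_compat; lra]).
    assert (A5 : 2 * (C - v0) * kap <= 2 * kap * (C - ln (Cabs (g 0%X - w)%X))).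
    { replace (2 * (C - v0) * kap) with (2 * kap * (C - v0)) by ring. apply Rmult_le_compat_l; lra. }
    assert (A6 : INR n * (2 * (C - v0) * kap) <= INR n * (2 * kap * (C - ln (Cabs (g 0%X - w)%X)))) by (apply Rmult_le_compat_l; lra).
    lra.
  - intros r Hr Hbad.
    assert (NB : forall a, In a l -> r <> Cabs a) by (intros a Ha X; apply Hbad; rewrite X; now apply in_map).
    assert (NW : forall z, Cabs z = r -> g z <> w).
    { intros z Hz X. assert (Y : (g z - w)%X = 0%X) by (rewrite X; ring). rewrite E in Y by (unfold disk; lra).
      assert (PZ : prodl l z <> 0%X) by (apply ln_prodl; intros a Ha Q; apply (NB a Ha); rewrite <- Q; auto).
      apply (Cmul_neq0 _ _ PZ) in Y; [exact Y | apply Z; unfold disk; lra]. }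
    split; [exact NW|]. intros eps He.
    assert (HL : exists N0, forall N, (N0 <= N)%nat ->
      Rabs (lsum (fun a => rsum N (fun k => ln (Cabs (pt N r k - a)%X)) - INR N * ln (Rmax r (Cabs a))) l) <= INR N * (eps / 2)).
    { clear - NB Hr He. assert (G : forall e, 0 < e -> exists N0, forall N, (N0 <= N)%nat ->
        Rabs (lsum (fun a => rsum N (fun k => ln (Cabs (pt N r k - a)%X)) - INR N * ln (Rmax r (Cabs a))) l) <= INR N * e); [|apply G; lra].
      clear eps He. induction l as [|a l IH]; intros e He.
      - exists O. intros N _. simpl. rewrite Rabs_R0. apply Rmult_le_pos; [apply pos_INR | lra].
      - destruct (IH ltac:(intros; apply NB; now right) (e / 2) ltac:(lra)) as [N1 H1].
        destruct (linear_average_tendsto r a ltac:(lra) (NB a ltac:(now left)) (e / 2) ltac:(lra)) as [N2 H2].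
        exists (Nat.max N1 N2). intros N HN. specialize (H1 N ltac:(lia)). specialize (H2 N ltac:(lia)). simpl.
        eapply Rle_trans; [apply Rabs_triang|]. lra. }
    destruct HL as [N1 H1].
    destruct (harmonic_average_tendsto R2 r v c HS ltac:(unfold R2; lra) (eps / 2) ltac:(lra)) as [N2 H2].
    exists (Nat.max N1 N2). intros N HN. specialize (H1 N ltac:(lia)). specialize (H2 N ltac:(lia)).
    rewrite (rsum_ext N _ (fun k => lsum (fun a => ln (Cabs (pt N r k - a)%X)) l + v (pt N r k))).
    2:{ intros k Hk. apply SPLIT; [unfold disk; rewrite Cabs_pt; lra | apply NW; apply Cabs_pt; lra]. }
    rewrite rsum_plus, lsum_rsum. rewrite lsum_minus, lsum_scal in H1. rewrite Rc0 in H2.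
    match goal with |- Rabs ?x <= _ => replace x with
      ((lsum (fun a => rsum N (fun k => ln (Cabs (pt N r k - a)%X))) l - INR N * lsum (fun a => ln (Rmax r (Cabs a))) l) +
       (rsum N (fun k => v (pt N r k)) - INR N * v0)) by ring end.
    eapply Rle_trans; [apply Rabs_triang|]. lra.
  - intros r Hr.
    replace (v0 + lsum (fun a => ln (Rmax R0 (Cabs a))) l - (v0 + lsum (fun a => ln (Rmax r (Cabs a))) l)) with
      (lsum (fun a => ln (Rmax R0 (Cabs a)) - ln (Rmax r (Cabs a))) l) by (rewrite lsum_minus; ring).
    assert (L0 : 0 <= ln (R0 / r)).
    { rewrite <- ln_1. apply ln_le; [lra|]. apply Rmult_le_reg_r with r; [lra|]. unfold Rdiv. rewrite Rmult_assoc, Rinv_l by lra. lra. }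
    (* Each zero contributes at most [ln (R0 / r)], and there are at most [q] of them: here the
       valence enters. *)
    apply Rle_trans with (INR (length l) * ln (R0 / r)).
    + apply lsum_le_const. intros a _.
      assert (M1 := Rmax_l r (Cabs a)). assert (M2 := Rmax_r r (Cabs a)).
      assert (RP : 0 < R0 / r) by (apply Rdiv_lt_0_compat; lra).
      assert (ln (Rmax R0 (Cabs a)) <= ln (R0 / r * Rmax r (Cabs a))).
      { apply ln_le; [eapply Rlt_le_trans; [|apply Rmax_l]; lra|].
        assert (1 <= R0 / r) by (apply Rmult_le_reg_r with r; [lra|]; unfold Rdiv; rewrite Rmult_assoc, Rinv_l by lra; lra).
        apply Rmax_lub; [|nra]. apply Rle_trans with (R0 / r * r); [apply Req_le; field; lra | nra]. }
      rewrite ln_mult in H0 by lra. lra.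
    + apply Rmult_le_compat_r; [exact L0 | now apply le_INR].
Qed.

Lemma rsum_block (n m : nat) (F : nat -> R) : rsum (n * m) F = rsum n (fun i => rsum m (fun j => F (i * m + j)%nat)).
Proof.
  induction n; [reflexivity|]. simpl rsum at 2. rewrite <- IHn.
  replace (S n * m)%nat with (n * m + m)%nat by lia. apply rsum_split.
Qed.

Lemma exists_between_avoiding (l : list R) (a b : R) : a < b -> exists x, a < x < b /\ ~ In x l.
Proof.
  intros H. assert (G : exists c d, a <= c < d /\ d <= b /\ forall x, In x l -> ~ c < x < d).
  { induction l as [|y l IH].
    - exists a, b. repeat split; try lra. intros x [].
    - destruct IH as (c & d & H1 & H2 & H3). destruct (Rlt_le_dec c y) as [Hy|Hy].
      + exists c, (Rmin y d). assert (M1 := Rmin_l y d). assert (M2 := Rmin_r y d). assert (M3 : c < Rmin y d) by (apply Rmin_glb_lt; lra).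
        repeat split; try lra. intros x [<- | Hx]; [lra|]. intros Q. apply (H3 x Hx). lra.
      + exists c, d. repeat split; try lra. intros x [<- | Hx]; [lra | auto]. }
  destruct G as (c & d & H1 & H2 & H3). exists ((c + d) / 2). split; [lra|]. intros X. apply (H3 _ X). lra.
Qed.

(** Division by [m] and [m] tending to infinity, in the form used to replace
    [ln |g ^ m - t ^ m| / m] by its limit. *)
Lemma le_of_scaled (A B c : R) : (forall m, (0 < m)%nat -> INR m * A <= INR m * B + c) -> A <= B.
Proof.
  intros H. destruct (Rle_lt_dec A B) as [|L]; [assumption|]. exfalso.
  destruct (INR_unbounded (c / (A - B))) as [m Hm].
  assert (Hm' : c < INR (S m) * (A - B)).
  { rewrite S_INR. apply (Rmult_gt_compat_r (A - B)) in Hm; [|lra].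
    replace (c / (A - B) * (A - B)) with c in Hm by (field; lra). nra. }
  specialize (H (S m) ltac:(lia)). nra.
Qed.

Lemma choice_nat {A : Type} (P : nat -> A -> Prop) : (forall i, exists y, P i y) -> exists f, forall i, P i (f i).
Proof.
  intros H. exists (fun i => proj1_sig (constructive_indefinite_description _ (H i))).
  intros i. apply (proj2_sig (constructive_indefinite_description _ (H i))).
Qed.

Lemma ln_Rmax (x t : R) : 0 < x -> 0 < t -> ln (Rmax x t) = Rmax (ln x) (ln t).
Proof.
  intros Hx Ht. destruct (Rle_dec x t).
  - rewrite !Rmax_right; auto. now apply ln_le.
  - rewrite !Rmax_left; auto; try lra. apply ln_le; lra.
Qed.

Lemma Rmax_lip (a b t : R) : Rmax a t - Rmax b t <= Rabs (a - b).
Proof.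
  assert (H := Rle_abs (a - b)). assert (H2 := Rabs_pos (a - b)).
  assert (M1 := Rmax_l b t). assert (M2 := Rmax_r b t).
  assert (Rmax a t <= Rmax b t + Rabs (a - b)) by (apply Rmax_lub; lra). lra.
Qed.

Lemma sum_ln_roots (m : nat) (x : Cplx) (t : R) :
  (0 < m)%nat -> (forall i, (i < m)%nat -> x <> (rootu m i * RtoC t)%X) ->
  (x ^ m - RtoC t ^ m)%X <> 0%X /\
  rsum m (fun i => ln (Cabs (x - rootu m i * RtoC t)%X)) = ln (Cabs (x ^ m - RtoC t ^ m)%X).
Proof.
  intros Hm H. rewrite <- cprod_rootu_sub by exact Hm.
  assert (N : forall k, (k < m)%nat -> (x - rootu m k * RtoC t)%X <> 0%X) by (intros; apply Csub_neq0; auto).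
  split; [now apply cprod_neq0 | now rewrite ln_Cabs_cprod].
Qed.

(** Each point of the finer grid is close to the coarse point that starts its block. The angular
    error is [O(1/n)], so its total over [n] points stays bounded. *)
Lemma pt_close (n m i j : nat) (r s : R) :
  (0 < n)%nat -> (j < m)%nat -> 0 <= s <= 1 -> Cabs (pt (n * m) r (i * m + j) - pt n s i)%X <= Rabs (r - s) + 4 * PI / INR n.
Proof.
  intros Hn Hj Hs. assert (PP := PI_RGT_0).
  assert (Hn' : 0 < INR n) by (apply lt_0_INR; lia). assert (Hm' : 0 < INR m) by (apply lt_0_INR; lia).
  assert (L := circ_lip r (2 * PI * INR (i * m + j) / INR (n * m)) s (2 * PI * INR i / INR n)).
  change (Cabs (pt (n * m) r (i * m + j) - pt n s i)%X <= Rabs (r - s) + Rabs s * (2 * Rabs (2 * PI * INR (i * m + j) / INR (n * m) - 2 * PI * INR i / INR n))) in L.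
  eapply Rle_trans; [exact L|]. apply Rplus_le_compat_l.
  rewrite plus_INR, !mult_INR.
  replace (2 * PI * (INR i * INR m + INR j) / (INR n * INR m) - 2 * PI * INR i / INR n) with (2 * PI / INR n * (INR j / INR m)) by (field; lra).
  assert (J : 0 <= INR j / INR m <= 1).
  { split; [apply Rmult_le_pos; [apply pos_INR | left; now apply Rinv_0_lt_compat]|].
    apply Rmult_le_reg_r with (INR m); [lra|]. unfold Rdiv. rewrite Rmult_assoc, Rinv_l by lra.
    rewrite Rmult_1_r, Rmult_1_l. apply le_INR. lia. }
  assert (P : 0 < 2 * PI / INR n) by (apply Rdiv_lt_0_compat; lra).
  rewrite (Rabs_pos_eq s), Rabs_pos_eq by nra.
  replace (4 * PI / INR n) with (1 * (2 * (2 * PI / INR n * 1))) by (field; lra).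
  apply Rmult_le_compat; nra.
Qed.

Definition lmax (t x : R) : R := ln (Rmax x t).

(* Jensen's formula for [g - w_i], where [w_i] runs over the [m]-th roots of [t ^ m]: the factors multiply to
   [g ^ m - t ^ m], and [ln |g ^ m - t ^ m| / m] tends to [lmax t |g|]. *)
Lemma circle_growth_generic (g : Cplx -> Cplx) (q : nat) (R1 R0 T : R) :
  holo_on (disk 1) g -> zerofree g -> valent q g -> 0 < R1 < R0 -> R0 < 1 -> 0 < T ->
  exists C th L, 0 <= th < 1 /\ 0 <= L /\ forall n t, (0 < n)%nat -> 0 < t <= T -> t <> Cabs (g 0%X) ->
    (forall k, (k < n)%nat -> t <> Cabs (g (pt n R0 k))) ->
    rsum n (fun k => lmax t (Cabs (g (pt n R0 k)))) <= rsum n (fun k => lmax t (Cabs (g (pt n R1 k)))) +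
      (INR n * (INR q * ln (R0 / R1)) + INR n * (2 * (th ^ n / (1 - th)) * (C - ln (Cabs (g 0%X)))) + (L * (4 * PI) + INR q * ln 2)).
Proof.
  intros Hg Zg HV HR1 HR0 HT.
  destruct (jensen_values g q R0 T Hg HV) as (C & th & Hth & HJ); [lra | exact HT|].
  destruct (ln_Cabs_lipschitz g R0 Hg Zg) as [L [L0 HL]]; [lra|].
  exists C, th, L. split; [exact Hth|]. split; [exact L0|]. intros n t Hn Ht Ht0 Htk.
  assert (Hn' : 0 < INR n) by (apply lt_0_INR; lia).
  assert (At : Cabs (RtoC t) = t) by (rewrite Cabs_RtoC, Rabs_pos_eq; lra).
  set (kap := th ^ n / (1 - th)).
  assert (K0 : 0 <= kap) by (apply Rmult_le_pos; [apply pow_le; lra | left; apply Rinv_0_lt_compat; lra]).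
  assert (D0 : disk 1 0%X) by (unfold disk; rewrite Cabs_0; lra).
  assert (G0 := Cabs_pos _ (Zg _ D0)).
  (* These constants depend on [n] and [t] but not on [m], so they vanish in the limit over [m]. *)
  assert (LOW : forall k, exists c, (k < n)%nat -> forall m, (0 < m)%nat ->
     INR m * lmax t (Cabs (g (pt n R0 k))) - c <= ln (Cabs (g (pt n R0 k) ^ m - RtoC t ^ m)%X)).
  { intros k. destruct (le_lt_dec n k) as [|Hk]; [exists 0; lia|].
    destruct (ln_diff_pow_ge (g (pt n R0 k)) (RtoC t)) as [c [_ Hc]]; [rewrite At; intros E; apply (Htk k Hk); auto|].
    exists c. intros _ m Hm. destruct (Hc m Hm) as [_ H]. rewrite At in H. exact H. }
  destruct (choice_nat _ LOW) as [cc Hcc].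
  destruct (ln_diff_pow_ge (g 0%X) (RtoC t)) as [c0 [_ Hc0]]; [rewrite At; auto|].
  apply le_epsilon. intros eps He.
  (* Three errors of size [eta] per point are to be absorbed: [L] times the change of radius from
     [R1] to [r], the limit along the circle of radius [r], and [INR q] times the change of
     [ln (R0 / R1)]. *)
  set (eta := Rmin (1 / 2) (eps / (INR n * (L + 1 + INR q)))).
  assert (Q0 := pos_INR q).
  assert (HD : 0 < INR n * (L + 1 + INR q)) by (apply Rmult_lt_0_compat; lra).
  assert (Heta : 0 < eta) by (apply Rmin_pos; [lra | now apply Rdiv_lt_0_compat]).
  assert (Heta2 : INR n * (L + 1 + INR q) * eta <= eps).
  { apply Rle_trans with (INR n * (L + 1 + INR q) * (eps / (INR n * (L + 1 + INR q)))).
    - apply Rmult_le_compat_l; [lra | apply Rmin_r].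
    - apply Req_le. field. lra. }
  (* The three terms are everything that does not grow with [m]. *)
  apply le_of_scaled with (rsum n cc + INR n * ln 2 + INR n * (2 * kap * c0)).
  intros m Hm. assert (Hm' : 0 < INR m) by (apply lt_0_INR; lia).
  set (w := fun i => (rootu m i * RtoC t)%X).
  assert (Aw : forall i, Cabs (w i) = t) by (intros; unfold w; rewrite Cabs_mul, Cabs_rootu, At; ring).
  assert (HJW : forall i, exists Jb : (R -> R) * list R,
    (forall n, (0 < n)%nat -> (forall k, (k < n)%nat -> g (pt n R0 k) <> w i) ->
       rsum n (fun k => ln (Cabs (g (pt n R0 k) - w i)%X)) <=
       INR n * (fst Jb R0 + 2 * (th ^ n / (1 - th)) * (C - ln (Cabs (g 0%X - w i)%X))) + INR q * ln 2) /\
    (forall r, 0 < r < R0 -> ~ In r (snd Jb) -> (forall z, Cabs z = r -> g z <> w i) /\ forall eps, 0 < eps -> exists N0, forall N, (N0 <= N)%nat ->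
       Rabs (rsum N (fun k => ln (Cabs (g (pt N r k) - w i)%X)) - INR N * fst Jb r) <= INR N * eps) /\
    (forall r, 0 < r <= R0 -> fst Jb R0 - fst Jb r <= INR q * ln (R0 / r))).
  { intros i. destruct (HJ (w i)) as (J & bad & H).
    - rewrite Aw. lra.
    - intros X. apply Ht0. rewrite X, Aw. reflexivity.
    - exists (J, bad). exact H. }
  destruct (choice_nat _ HJW) as [Jb HJb]. set (J := fun i => fst (Jb i)).
  assert (He1 : R1 * exp (- eta) < R1).
  { assert (exp (- eta) < exp 0) by (apply exp_increasing; lra). rewrite exp_0 in *. nra. }
  (* One radius just below [R1] must be free of zeros for all [m] functions [g - w i], which
     excludes only finitely many values. *)
  destruct (exists_between_avoiding (concat (map (fun i => snd (Jb i)) (seq 0 m))) _ _ He1) as (r & Hr & Hbad).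
  assert (Hexp := exp_pos (- eta)).
  assert (Hr0 : 0 < r) by nra.
  assert (Hri : forall i, (i < m)%nat -> ~ In r (snd (Jb i))).
  { intros i Hi X. apply Hbad. apply in_concat. exists (snd (Jb i)). split; [|exact X].
    apply in_map_iff. exists i. split; [reflexivity | apply in_seq; lia]. }
  assert (Hlr : ln (R0 / r) <= ln (R0 / R1) + eta).
  { replace eta with (ln (exp eta)) by apply ln_exp.
    assert (0 < R0 / R1) by (apply Rdiv_lt_0_compat; lra).
    rewrite <- ln_mult by (auto using exp_pos).
    apply ln_le; [apply Rdiv_lt_0_compat; lra|].
    apply Rmult_le_reg_r with (r * R1); [nra|].
    replace (R0 / r * (r * R1)) with (R0 * R1) by (field; lra).
    replace (R0 / R1 * exp eta * (r * R1)) with (R0 * (r * exp eta)) by (field; lra).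
    apply Rmult_le_compat_l; [lra|]. destruct Hr as [Hr _].
    assert (EE : exp (- eta) * exp eta = 1) by (rewrite <- exp_plus, Rplus_opp_l; apply exp_0).
    nra. }
  assert (Hrr : Rabs (r - R1) <= eta).
  { rewrite Rabs_left by lra. assert (1 + - eta <= exp (- eta)) by apply exp_ineq1_le. nra. }
  destruct (uniform_threshold (seq 0 m) (fun i N => Rabs (rsum N (fun k => ln (Cabs (g (pt N r k) - w i)%X)) - INR N * J i r) <= INR N * eta)) as [N0 HN0].
  { intros i Hi. apply in_seq in Hi. apply (HJb i); [lra | apply Hri; lia | exact Heta]. }
  (* A multiple of [n] beyond the common threshold: the limits on [|z| = r] need many points, and
     the blocks of [N1] of them lead back to the [n] given ones. *)
  set (N1 := S N0). set (N := (n * N1)%nat).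
  assert (HN1 : 0 < INR N1) by (apply lt_0_INR; unfold N1; lia).
  assert (EN : INR N = INR n * INR N1) by apply mult_INR.
  assert (S1 : rsum n (fun k => ln (Cabs (g (pt n R0 k) ^ m - RtoC t ^ m)%X)) <=
    INR n * rsum m (fun i => J i R0) + INR n * (2 * kap * (INR m * C - ln (Cabs (g 0%X ^ m - RtoC t ^ m)%X))) + INR m * (INR q * ln 2)).
  { rewrite (rsum_ext n _ (fun k => rsum m (fun i => ln (Cabs (g (pt n R0 k) - w i)%X)))).
    2:{ intros k Hk. symmetry. apply sum_ln_roots; [exact Hm|]. intros i _ X. apply (Htk k Hk). rewrite X.
        fold (w i). rewrite Aw. reflexivity. }
    rewrite rsum_swap.
    rewrite <- (proj2 (sum_ln_roots m (g 0%X) t Hm ltac:(intros i _ X; apply Ht0; rewrite X; fold (w i); rewrite Aw; reflexivity))).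
    apply Rle_trans with (rsum m (fun i => INR n * (J i R0 + 2 * kap * (C - ln (Cabs (g 0%X - w i)%X))) + INR q * ln 2)).
    - apply rsum_le. intros i Hi. apply HJb; [exact Hn|]. intros k Hk X. apply (Htk k Hk). rewrite X, Aw. reflexivity.
    - apply Req_le. rewrite rsum_plus, rsum_scal, rsum_plus, rsum_scal, rsum_minus, !rsum_const. unfold w. ring. }
  assert (S2 : rsum m (fun i => J i R0) <= rsum m (fun i => J i r) + INR m * (INR q * ln (R0 / r))).
  { rewrite <- rsum_const, <- rsum_plus. apply rsum_le. intros i Hi.
    assert (X := proj2 (proj2 (HJb i)) r ltac:(lra)). unfold J. lra. }
  assert (DP : forall k, Cabs (pt N r k) = r) by (intros; apply Cabs_pt; lra).
  assert (S3 : INR N * rsum m (fun i => J i r) <= rsum N (fun k => INR m * lmax t (Cabs (g (pt N r k))) + ln 2) + INR N * (INR m * eta)).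
  { rewrite <- rsum_scal.
    apply Rle_trans with (rsum m (fun i => rsum N (fun k => ln (Cabs (g (pt N r k) - w i)%X)) + INR N * eta)).
    - apply rsum_le. intros i Hi. assert (X := HN0 i ltac:(apply in_seq; lia) N ltac:(unfold N, N1; nia)).
      apply Rabs_le_between in X. lra.
    - rewrite rsum_plus, rsum_const, rsum_swap.
      apply Rplus_le_compat; [|apply Req_le; ring]. apply rsum_le. intros k Hk.
      assert (NW : forall i, (i < m)%nat -> g (pt N r k) <> w i).
      { intros i Hi. apply (proj1 (proj2 (HJb i))  r ltac:(lra) (Hri i Hi)). apply DP. }
      destruct (sum_ln_roots m (g (pt N r k)) t Hm NW) as [NZ EQ].
      unfold w. rewrite EQ. unfold lmax.
      assert (Y := ln_diff_pow_le (g (pt N r k)) (RtoC t) m NZ). rewrite At in Y.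
      specialize (Y ltac:(apply Cabs_pos, Zg; unfold disk; rewrite DP; lra)). lra. }
  (* Back to [n] points on the circle of radius [R1], by the Lipschitz bound for [ln |g|];
     truncation does not increase differences. *)
  assert (S4 : rsum N (fun k => lmax t (Cabs (g (pt N r k)))) <=
     INR N1 * (rsum n (fun k => lmax t (Cabs (g (pt n R1 k)))) + INR n * (L * (eta + 4 * PI / INR n)))).
  { unfold N. rewrite rsum_block.
    apply Rle_trans with (rsum n (fun i => INR N1 * (lmax t (Cabs (g (pt n R1 i))) + L * (eta + 4 * PI / INR n)))).
    - apply rsum_le. intros i Hi. apply rsum_le_const. intros j Hj.
      assert (P1 : 0 < Cabs (g (pt (n * N1) r (i * N1 + j)))) by (apply Cabs_pos, Zg; unfold disk; rewrite Cabs_pt; lra).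
      assert (P2 : 0 < Cabs (g (pt n R1 i))) by (apply Cabs_pos, Zg; unfold disk; rewrite Cabs_pt; lra).
      unfold lmax. rewrite !ln_Rmax by lra.
      assert (X := Rmax_lip (ln (Cabs (g (pt (n * N1) r (i * N1 + j))))) (ln (Cabs (g (pt n R1 i)))) (ln t)).
      assert (Y := HL (pt (n * N1) r (i * N1 + j)) (pt n R1 i)). rewrite !Cabs_pt in Y by lra. specialize (Y ltac:(lra) ltac:(lra)).
      assert (Z := pt_close n N1 i j r R1 Hn Hj ltac:(lra)).
      assert (L * Cabs (pt (n * N1) r (i * N1 + j) - pt n R1 i)%X <= L * (eta + 4 * PI / INR n)) by (apply Rmult_le_compat_l; lra).
      lra.
    - apply Req_le. rewrite rsum_scal, rsum_plus, rsum_const. ring. }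
  assert (S5 : INR m * rsum n (fun k => lmax t (Cabs (g (pt n R0 k)))) - rsum n cc <= rsum n (fun k => ln (Cabs (g (pt n R0 k) ^ m - RtoC t ^ m)%X))).
  { rewrite <- rsum_scal, <- rsum_minus. apply rsum_le. intros k Hk. now apply Hcc. }
  assert (S6 : INR m * ln (Cabs (g 0%X)) - c0 <= ln (Cabs (g 0%X ^ m - RtoC t ^ m)%X)).
  { destruct (Hc0 m Hm) as [_ X]. eapply Rle_trans; [|exact X]. apply Rplus_le_compat_r.
    apply Rmult_le_compat_l; [lra|]. apply ln_le; [exact G0 | apply Rmax_l]. }
  rewrite rsum_plus, rsum_scal, rsum_const in S3.
  assert (S7 : INR n * rsum m (fun i => J i r) <= INR m * (rsum n (fun k => lmax t (Cabs (g (pt n R1 k)))) + INR n * (L * (eta + 4 * PI / INR n))) + INR n * ln 2 + INR n * (INR m * eta)).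
  { apply Rmult_le_reg_l with (INR N1); [exact HN1|].
    rewrite EN in S3.
    assert (INR m * rsum N (fun k => lmax t (Cabs (g (pt N r k)))) <= INR m * (INR N1 * (rsum n (fun k => lmax t (Cabs (g (pt n R1 k)))) + INR n * (L * (eta + 4 * PI / INR n))))) by (apply Rmult_le_compat_l; lra).
    lra. }
  assert (S8 : INR n * (2 * kap * (INR m * C - ln (Cabs (g 0%X ^ m - RtoC t ^ m)%X))) <= INR n * (2 * kap * (INR m * C - (INR m * ln (Cabs (g 0%X)) - c0)))).
  { apply Rmult_le_compat_l; [lra|]. apply Rmult_le_compat_l; lra. }
  assert (S9 : INR n * (INR m * (INR q * ln (R0 / r))) <= INR n * (INR m * (INR q * (ln (R0 / R1) + eta)))).
  { apply Rmult_le_compat_l; [lra|]. apply Rmult_le_compat_l; [lra|]. apply Rmult_le_compat_l; lra. }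
  assert (S10 : INR n * rsum m (fun i => J i R0) <= INR n * (rsum m (fun i => J i r) + INR m * (INR q * ln (R0 / r)))) by (apply Rmult_le_compat_l; lra).
  assert (S11 : INR m * (INR n * (L + 1 + INR q) * eta) <= INR m * eps) by (apply Rmult_le_compat_l; lra).
  assert (E12 : INR n * (L * (eta + 4 * PI / INR n)) = INR n * (L * eta) + L * (4 * PI)) by (field; lra).
  rewrite E12 in S7. fold kap. lra.
Qed.

(** The threshold [n0] must serve all [t], since majorization compares all levels at one [n]. Above
    a bound of [|g|] both sides have the same sum [n * ln t]; below it an exceptional [t] is
    replaced by a generic [s] between [t * exp (- (eps / 3))] and [t]. *)
Lemma circle_growth (g : Cplx -> Cplx) (q : nat) (R1 R0 : R) :
  holo_on (disk 1) g -> zerofree g -> valent q g -> 0 < R1 < R0 -> R0 < 1 ->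
  forall eps, 0 < eps -> exists n0, forall n, (n0 <= n)%nat -> forall t, 0 < t ->
    rsum n (fun k => lmax t (Cabs (g (pt n R0 k)))) <= rsum n (fun k => lmax t (Cabs (g (pt n R1 k)))) +
      INR n * (INR q * ln (R0 / R1) + eps).
Proof.
  intros Hg Zg HV HR1 HR0 eps He.
  destruct (holo_bounded_disk g R0 Hg) as [T [T0 HT]]; [lra|].
  destruct (circle_growth_generic g q R1 R0 T Hg Zg HV HR1 HR0 T0) as (C & th & L & Hth & L0 & H).
  destruct (geometric_small th (2 * (C - ln (Cabs (g 0%X))) / (1 - th)) (eps / 3)) as [D HD]; [exact Hth | lra|].
  set (B := L * (4 * PI) + INR q * ln 2) in *.
  destruct (INR_unbounded (B / (eps / 3))) as [D2 HD2].
  exists (D + D2 + 1)%nat. intros n Hn t Ht.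
  assert (Hn' : 0 < INR n) by (apply lt_0_INR; lia).
  assert (LQ : 0 <= INR q * ln (R0 / R1)).
  { apply Rmult_le_pos; [apply pos_INR|]. rewrite <- ln_1. apply ln_le; [lra|].
    apply Rmult_le_reg_r with R1; [lra|]. unfold Rdiv. rewrite Rmult_assoc, Rinv_l by lra. lra. }
  destruct (Rle_lt_dec t T) as [HtT | HtT].
  2:{ rewrite (rsum_ext n (fun k => lmax t (Cabs (g (pt n R0 k)))) (fun _ => ln t)).
      2:{ intros k _. unfold lmax. f_equal. apply Rmax_right. specialize (HT (pt n R0 k)). rewrite Cabs_pt in HT by lra. lra. }
      rewrite (rsum_ext n (fun k => lmax t (Cabs (g (pt n R1 k)))) (fun _ => ln t)).
      2:{ intros k _. unfold lmax. f_equal. apply Rmax_right. specialize (HT (pt n R1 k)). rewrite Cabs_pt in HT by lra. lra. }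
      assert (0 <= INR n * (INR q * ln (R0 / R1) + eps)) by (apply Rmult_le_pos; lra). lra. }
  assert (ET : t * exp (- (eps / 3)) < t).
  { assert (exp (- (eps / 3)) < exp 0) by (apply exp_increasing; lra). rewrite exp_0 in *. nra. }
  destruct (exists_between_avoiding (Cabs (g 0%X) :: map (fun k => Cabs (g (pt n R0 k))) (seq 0 n)) _ _ ET) as (s & Hs & Hav).
  assert (EP := exp_pos (- (eps / 3))).
  assert (Hs0 : 0 < s) by nra.
  specialize (H n s ltac:(lia) ltac:(lra)).
  specialize (H ltac:(intros X; apply Hav; left; auto)).
  assert (H' := H ltac:(intros k Hk X; apply Hav; right; apply in_map_iff; exists k; split; [auto | apply in_seq; lia])).
  assert (LT : ln t <= ln s + eps / 3).
  { replace (eps / 3) with (ln (exp (eps / 3))) by apply ln_exp. rewrite <- ln_mult by (auto using exp_pos).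
    apply ln_le; [exact Ht|].
    assert (EE : exp (- (eps / 3)) * exp (eps / 3) = 1) by (rewrite <- exp_plus, Rplus_opp_l; apply exp_0).
    nra. }
  assert (PG : forall r k, 0 < r < 1 -> 0 < Cabs (g (pt n r k))) by (intros; apply Cabs_pos, Zg; unfold disk; rewrite Cabs_pt; lra).
  assert (U1 : rsum n (fun k => lmax t (Cabs (g (pt n R0 k)))) <= rsum n (fun k => lmax s (Cabs (g (pt n R0 k)))) + INR n * (eps / 3)).
  { rewrite <- rsum_const, <- rsum_plus. apply rsum_le. intros k _. unfold lmax. specialize (PG R0 k ltac:(lra)).
    rewrite !ln_Rmax by lra. assert (M1 := Rmax_l (ln (Cabs (g (pt n R0 k)))) (ln s)). assert (M2 := Rmax_r (ln (Cabs (g (pt n R0 k)))) (ln s)).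
    apply Rmax_lub; lra. }
  assert (U2 : rsum n (fun k => lmax s (Cabs (g (pt n R1 k)))) <= rsum n (fun k => lmax t (Cabs (g (pt n R1 k))))).
  { apply rsum_le. intros k _. specialize (PG R1 k ltac:(lra)). apply ln_le.
    - eapply Rlt_le_trans; [exact PG | apply Rmax_l].
    - apply Rle_max_compat_l. lra. }
  specialize (HD n ltac:(lia)).
  assert (U3 : INR n * (2 * (th ^ n / (1 - th)) * (C - ln (Cabs (g 0%X)))) <= INR n * (eps / 3)).
  { apply Rmult_le_compat_l; [lra|]. eapply Rle_trans; [|exact HD]. apply Req_le. field. lra. }
  assert (U4 : B <= INR n * (eps / 3)).
  { assert (INR D2 <= INR n) by (apply le_INR; lia).
    apply Rmult_le_reg_r with (/ (eps / 3)); [apply Rinv_0_lt_compat; lra|].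
    replace (INR n * (eps / 3) * / (eps / 3)) with (INR n) by (field; lra). lra. }
  clear - U1 U2 U3 U4 H'. lra.
Qed.

(** * The Poisson kernel *)

Definition pois (r c : R) : R := (1 - r * r) / (1 - 2 * r * c + r * r).

Lemma pois_den_pos (r c : R) : 0 <= r < 1 -> -1 <= c <= 1 -> 0 < 1 - 2 * r * c + r * r.
Proof. intros Hr Hc. nra. Qed.

(** The kernel increases with the cosine, so all comparisons of its values reduce to trigonometric
    identities. *)
Lemma pois_diff (r c c' : R) : 0 <= r < 1 -> -1 <= c <= 1 -> -1 <= c' <= 1 ->
  exists K, 0 <= K /\ (0 < r -> 0 < K) /\ pois r c - pois r c' = K * (c - c').
Proof.
  intros Hr Hc Hc'. assert (D := pois_den_pos r c Hr Hc). assert (D' := pois_den_pos r c' Hr Hc').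
  exists (2 * r * (1 - r * r) / ((1 - 2 * r * c + r * r) * (1 - 2 * r * c' + r * r))).
  assert (P : 0 < / ((1 - 2 * r * c + r * r) * (1 - 2 * r * c' + r * r))) by (apply Rinv_0_lt_compat; nra).
  split; [|split].
  - apply Rmult_le_pos; [nra | lra].
  - intros H. apply Rmult_lt_0_compat; [|exact P]. apply Rmult_lt_0_compat; nra.
  - unfold pois. field. lra.
Qed.

Lemma cos_reflect (X S : R) : cos X - cos (S - X) = - (2 * sin (S / 2) * sin (X - S / 2)).
Proof.
  rewrite form2. replace ((X + (S - X)) / 2) with (S / 2) by field. replace ((X - (S - X)) / 2) with (X - S / 2) by field. ring.
Qed.

(** By the sum-to-product formulas each of the three differences is a multiple of two of the sines
    [a], [b], [c], and each sine occurs in two of them: the product is a square times nonnegative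
    factors. *)
Lemma pois_reflect_sign (r rho X Y S : R) : 0 <= r < 1 -> 0 <= rho < 1 ->
  0 <= (pois r (cos (X - Y)) - pois r (cos (X + Y - S))) *
       ((pois rho (cos X) - pois rho (cos (S - X))) * (pois rho (cos Y) - pois rho (cos (S - Y)))).
Proof.
  intros Hr Hrho.
  destruct (pois_diff r (cos (X - Y)) (cos (X + Y - S)) Hr (COS_bound _) (COS_bound _)) as (K1 & P1 & _ & ->).
  destruct (pois_diff rho (cos X) (cos (S - X)) Hrho (COS_bound _) (COS_bound _)) as (K2 & P2 & _ & ->).
  destruct (pois_diff rho (cos Y) (cos (S - Y)) Hrho (COS_bound _) (COS_bound _)) as (K3 & P3 & _ & ->).
  rewrite !cos_reflect.
  assert (E : cos (X - Y) - cos (X + Y - S) = 2 * sin (X - S / 2) * sin (Y - S / 2)).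
  { rewrite form2. replace ((X - Y + (X + Y - S)) / 2) with (X - S / 2) by field.
    replace ((X - Y - (X + Y - S)) / 2) with (- (Y - S / 2)) by field. rewrite sin_neg. ring. }
  rewrite E. set (a := sin (X - S / 2)). set (b := sin (Y - S / 2)). set (c := sin (S / 2)).
  replace (K1 * (2 * a * b) * (K2 * - (2 * c * a) * (K3 * - (2 * c * b)))) with
    (8 * (K1 * K2 * K3) * ((a * b * c) * (a * b * c))) by ring.
  assert (0 <= (a * b * c) * (a * b * c)) by apply Rle_0_sqr.
  assert (0 <= K1 * K2 * K3) by (repeat apply Rmult_le_pos; lra). nra.
Qed.

(** The difference of the two values contains [sin (S / 2) * sin (X - S / 2)]. The first factor
    decides invariance under the reflection, the second vanishes only at its fixed points. *)
Lemma pois_reflect_fix (rho S : R) : 0 < rho < 1 ->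
  (forall X, pois rho (cos (S - X)) = pois rho (cos X)) \/
  (forall X, pois rho (cos (S - X)) = pois rho (cos X) -> cis (S - X) = cis X).
Proof.
  intros Hrho. destruct (Req_dec (sin (S / 2)) 0) as [Z|Z].
  - left. intros X. f_equal. assert (H := cos_reflect X S). rewrite Z in H. lra.
  - right. intros X E.
    destruct (pois_diff rho (cos X) (cos (S - X)) ltac:(lra) (COS_bound _) (COS_bound _)) as (K & _ & PK & EK).
    specialize (PK ltac:(lra)). rewrite E in EK. rewrite cos_reflect in EK.
    assert (Z2 : sin (X - S / 2) = 0).
    { assert (F : K * (sin (S / 2) * sin (X - S / 2)) = 0) by lra.
      apply Rmult_integral in F. destruct F as [F|F]; [lra|]. apply Rmult_integral in F. destruct F; [contradiction | assumption]. }
    replace (S - X) with (X + - (2 * (X - S / 2))) by field. rewrite cis_add.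
    replace (cis (- (2 * (X - S / 2)))) with 1%X; [ring|].
    apply Ceq; simpl; [rewrite cos_neg, cos_2a_sin, Z2; ring | rewrite sin_neg, sin_2a, Z2; ring].
Qed.

Definition ang (n k : nat) : R := 2 * PI * INR k / INR n.

Lemma cis_ang_mod (n a q b : nat) : (0 < n)%nat -> a = (q * n + b)%nat -> cis (ang n a) = cis (ang n b).
Proof.
  intros Hn ->. unfold ang. rewrite plus_INR, mult_INR. assert (0 < INR n) by (apply lt_0_INR; lia).
  replace (2 * PI * (INR q * INR n + INR b) / INR n) with (2 * PI * INR q + 2 * PI * INR b / INR n) by (field; lra).
  rewrite cis_add, cis_2PI_nat. ring.
Qed.

Lemma cis_ang_add (n a b : nat) : cis (ang n (a + b)) = (cis (ang n a) * cis (ang n b))%X.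
Proof. rewrite <- cis_add. f_equal. unfold ang. rewrite plus_INR. unfold Rdiv; ring. Qed.

Lemma cis_ang_inj (n a b : nat) : (a < n)%nat -> (b < n)%nat -> cis (ang n a) = cis (ang n b) -> a = b.
Proof.
  assert (W : forall a b, (a < b)%nat -> (b < n)%nat -> cis (ang n a) <> cis (ang n b)).
  { clear a b. intros a b Hab Hb E. assert (PP := PI_RGT_0).
    apply (cis_neq1 (ang n (b - a))).
    - unfold ang. assert (0 < INR (b - a)) by (apply lt_0_INR; lia). assert (INR (b - a) < INR n) by (apply lt_INR; lia).
      split; [apply Rdiv_lt_0_compat; nra|]. apply Rmult_lt_reg_r with (INR n); [lra|]. unfold Rdiv. rewrite Rmult_assoc, Rinv_l by lra. nra.
    - assert (E2 := cis_ang_add n a (b - a)). replace (a + (b - a))%nat with b in E2 by lia.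
      rewrite <- E in E2. assert (N := cis_neq0 (ang n a)).
      replace (cis (ang n (b - a))) with (cis (ang n a) * cis (ang n (b - a)) / cis (ang n a))%X by (field; exact N).
      rewrite <- E2. field. exact N. }
  intros Ha Hb E. destruct (Nat.lt_trichotomy a b) as [L | [L | L]]; [|assumption|].
  - exfalso. exact (W a b L Hb E).
  - exfalso. exact (W b a L Ha (eq_sym E)).
Qed.

(** * Transfer of the rearrangement inequalities to roots of unity *)

Module Circle.
Import all_boot all_order all_algebra all_fingroup Rstruct Defs Reals Rearrangement.
Set Implicit Arguments. Unset Strict Implicit. Unset Printing Implicit Defensive.
Import Order.TTheory GRing.Theory Num.Theory.
Local Open Scope ring_scope.

(** The bound is [n.+1] because ['I_n.+1] carries the group structure of the integers modulo [n.+1],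
    on which [x -> s - x] acts as a reflection of the circle. *)
Definition pm (n : nat) (tau : nat -> nat) : Prop :=
  exists sg : {perm 'I_n.+1}, forall i : 'I_n.+1, tau i = sg i :> nat.

Lemma rsumE (n : nat) (f : nat -> R) : rsum n f = \sum_(i < n) f i.
Proof. by elim: n => [|n IH]; rewrite ?big_ord0 // big_ord_recr /= -IH. Qed.

Section Circle.
Variable n : nat.
Local Notation X := 'I_n.+1.

Definition an (x : X) : R := ang n.+1 x.

Lemma cis_an_add (x y : X) : cis (an (x + y)) = Cmul (cis (an x)) (cis (an y)).
Proof.
rewrite -cis_ang_add; symmetry; apply: (@cis_ang_mod n.+1 (addn x y) (divn (addn x y) n.+1)).
  exact: PeanoNat.Nat.lt_0_succ.
exact: divn_eq.
Qed.

Lemma cis_an_opp (x : X) : cis (an (- x)) = cis (Ropp (an x)).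
Proof.
have H : Cmul (cis (an (- x))) (cis (an x)) = RtoC R1.
  by rewrite -cis_an_add addNr /an /ang /= /Rdiv Rmult_0_r Rmult_0_l cis_0.
have H2 : Cmul (cis (Ropp (an x))) (cis (an x)) = RtoC R1 by rewrite -cis_add Rplus_opp_l cis_0.
have N := cis_neq0 (an x).
have D a : a = Cmul (Cmul a (cis (an x))) (Cinv (cis (an x))).
  by rewrite -[LHS](_ : Cmul a (Cmul (cis (an x)) (Cinv (cis (an x)))) = a); [ring | field].
by rewrite (D (cis (an (- x)))) H -H2 -D.
Qed.

Lemma cis_an_sub (x y : X) : cis (an (x - y)) = cis (Rminus (an x) (an y)).
Proof. by rewrite cis_an_add cis_an_opp -cis_add. Qed.

(** Reindexing by the inverse of [sg'] moves the permutation from [b] to the kernel. The inner sum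
    then is a convolution of two Poisson kernels, evaluated at a permuted angle. *)
Lemma riesz_circle (r rho : R) (tau : nat -> nat) (b : nat -> R) :
  Rle R0 r /\ Rlt r R1 -> Rlt R0 rho /\ Rlt rho R1 -> pm n tau -> exists tau', pm n tau' /\
  Rle (rsum n.+1 (fun i => rsum n.+1 (fun j => Rmult (Rmult (pois rho (cos (ang n.+1 (tau i)))) (b j)) (pois r (cos (Rminus (ang n.+1 i) (ang n.+1 j)))))))
      (rsum n.+1 (fun j => Rmult (b j) (rsum n.+1 (fun i => Rmult (pois rho (cos (ang n.+1 i))) (pois r (cos (Rminus (ang n.+1 i) (ang n.+1 (tau' j))))))))).
Proof.
move=> Hr Hrho [sg Hsg].
pose k (x : X) : R := pois r (cos (an x)).
pose phi (x : X) : R := pois rho (cos (an x)).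
have cosS x y : cos (an (x - y)) = cos (Rminus (an x) (an y)) by have := f_equal Defs.Re (cis_an_sub x y).
have k_even x : k (- x) = k x by rewrite /k; have /= -> := f_equal Defs.Re (cis_an_opp x); rewrite cos_neg.
have Hrho' : Rle R0 rho /\ Rlt rho R1 by case: Hrho => h1 h2; split => //; left.
have k_sign (s x y : X) : 0 <= (k (x - y) - k (x + y - s)) * ((phi x - phi (s - x)) * (phi y - phi (s - y))).
  apply/RleP; have := @pois_reflect_sign r rho (an x) (an y) (an s) Hr Hrho'.
  rewrite /k /phi !cosS.
  suff -> : cos (Rminus (an (x + y)) (an s)) = cos (Rminus (Rplus (an x) (an y)) (an s)) by [].
  have A : cis (Rminus (an (x + y)) (an s)) = cis (Rminus (Rplus (an x) (an y)) (an s)).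
    by rewrite /Rminus !cis_add cis_an_add.
  exact (f_equal Defs.Re A).
have phi_fix s : (forall x, phi (s - x) = phi x) \/ (forall x, phi (s - x) = phi x -> s - x = x).
  have [H|H] := @pois_reflect_fix rho (an s) Hrho; [left|right] => x; rewrite /phi cosS; first exact: H.
  move=> /H E; apply: val_inj; apply: (@cis_ang_inj n.+1); try by apply/ssrnat.ltP; apply: ltn_ord.
  by have := cis_an_sub s x; rewrite E.
have [sg' H] := riesz_rearrangement k_even k_sign phi_fix (fun x : X => b x) sg.
exists (fun i => if insub i is Some x then (sg'^-1)%g x : nat else i); split.
  by exists (sg'^-1)%g => i; rewrite valK.
move/RleP: H.
have -> : conv k (phi \o sg) (fun x : X => b x) =
  rsum n.+1 (fun i => rsum n.+1 (fun j => Rmult (Rmult (pois rho (cos (ang n.+1 (tau i)))) (b j)) (pois r (cos (Rminus (ang n.+1 i) (ang n.+1 j)))))).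
  rewrite rsumE; apply: eq_bigr => x _; rewrite rsumE; apply: eq_bigr => y _ /=.
  by rewrite /k /phi cosS /an Hsg.
suff -> : conv k phi ((fun x : X => b x) \o sg') =
  rsum n.+1 (fun j => Rmult (b j) (rsum n.+1 (fun i => Rmult (pois rho (cos (ang n.+1 i))) (pois r (cos (Rminus (ang n.+1 i)
     (ang n.+1 (if insub j is Some x then (sg'^-1)%g x : nat else j)))))))) by [].
rewrite /conv exchange_big rsumE [LHS](reindex_inj (@perm_inj _ (sg'^-1)%g)); apply: eq_bigr => y _.
rewrite valK rsumE RmultE mulr_sumr; apply: eq_bigr => x _.
by rewrite /= permKV /k /phi cosS /an RmultE mulrA [b y * _]mulrC.
Qed.

Lemma majorization_rsum (phi U U' : nat -> R) (lo hi eta : R) (tau : nat -> nat) :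
  (forall i, Rle lo (phi i)) -> (forall i, Rle (phi i) hi) -> Rle R0 eta ->
  (forall t, Rle (rsum n.+1 (fun i => Rmax (U i) t)) (Rplus (rsum n.+1 (fun i => Rmax (U' i) t)) eta)) ->
  pm n tau -> exists tau', pm n tau' /\
  Rle (rsum n.+1 (fun i => Rmult (phi (tau i)) (U i)))
      (Rplus (Rplus (rsum n.+1 (fun i => Rmult (phi (tau' i)) (U' i))) (Rmult (Rminus hi lo) eta)) (Rmult lo (Rminus (rsum n.+1 U) (rsum n.+1 U')))).
Proof.
move=> hlo hhi eta0 H [sg Hsg].
have H' t : \sum_(x : X) Num.max (U x) t <= \sum_(x : X) Num.max (U' x) t + eta.
  apply/RleP; have := H t; rewrite !rsumE => H1.
  suff E (V : nat -> R) : \sum_(x : X) Num.max (V x) t = \sum_(x : X) Rmax (V x) t by rewrite !E.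
  by apply: eq_bigr => x _; rewrite RmaxE.
have lohi : lo <= hi by apply/RleP; apply: Rle_trans (hlo O) (hhi O).
have h1 (x : X) : lo <= phi x by apply/RleP.
have h2 (x : X) : phi x <= hi by apply/RleP.
have e0 : 0 <= eta by apply/RleP.
have [sg' Hs] := majorization h1 h2 lohi e0 H' sg.
exists (fun i => if insub i is Some x then sg' x : nat else i); split.
  by exists sg' => i; rewrite valK.
move/RleP: Hs; rewrite !rsumE.
have -> : \sum_(i < n.+1) Rmult (phi (tau i)) (U i) = \sum_(x : X) phi (sg x) * U x by apply: eq_bigr => x _; rewrite Hsg.
have -> : \sum_(i < n.+1) Rmult (phi (if insub (nat_of_ord i) is Some x then sg' x : nat else i)) (U' i) = \sum_(x : X) phi (sg' x) * U' x.
  by apply: eq_bigr => x _; rewrite valK.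
by [].
Qed.

Lemma pm_id : pm n (fun i => i).
Proof. by exists 1%g => i; rewrite perm1. Qed.

End Circle.
End Circle.

Import Circle.

Lemma rsum_single (D i : nat) (F : nat -> R) : (i < D)%nat -> (forall m, (m < D)%nat -> m <> i -> F m = 0) -> rsum D F = F i.
Proof.
  intros Hi H. induction D; [lia|]. simpl. destruct (Nat.eq_dec i D) as [-> | Hne].
  - rewrite (rsum_ext D F (fun _ => 0)) by (intros; apply H; lia). rewrite rsum_const. ring.
  - rewrite IHD by (try lia; intros; apply H; lia). rewrite (H D) by lia. ring.
Qed.

(** The Poisson kernel as a harmonic function on the disk. In this form [poisson_average] applies to
    the kernel itself and yields that parameters multiply under convolution. *)
Definition poisson_fun (z : Cplx) : R := Re ((1 + z) / (1 - z))%X.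
Definition poisson_coef (i : nat) : Cplx := match i with O => 1%X | _ => RtoC 2 end.

Lemma Cabs_lt1_neq (z : Cplx) : Cabs z < 1 -> (1 - z)%X <> 0%X.
Proof. intros H E. apply Csub_eq0 in E. subst. rewrite Cabs_1 in H. lra. Qed.

Lemma poisson_fun_cis (r t : R) : 0 <= r < 1 -> poisson_fun (RtoC r * cis t)%X = pois r (cos t).
Proof.
  intros Hr. unfold poisson_fun, pois.
  assert (D := pois_den_pos r (cos t) Hr (COS_bound t)).
  assert (S2 := sin2_cos2 t). unfold Rsqr in S2.
  set (c := cos t) in *. set (s := sin t) in *.
  simpl. fold c s.
  assert (E : (1 + - (r * c - 0 * s)) * (1 + - (r * c - 0 * s)) + (0 + - (r * s + 0 * c)) * (0 + - (r * s + 0 * c)) = 1 - 2 * r * c + r * r).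
  { replace (r * r) with (r * r * (s * s + c * c)) by (rewrite S2; ring). ring. }
  rewrite E. apply Rmult_eq_reg_r with (1 - 2 * r * c + r * r); [|lra].
  field_simplify; [|lra|lra]. replace (c ^ 2) with (1 - s ^ 2) by (rewrite <- S2; ring). ring.
Qed.

Lemma poisson_series : real_series 1 poisson_fun poisson_coef.
Proof.
  intros R0 HR eps He. destruct (geometric_small R0 (2 / (1 - R0)) eps) as [D HD]; [lra | exact He|].
  exists (S D). intros n Hn z Hz. destruct n as [|n]; [lia|]. specialize (HD (S n) ltac:(lia)).
  assert (N := Cabs_lt1_neq z ltac:(lra)).
  assert (E : csum (S n) (fun i => (poisson_coef i * z ^ i)%X) = (RtoC 2 * csum (S n) (fun i => z ^ i) - 1)%X).
  { rewrite !csum_shift. simpl Cpow.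
    rewrite (csum_ext n (fun k => (poisson_coef (S k) * (z * z ^ k))%X) (fun k => (RtoC 2 * (z * z ^ k))%X)) by reflexivity.
    rewrite csum_scal. generalize (csum n (fun k : nat => (z * z ^ k)%X)). intros u.
    apply Ceq; simpl; ring. }
  assert (E2 : ((1 + z) / (1 - z) - csum (S n) (fun i => (poisson_coef i * z ^ i)) = RtoC 2 * z ^ (S n) / (1 - z))%X).
  { rewrite E. assert (G := csum_geom (S n) z). set (c := csum (S n) (fun i => (z ^ i)%X)) in *.
    replace (z ^ S n)%X with (1 - (1 - z) * c)%X by (rewrite G; ring).
    replace (RtoC 2) with (1 + 1)%X by (apply Ceq; simpl; ring). field. exact N. }
  unfold poisson_fun. replace (Re ((1 + z) / (1 - z))%X - Re (csum (S n) (fun i => (poisson_coef i * z ^ i)%X))) with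
    (Re ((1 + z) / (1 - z) - csum (S n) (fun i => poisson_coef i * z ^ i))%X) by reflexivity.
  rewrite E2. eapply Rle_trans; [apply Re_le_Cabs|]. rewrite Cabs_div, Cabs_mul, Cabs_pow, Cabs_RtoC, Rabs_pos_eq by (try exact N; lra).
  eapply Rle_trans; [|exact HD]. assert (A := Cabs_sub_ge 1%X z). rewrite Cabs_1 in A. assert (A0 := Cabs_ge0 z).
  assert (P : Cabs z ^ S n <= R0 ^ S n) by (apply pow_incr; lra). assert (P0 : 0 <= Cabs z ^ S n) by (apply pow_le; lra).
  assert (I1 : / Cabs (1 - z)%X <= / (1 - R0)) by (apply Rinv_le_contravar; lra).
  assert (I0 : 0 < / Cabs (1 - z)%X) by (apply Rinv_0_lt_compat; lra).
  unfold Rdiv. replace (2 * / (1 - R0) * R0 ^ S n) with (2 * R0 ^ S n * / (1 - R0)) by ring.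
  apply Rmult_le_compat; lra.
Qed.

Lemma real_series_bounded (r R0 : R) (v : Cplx -> R) (l : nat -> Cplx) :
  real_series r v l -> 0 < R0 < r -> exists B, 0 <= B /\ forall z, Cabs z <= R0 -> Rabs (v z) <= B.
Proof.
  intros HS HR. destruct (HS R0 HR 1 Rlt_0_1) as [D HD]. specialize (HD D (le_n D)).
  exists (1 + rsum D (fun i => Cabs (l i) * R0 ^ i)). split.
  - assert (0 <= rsum D (fun i => Cabs (l i) * R0 ^ i)); [|lra].
    replace 0 with (INR D * 0) by ring. rewrite <- rsum_const. apply rsum_le. intros.
    apply Rmult_le_pos; [apply Cabs_ge0 | apply pow_le; lra].
  - intros z Hz. specialize (HD z Hz).
    replace (v z) with ((v z - Re (csum D (fun i => l i * z ^ i)%X)) + Re (csum D (fun i => l i * z ^ i)%X)) by ring.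
    eapply Rle_trans; [apply Rabs_triang|]. apply Rplus_le_compat; [exact HD|].
    eapply Rle_trans; [apply Re_le_Cabs|]. eapply Rle_trans; [apply csum_abs|].
    apply rsum_le. intros i _. rewrite Cabs_mul, Cabs_pow. apply Rmult_le_compat_l; [apply Cabs_ge0|].
    apply pow_incr. split; [apply Cabs_ge0 | exact Hz].
Qed.

Lemma rootu_ang (n k : nat) : rootu n k = cis (ang n k).
Proof. reflexivity. Qed.

(* Exact for polynomials of degree below n/2, by orthogonality. *)
Lemma poisson_sum_poly (n D k : nat) (l : nat -> Cplx) (r R0 : R) : (2 * D < n)%nat ->
  rsum n (fun j => Re (csum D (fun i => poisson_coef i * (RtoC r * cis (ang n k - ang n j)) ^ i)%X) * Re (csum D (fun m => l m * pt n R0 j ^ m)%X))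
  = INR n * Re (csum D (fun i => l i * pt n (R0 * r) k ^ i)%X).
Proof.
  intros HD.
  set (A := fun i => (RtoC r ^ i * poisson_coef i * Cbar (rootu n k ^ i))%X).
  set (B := fun m => (l m * RtoC R0 ^ m)%X).
  rewrite (rsum_ext n _ (fun j => rsum D (fun i => rsum D (fun m => Re (A i * rootu n j ^ i)%X * Re (B m * rootu n j ^ m)%X)))).
  2:{ intros j _. rewrite !Re_csum, Rmult_comm, <- rsum_scal. apply rsum_ext. intros i _.
      rewrite Rmult_comm, <- rsum_scal. apply rsum_ext. intros m _. f_equal.
      - rewrite Cpow_mul_base.
        assert (E : (cis (ang n k - ang n j) ^ i)%X = (rootu n k ^ i * Cbar (rootu n j ^ i))%X).
        { rewrite !rootu_ang, !cis_pow, Cbar_cis, <- cis_add. f_equal. ring. }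
        rewrite E. unfold A.
        assert (PR : exists p, poisson_coef i = RtoC p) by (destruct i; [exists 1 | exists 2]; reflexivity).
        destruct PR as [p ->]. rewrite <- RtoC_pow. generalize (rootu n k ^ i)%X (rootu n j ^ i)%X (r ^ i). intros a b c. simpl. ring.
      - unfold B, pt. rewrite Cpow_mul_base. f_equal. ring. }
  rewrite rsum_swap.
  rewrite (rsum_ext D _ (fun i => INR n * Re (l i * pt n (R0 * r) k ^ i)%X)).
  - rewrite rsum_scal, Re_csum. reflexivity.
  - intros i Hi. rewrite rsum_swap. rewrite (rsum_single D i) by (try exact Hi; intros m Hm Hne; apply rsum_corr_neq; lia).
    assert (EP : (pt n (R0 * r) k ^ i)%X = (RtoC (R0 ^ i * r ^ i) * rootu n k ^ i)%X).
    { unfold pt. rewrite Cpow_mul_base, <- RtoC_pow, Rpow_mult_distr. reflexivity. }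
    rewrite EP. destruct i as [|i].
    + rewrite (rsum_ext n _ (fun _ => Re (l O))).
      * rewrite rsum_const. f_equal. simpl. ring.
      * intros j _. simpl. ring.
    + rewrite rsum_corr_eq by lia. f_equal. unfold A, B. rewrite <- !RtoC_pow.
      generalize (rootu n k ^ S i)%X (r ^ S i) (R0 ^ S i) (l (S i)). intros a b c d. simpl. field.
Qed.

(** Both the kernel and [v] are replaced by partial sums of degree below [n / 2], for which the
    identity is exact. The truncation errors are uniform on circles, so [n0] does not depend on
    [k]. *)
Lemma poisson_average (rr R0 r : R) (v : Cplx -> R) (l : nat -> Cplx) :
  real_series rr v l -> 0 < R0 < rr -> 0 < r < 1 -> forall eps, 0 < eps -> exists n0, forall n, (n0 <= n)%nat -> forall k,
    Rabs (rsum n (fun j => pois r (cos (ang n k - ang n j)) * v (pt n R0 j)) - INR n * v (pt n (R0 * r) k)) <= INR n * eps.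
Proof.
  intros HS HR Hr eps He.
  destruct (real_series_bounded rr R0 v l HS HR) as [B [B0 HB]].
  destruct (real_series_bounded 1 r _ _ poisson_series Hr) as [B2 [B20 HB2]].
  destruct (poisson_series r Hr (eps / (3 * (B + 1)))) as [D1 H1]; [apply Rdiv_lt_0_compat; lra|].
  assert (E2 : 0 < Rmin (eps / (3 * (B2 + eps / (3 * (B + 1)) + 1))) (eps / 3)).
  { assert (0 < eps / (3 * (B + 1))) by (apply Rdiv_lt_0_compat; lra).
    apply Rmin_pos; [apply Rdiv_lt_0_compat; lra | lra]. }
  destruct (HS R0 HR _ E2) as [D2 H2].
  set (D := (D1 + D2)%nat). specialize (H1 D ltac:(unfold D; lia)). specialize (H2 D ltac:(unfold D; lia)).
  exists (2 * D + 1)%nat. intros n Hn k.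
  set (e1 := eps / (3 * (B + 1))) in *.
  assert (He1 : 0 < e1) by (apply Rdiv_lt_0_compat; lra).
  set (e2 := Rmin (eps / (3 * (B2 + e1 + 1))) (eps / 3)) in *.
  assert (Q1 : e1 * B <= eps / 3).
  { apply Rle_trans with (e1 * (B + 1)); [nra|]. apply Req_le. unfold e1. field. lra. }
  assert (Q2 : (B2 + e1) * e2 <= eps / 3).
  { apply Rle_trans with ((B2 + e1 + 1) * (eps / (3 * (B2 + e1 + 1)))).
    - apply Rmult_le_compat; try lra. apply Rmin_l.
    - apply Req_le. field. lra. }
  assert (Q3 : e2 <= eps / 3) by apply Rmin_r.
  set (P := fun z => Re (csum D (fun m => l m * z ^ m)%X)) in *.
  set (K := fun j => Re (csum D (fun i => poisson_coef i * (RtoC r * cis (ang n k - ang n j)) ^ i)%X)).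
  assert (EX := poisson_sum_poly n D k l r R0 ltac:(lia)). fold K in EX.
  change (rsum n (fun j => K j * P (pt n R0 j)) = INR n * P (pt n (R0 * r) k)) in EX.
  assert (S1 : Rabs (rsum n (fun j => pois r (cos (ang n k - ang n j)) * v (pt n R0 j)) - rsum n (fun j => K j * P (pt n R0 j))) <= INR n * (2 * (eps / 3))).
  { rewrite <- rsum_minus. eapply Rle_trans; [apply rsum_abs|]. apply rsum_le_const. intros j _.
    assert (AZ : Cabs (RtoC r * cis (ang n k - ang n j))%X <= r) by (rewrite Cabs_mul, Cabs_cis, Cabs_RtoC, Rabs_pos_eq; lra).
    specialize (H1 _ AZ). specialize (HB2 _ AZ). rewrite poisson_fun_cis in H1, HB2 by lra. fold (K j) in H1.
    assert (AP : Cabs (pt n R0 j) <= R0) by (rewrite Cabs_pt; lra).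
    specialize (H2 _ AP). specialize (HB _ AP). fold (P (pt n R0 j)) in H2.
    set (p := pois r (cos (ang n k - ang n j))) in *. set (x := v (pt n R0 j)) in *. set (y := P (pt n R0 j)) in *.
    assert (KB : Rabs (K j) <= B2 + e1).
    { replace (K j) with (p - (p - K j)) by ring. eapply Rle_trans; [apply Rabs_triang|]. rewrite Rabs_Ropp. lra. }
    replace (p * x - K j * y) with ((p - K j) * x + K j * (x - y)) by ring.
    eapply Rle_trans; [apply Rabs_triang|]. rewrite !Rabs_mult.
    assert (Rabs (p - K j) * Rabs x <= e1 * B) by (apply Rmult_le_compat; auto using Rabs_pos).
    assert (Rabs (K j) * Rabs (x - y) <= (B2 + e1) * e2) by (apply Rmult_le_compat; auto using Rabs_pos).
    lra. }
  assert (AP : Cabs (pt n (R0 * r) k) <= R0) by (rewrite Cabs_pt; nra).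
  specialize (H2 _ AP). fold (P (pt n (R0 * r) k)) in H2.
  assert (Hn0 := pos_INR n).
  rewrite EX in S1.
  match goal with |- Rabs (?a - ?b) <= _ => replace (a - b) with ((a - INR n * P (pt n (R0 * r) k)) - INR n * (v (pt n (R0 * r) k) - P (pt n (R0 * r) k))) by ring end.
  eapply Rle_trans; [apply Rabs_triang|]. rewrite Rabs_Ropp, Rabs_mult, (Rabs_pos_eq (INR n)) by lra.
  assert (INR n * Rabs (v (pt n (R0 * r) k) - P (pt n (R0 * r) k)) <= INR n * (eps / 3)) by (apply Rmult_le_compat_l; lra).
  lra.
Qed.

(** The logarithm of the slit map [((1 + z) / (1 - z)) ^ 2 = 1 + 4 * z / (1 - z) ^ 2] on the
    positive axis, the extremal growth for valence 1. *)
Definition koebe_log (x : R) : R := 2 * ln ((1 + x) / (1 - x)).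

(** The derivative of [koebe_log] with respect to [ln x] is the oscillation of the kernel of
    parameter [x], which increases with [x]. The mean value theorem therefore bounds the increment
    from below by the oscillation at the left end. *)
Lemma koebe_log_step (rho r : R) : 0 < rho < 1 -> 0 < r < 1 ->
  ((1 + r * rho) / (1 - r * rho) - (1 - r * rho) / (1 + r * rho)) * ln (/ r) <= koebe_log rho - koebe_log (r * rho).
Proof.
  intros Hrho Hr.
  assert (Hx : 0 < r * rho < rho) by nra.
  assert (L : ln (/ r) = ln rho - ln (r * rho)).
  { rewrite ln_mult, ln_Rinv by lra. ring. }
  set (f := fun s => 2 * ln ((1 + exp s) / (1 - exp s))).
  set (f' := fun s => 4 * exp s / (1 - exp s * exp s)).
  destruct (MVT_cor2 f f' (ln (r * rho)) (ln rho)) as [c [Hc1 Hc2]].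
  - apply ln_increasing; lra.
  - intros c Hc. assert (Hce : exp c <= rho).
    { rewrite <- (exp_ln rho) by lra. destruct (Req_dec c (ln rho)) as [->|]; [lra | left; apply exp_increasing; lra]. }
    assert (E0 := exp_pos c). apply is_derive_Reals. unfold f, f'. auto_derive.
    + split; [lra|]. split; [|trivial]. apply Rdiv_lt_0_compat; lra.
    + field. repeat split; nra.
  - unfold f in Hc1. rewrite !exp_ln in Hc1 by lra. unfold koebe_log. rewrite Hc1, L.
    apply Rmult_le_compat_r; [assert (ln (r * rho) < ln rho) by (apply ln_increasing; lra); lra|].
    set (x := r * rho) in *.
    assert (Y1 : x <= exp c) by (rewrite <- (exp_ln x) by lra; left; apply exp_increasing; lra).
    assert (Y2 : exp c < rho) by (rewrite <- (exp_ln rho) by lra; apply exp_increasing; lra).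
    replace ((1 + x) / (1 - x) - (1 - x) / (1 + x)) with (4 * x / (1 - x * x)) by (field; repeat split; nra).
    apply Rmult_le_compat; [lra | left; apply Rinv_0_lt_compat; nra | lra|].
    apply Rinv_le_contravar; nra.
Qed.

Lemma pois_bounds (r c : R) : 0 <= r < 1 -> -1 <= c <= 1 -> (1 - r) / (1 + r) <= pois r c <= (1 + r) / (1 - r).
Proof.
  intros Hr Hc. assert (D := pois_den_pos r c Hr Hc). unfold pois. split.
  - apply Rmult_le_reg_r with ((1 + r) * (1 - 2 * r * c + r * r)); [nra|].
    replace ((1 - r) / (1 + r) * ((1 + r) * (1 - 2 * r * c + r * r))) with ((1 - r) * (1 - 2 * r * c + r * r)) by (field; lra).
    replace ((1 - r * r) / (1 - 2 * r * c + r * r) * ((1 + r) * (1 - 2 * r * c + r * r))) with ((1 - r) * ((1 + r) * (1 + r))) by (field; lra).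
    apply Rmult_le_compat_l; nra.
  - apply Rmult_le_reg_r with ((1 - r) * (1 - 2 * r * c + r * r)); [nra|].
    replace ((1 + r) / (1 - r) * ((1 - r) * (1 - 2 * r * c + r * r))) with ((1 + r) * (1 - 2 * r * c + r * r)) by (field; lra).
    replace ((1 - r * r) / (1 - 2 * r * c + r * r) * ((1 - r) * (1 - 2 * r * c + r * r))) with ((1 + r) * ((1 - r) * (1 - r))) by (field; lra).
    apply Rmult_le_compat_l; nra.
Qed.

(** * The sharp growth theorem for zero-free multivalent functions *)

(* [c] bounds, up to o(1), every pairing of the values of [v] on the circle of radius [R1] with a
   rearrangement of the Poisson kernel of parameter [rho]. *)
Definition pairing_bound (v : Cplx -> R) (R1 rho c : R) : Prop :=
  forall eps, 0 < eps -> exists N0, forall N, (N0 <= N)%nat -> forall tau, pm N tau ->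
    rsum (S N) (fun k => pois rho (cos (ang (S N) (tau k))) * v (pt (S N) R1 k)) <= INR (S N) * (c + eps).

Section Growth.
(** In the application [v] is [ln |g| - ln |g 0|] and [q] is the valence; the normalization makes
    every circle mean of [v] tend to 0. *)
Variables (v : Cplx -> R) (l : nat -> Cplx) (rr R0 R1 q : R).
Hypothesis v_series : real_series rr v l.
Hypothesis l_0 : Re (l O) = 0.
Hypothesis radii : 0 < R1 < R0 /\ R0 < rr.
Hypothesis q_pos : 0 <= q.
Hypothesis v_growth : forall eps, 0 < eps -> exists n0, forall n, (n0 <= n)%nat -> forall s,
  rsum n (fun k => Rmax (v (pt n R0 k)) s) <= rsum n (fun k => Rmax (v (pt n R1 k)) s) + INR n * (q * ln (R0 / R1) + eps).

Lemma pairing_bound_step (rho c : R) : 0 < rho < 1 ->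
  pairing_bound v R1 (R1 / R0 * rho) c ->
  pairing_bound v R1 rho (c + q * (koebe_log rho - koebe_log (R1 / R0 * rho))).
Proof.
  intros Hrho HQ eps He. set (r := R1 / R0) in *.
  assert (Hr : 0 < r < 1).
  { unfold r. split; [apply Rdiv_lt_0_compat; lra|]. apply Rmult_lt_reg_r with R0; [lra|]. unfold Rdiv. rewrite Rmult_assoc, Rinv_l by lra. lra. }
  assert (Hrr : 0 < r * rho < 1) by nra.
  assert (ER : R0 * r = R1) by (unfold r; field; lra).
  assert (EH : ln (R0 / R1) = ln (/ r)) by (f_equal; unfold r; field; lra).
  assert (LH : 0 <= ln (/ r)).
  { rewrite <- ln_1. apply ln_le; [lra|]. rewrite <- Rinv_1. apply Rinv_le_contravar; lra. }
  destruct (real_series_bounded rr R0 v l v_series) as [B [B0 HB]]; [lra|].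
  set (lo := (1 - r * rho) / (1 + r * rho)). set (hi := (1 + r * rho) / (1 - r * rho)).
  set (hi0 := (1 + rho) / (1 - rho)).
  assert (Hlo : 0 <= lo <= 1).
  { unfold lo. split; [apply Rmult_le_pos; [lra | left; apply Rinv_0_lt_compat; lra]|].
    apply Rmult_le_reg_r with (1 + r * rho); [lra|]. unfold Rdiv. rewrite Rmult_assoc, Rinv_l by lra. lra. }
  assert (Hlohi : lo <= hi) by (unfold lo, hi; eapply Rle_trans; apply (pois_bounds (r * rho) 0); lra).
  assert (Hhi0 : 0 < hi0) by (apply Rdiv_lt_0_compat; lra).
  assert (STEP : (hi - lo) * ln (/ r) <= koebe_log rho - koebe_log (r * rho)) by (apply koebe_log_step; lra).
  (* The errors cost [hi0] for the Poisson mean of [v], [B] for the convolution of kernels,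
     [hi - lo] for the growth, 2 for the means over both circles and 1 for the hypothesis on
     [r * rho]; one unit is spare. *)
  set (e := eps / (hi0 + B + (hi - lo) + 4)).
  assert (De : 0 < hi0 + B + (hi - lo) + 4) by lra.
  assert (He' : 0 < e) by now apply Rdiv_lt_0_compat.
  assert (Ee : e * (hi0 + B + (hi - lo) + 4) = eps) by (unfold e; field; lra).
  destruct (poisson_average rr R0 r v l v_series ltac:(lra) Hr e He') as [n1 H1].
  destruct (poisson_average 1 rho r poisson_fun poisson_coef poisson_series Hrho Hr e He') as [n2 H2].
  destruct (v_growth e He') as [n3 H3].
  destruct (harmonic_average_tendsto rr R0 v l v_series ltac:(lra) e He') as [n4 H4].
  destruct (harmonic_average_tendsto rr R1 v l v_series ltac:(lra) e He') as [n5 H5].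
  destruct (HQ e He') as [n6 H6].
  exists (n1 + n2 + n3 + n4 + n5 + n6)%nat. intros N HN tau Htau.
  set (n := S N) in *.
  assert (Hn : 0 < INR n) by (apply lt_0_INR; unfold n; lia).
  specialize (H1 n ltac:(unfold n; lia)). specialize (H2 n ltac:(unfold n; lia)). specialize (H3 n ltac:(unfold n; lia)).
  specialize (H4 n ltac:(unfold n; lia)). specialize (H5 n ltac:(unfold n; lia)). specialize (H6 N ltac:(lia)). fold n in H6.
  rewrite l_0, Rmult_0_r, Rminus_0_r in H4, H5.
  set (phi := fun y => pois (r * rho) (cos (ang n y))).
  (* Riesz rearrangement, the kernel of parameter r turning values on |z| = R0 into values on |z| = R1 *)
  destruct (riesz_circle (n := N) (r := r) (rho := rho) (tau := tau) (fun j => v (pt n R0 j))) as (tau1 & Ht1 & RZ); [lra | lra | exact Htau|].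
  fold n in RZ.
  assert (A1 : INR n * rsum n (fun k => pois rho (cos (ang n (tau k))) * v (pt n R1 k)) <=
     rsum n (fun i => rsum n (fun j => pois rho (cos (ang n (tau i))) * v (pt n R0 j) * pois r (cos (ang n i - ang n j)))) + INR n * (INR n * (hi0 * e))).
  { rewrite <- (rsum_const n (INR n * (hi0 * e))), <- rsum_plus, <- rsum_scal. apply rsum_le. intros i _.
    specialize (H1 i). rewrite ER in H1. apply Rabs_le_between in H1.
    assert (PB := pois_bounds rho (cos (ang n (tau i))) ltac:(lra) (COS_bound _)). fold hi0 in PB.
    assert (PB0 : 0 <= (1 - rho) / (1 + rho)) by (apply Rmult_le_pos; [lra | left; apply Rinv_0_lt_compat; lra]).
    rewrite (rsum_ext n _ (fun j => pois rho (cos (ang n (tau i))) * (pois r (cos (ang n i - ang n j)) * v (pt n R0 j)))) by (intros; ring).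
    rewrite rsum_scal. set (p := pois rho (cos (ang n (tau i)))) in *. set (S1 := rsum n _) in *.
    assert (p * (INR n * v (pt n R1 i)) <= p * (S1 + INR n * e)) by (apply Rmult_le_compat_l; lra).
    assert (p * (INR n * e) <= hi0 * (INR n * e)) by (apply Rmult_le_compat_r; nra).
    lra. }
  (* The Poisson mean is applied to the kernel: averaging the one of parameter [rho] against the one
     of parameter [r] gives the one of parameter [r * rho]. *)
  assert (A2 : rsum n (fun j => v (pt n R0 j) * rsum n (fun i => pois rho (cos (ang n i)) * pois r (cos (ang n i - ang n (tau1 j))))) <=
     INR n * rsum n (fun j => phi (tau1 j) * v (pt n R0 j)) + INR n * (INR n * (B * e))).
  { rewrite <- (rsum_const n (INR n * (B * e))), <- rsum_scal, <- rsum_plus. apply rsum_le. intros j _.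
    specialize (H2 (tau1 j)).
    rewrite (rsum_ext n (fun i => pois r (cos (ang n (tau1 j) - ang n i)) * poisson_fun (pt n rho i)) (fun i => pois rho (cos (ang n i)) * pois r (cos (ang n i - ang n (tau1 j))))) in H2.
    2:{ intros i _. unfold pt. rewrite rootu_ang, poisson_fun_cis by lra. rewrite <- (cos_neg (ang n i - ang n (tau1 j))).
        replace (- (ang n i - ang n (tau1 j))) with (ang n (tau1 j) - ang n i) by ring. ring. }
    unfold pt at 1 in H2. rewrite rootu_ang, poisson_fun_cis in H2 by (rewrite Rmult_comm; lra).
    rewrite (Rmult_comm rho r) in H2. fold (phi (tau1 j)) in H2.
    set (S1 := rsum n _) in *. set (x := v (pt n R0 j)).
    assert (XB : Rabs x <= B) by (apply HB; rewrite Cabs_pt; lra).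
    assert (Q : x * (S1 - INR n * phi (tau1 j)) <= B * (INR n * e)).
    { eapply Rle_trans; [apply Rle_abs|]. rewrite Rabs_mult. apply Rmult_le_compat; auto using Rabs_pos. }
    lra. }
  destruct (majorization_rsum (n := N) (phi := phi) (U := fun j => v (pt n R0 j)) (U' := fun j => v (pt n R1 j)) (lo := lo) (hi := hi) (eta := INR n * (q * ln (R0 / R1) + e)) (tau := tau1))
    as (tau2 & Ht2 & MJ).
  { intros i. apply pois_bounds; [lra | apply COS_bound]. }
  { intros i. apply pois_bounds; [lra | apply COS_bound]. }
  { rewrite EH. apply Rmult_le_pos; [lra|]. assert (0 <= q * ln (/ r)) by (apply Rmult_le_pos; lra). apply Rplus_le_le_0_compat; [assumption | lra]. }
  { intros t. apply H3. }
  { exact Ht1. }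
  fold n in MJ. specialize (H6 tau2 Ht2). unfold phi in MJ at 2. rewrite EH in MJ.
  apply Rabs_le_between in H4. apply Rabs_le_between in H5.
  (* Both circle means of [v] are close to 0, so the constant part [lo] of the kernel contributes
     only an error. *)
  assert (LL : lo * (rsum n (fun j => v (pt n R0 j)) - rsum n (fun j => v (pt n R1 j))) <= INR n * (2 * e)).
  { apply Rle_trans with (lo * (INR n * (2 * e))); [apply Rmult_le_compat_l; lra|].
    nra. }
  assert (ST2 : INR n * (q * ((hi - lo) * ln (/ r))) <= INR n * (q * (koebe_log rho - koebe_log (r * rho)))).
  { apply Rmult_le_compat_l; [lra|]. apply Rmult_le_compat_l; lra. }
  apply Rmult_le_reg_l with (INR n); [exact Hn|].
  assert (A4 : INR n * rsum n (fun j => phi (tau1 j) * v (pt n R0 j)) <= INR n * (INR n * (c + e) + (INR n * (q * (koebe_log rho - koebe_log (r * rho))) + INR n * ((hi - lo) * e)) + INR n * (2 * e))) by (apply Rmult_le_compat_l; lra).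
  assert (A5 : 0 <= INR n * (INR n * e)) by (apply Rmult_le_pos; [lra | apply Rmult_le_pos; lra]).
  rewrite <- Ee. lra.
Qed.

(** A kernel of small parameter is nearly 1, whatever its rearrangement, and against the constant 1
    the mean of [v] tends to 0. *)
Lemma pairing_bound_base (rho B : R) : 0 < rho < 1 -> (forall z, Cabs z <= R0 -> Rabs (v z) <= B) ->
  pairing_bound v R1 rho (2 * rho / (1 - rho) * B).
Proof.
  intros Hrho HB eps He.
  destruct (harmonic_average_tendsto rr R1 v l v_series ltac:(lra) eps He) as [n5 H5].
  exists n5. intros N HN tau Htau. specialize (H5 (S N) ltac:(lia)). rewrite l_0, Rmult_0_r, Rminus_0_r in H5.
  apply Rabs_le_between in H5.
  apply Rle_trans with (rsum (S N) (fun k => v (pt (S N) R1 k) + 2 * rho / (1 - rho) * B)).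
  - apply rsum_le. intros k _.
    assert (PB := pois_bounds rho (cos (ang (S N) (tau k))) ltac:(lra) (COS_bound _)).
    set (p := pois rho (cos (ang (S N) (tau k)))) in *.
    specialize (HB (pt (S N) R1 k)). rewrite Cabs_pt in HB by lra. specialize (HB ltac:(lra)).
    set (x := v (pt (S N) R1 k)) in *.
    assert (Q : Rabs (p - 1) <= 2 * rho / (1 - rho)).
    { apply Rabs_le. split.
      - apply Rle_trans with (- (2 * rho / (1 + rho))).
        + apply Ropp_le_contravar. apply Rmult_le_compat_l; [lra|]. apply Rinv_le_contravar; lra.
        + apply Rle_trans with ((1 - rho) / (1 + rho) - 1); [apply Req_le; field; lra | lra].
      - apply Rle_trans with ((1 + rho) / (1 - rho) - 1); [lra | apply Req_le; field; lra]. }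
    assert (T : (p - 1) * x <= 2 * rho / (1 - rho) * B).
    { eapply Rle_trans; [apply Rle_abs|]. rewrite Rabs_mult. apply Rmult_le_compat; auto using Rabs_pos. }
    lra.
  - rewrite rsum_plus, rsum_const. lra.
Qed.

Lemma koebe_log_pos (x : R) : 0 <= x < 1 -> 0 <= koebe_log x.
Proof.
  intros Hx. unfold koebe_log. assert (0 <= ln ((1 + x) / (1 - x))); [|lra].
  rewrite <- ln_1. apply ln_le; [lra|]. apply Rmult_le_reg_r with (1 - x); [lra|]. unfold Rdiv. rewrite Rmult_assoc, Rinv_l by lra. lra.
Qed.

(** After [m] steps the parameter is [r ^ m * rho], so the base bound is negligible for large [m].
    At the other end the unpermuted kernel of parameter [rho] on [|z| = R1] reproduces the value of
    [v] at [R1 * rho]. *)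
Lemma harmonic_growth (rho : R) : 0 < rho < 1 -> v (RtoC (R1 * rho)) <= q * koebe_log rho.
Proof.
  intros Hrho. set (r := R1 / R0).
  assert (Hr : 0 < r < 1).
  { unfold r. split; [apply Rdiv_lt_0_compat; lra|]. apply Rmult_lt_reg_r with R0; [lra|]. unfold Rdiv. rewrite Rmult_assoc, Rinv_l by lra. lra. }
  destruct (real_series_bounded rr R0 v l v_series) as [B [B0 HB]]; [lra|].
  (* The increments of [koebe_log] telescope along the geometric sequence of parameters. *)
  assert (IT : forall m x c, 0 < x < 1 -> pairing_bound v R1 (r ^ m * x) c -> pairing_bound v R1 x (c + q * (koebe_log x - koebe_log (r ^ m * x)))).
  { induction m; intros x c Hx H.
    - rewrite Rmult_1_l in *. replace (c + q * (koebe_log x - koebe_log x)) with c by ring. exact H.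
    - simpl in *. replace (r * r ^ m * x) with (r ^ m * (r * x)) in * by ring.
      assert (Hrx : 0 < r * x < 1) by nra.
      specialize (IHm _ _ Hrx H). apply (pairing_bound_step x) in IHm; [|exact Hx]. fold r in IHm.
      replace (c + q * (koebe_log x - koebe_log (r ^ m * (r * x)))) with
        (c + q * (koebe_log (r * x) - koebe_log (r ^ m * (r * x))) + q * (koebe_log x - koebe_log (r * x))) by ring. exact IHm. }
  apply le_epsilon. intros eps He.
  destruct (geometric_small r (2 * B / (1 - rho)) (eps / 3)) as [m Hm]; [lra | lra|]. specialize (Hm m (le_n m)).
  assert (Rm : 0 < r ^ m) by (apply pow_lt; lra).
  assert (Rm1 : r ^ m <= 1) by (rewrite <- (pow1 m); apply pow_incr; lra).
  assert (Hx : 0 < r ^ m * rho < 1) by nra.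
  assert (PB := IT m rho _ Hrho (pairing_bound_base _ B Hx HB)).
  destruct (PB (eps / 3) ltac:(lra)) as [n1 H1].
  destruct (poisson_average rr R1 rho v l v_series ltac:(lra) Hrho (eps / 3) ltac:(lra)) as [n2 H2].
  set (N := (n1 + n2)%nat). specialize (H1 N ltac:(unfold N; lia) (fun i => i) (pm_id N)).
  specialize (H2 (S N) ltac:(unfold N; lia) O).
  assert (A0 : ang (S N) 0 = 0) by (unfold ang; simpl INR; unfold Rdiv; ring).
  rewrite (rsum_ext (S N) _ (fun k => pois rho (cos (ang (S N) k)) * v (pt (S N) R1 k))) in H2.
  2:{ intros j _. rewrite A0. replace (0 - ang (S N) j) with (- ang (S N) j) by ring. rewrite cos_neg. reflexivity. }
  assert (P0 : pt (S N) (R1 * rho) 0 = RtoC (R1 * rho)) by (unfold pt; rewrite rootu_0; ring).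
  rewrite P0 in H2. apply Rabs_le_between in H2.
  assert (Hn : 0 < INR (S N)) by (apply lt_0_INR; lia).
  assert (KP := koebe_log_pos (r ^ m * rho) ltac:(lra)).
  assert (SM : 2 * (r ^ m * rho) / (1 - r ^ m * rho) * B <= eps / 3).
  { eapply Rle_trans; [|exact Hm].
    assert (I1 : / (1 - r ^ m * rho) <= / (1 - rho)) by (apply Rinv_le_contravar; nra).
    assert (I0 : 0 < / (1 - r ^ m * rho)) by (apply Rinv_0_lt_compat; lra).
    replace (2 * B / (1 - rho) * r ^ m) with (2 * B * r ^ m * / (1 - rho)) by (unfold Rdiv; ring).
    replace (2 * (r ^ m * rho) / (1 - r ^ m * rho) * B) with (2 * B * (r ^ m * rho) * / (1 - r ^ m * rho)) by (unfold Rdiv; ring).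
    apply Rmult_le_compat; [repeat apply Rmult_le_pos; lra | lra | apply Rmult_le_compat_l; nra | exact I1]. }
  assert (QK : 0 <= q * koebe_log (r ^ m * rho)) by (apply Rmult_le_pos; lra).
  apply Rmult_le_reg_l with (INR (S N)); [exact Hn|].
  set (V := v (RtoC (R1 * rho))) in *.
  assert (Z : INR (S N) * V <= INR (S N) * (2 * (r ^ m * rho) / (1 - r ^ m * rho) * B + q * (koebe_log rho - koebe_log (r ^ m * rho)) + eps / 3) + INR (S N) * (eps / 3)) by lra.
  eapply Rle_trans; [exact Z|]. rewrite <- Rmult_plus_distr_l. apply Rmult_le_compat_l; lra.
Qed.
End Growth.

Lemma growth_radial (g : Cplx -> Cplx) (q : nat) (R1 rho : R) :
  holo_on (disk 1) g -> zerofree g -> valent q g -> 0 < R1 < 1 -> 0 < rho < 1 ->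
  ln (Cabs (g (RtoC (R1 * rho)))) - ln (Cabs (g 0%X)) <= INR q * koebe_log rho.
Proof.
  intros Hg Zg HV HR1 Hrho.
  set (R0 := (2 * R1 + 1) / 3). set (rr := (R1 + 2) / 3).
  destruct (ln_Cabs_series g rr Hg Zg) as (l & Hl0 & HS); [unfold rr; lra|].
  set (c := ln (Cabs (g 0%X))) in *.
  set (v := fun z => ln (Cabs (g z)) - c).
  set (l' := fun i => match i with O => 0%X | S j => l (S j) end).
  assert (HS' : real_series rr v l').
  { intros R2 HR2 eps He. destruct (HS R2 HR2 eps He) as [D HD]. exists (S D). intros n Hn z Hz.
    destruct n as [|n]; [lia|]. specialize (HD (S n) ltac:(lia) z Hz).
    rewrite csum_shift in HD |- *. rewrite Hl0 in HD.
    replace (v z - Re (l' 0%nat * z ^ 0 + csum n (fun k => l' (S k) * z ^ S k))%X) with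
      (ln (Cabs (g z)) - Re (RtoC c * z ^ 0 + csum n (fun k => l (S k) * z ^ S k))%X); [exact HD|].
    unfold l', v. generalize (csum n (fun k => (l (S k) * z ^ S k)%X)). intros u. simpl. ring. }
  apply (harmonic_growth v l' rr R0 R1 (INR q)); auto.
  - unfold R0, rr. lra.
  - apply pos_INR.
  - intros eps He. destruct (circle_growth g q R1 R0 Hg Zg HV ltac:(unfold R0; lra) ltac:(unfold R0; lra) eps He) as [n0 H].
    (* The level [t = exp (s + c)] turns the truncation of [ln |g|] at [ln t] into the truncation of
       [v] at [s]. *)
    exists n0. intros n Hn s. specialize (H n Hn (exp (s + c)) (exp_pos _)).
    assert (E : forall r, 0 < r < 1 -> rsum n (fun k => lmax (exp (s + c)) (Cabs (g (pt n r k)))) = rsum n (fun k => Rmax (v (pt n r k)) s) + INR n * c).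
    { intros r Hr. rewrite <- rsum_const, <- rsum_plus. apply rsum_ext. intros k _. unfold lmax.
      rewrite ln_Rmax, ln_exp by (try apply exp_pos; apply Cabs_pos, Zg; unfold disk; rewrite Cabs_pt; lra).
      unfold v. set (x := ln (Cabs (g (pt n r k)))). unfold Rmax. destruct (Rle_dec x (s + c)), (Rle_dec (x - c) s); lra. }
    rewrite !E in H by (unfold R0; lra). lra.
Qed.

Lemma koebe_log_continuous (a : R) : 0 <= a < 1 -> forall eps, 0 < eps -> exists del, 0 < del /\
  forall x, a < x < 1 -> x < a + del -> koebe_log x <= koebe_log a + eps.
Proof.
  intros Ha eps He.
  assert (D : ex_derive koebe_log a).
  { unfold koebe_log. auto_derive. split; [lra|]. split; [|trivial]. apply Rdiv_lt_0_compat; lra. }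
  assert (C := ex_derive_continuous _ _ D). apply continuity_pt_filterlim in C.
  destruct (C eps He) as [del [Hd H]]. exists del. split; [exact Hd|]. intros x Hx1 Hx2.
  assert (X := H x). simpl in X. unfold R_dist in X.
  assert (Rabs (koebe_log x - koebe_log a) < eps).
  { apply X. split; [split; [exact I | lra]|]. rewrite Rabs_pos_eq; lra. }
  apply Rabs_lt_between in H0. lra.
Qed.

Lemma growth_upper (g : Cplx -> Cplx) (q : nat) (z : Cplx) :
  holo_on (disk 1) g -> zerofree g -> valent q g -> disk 1 z ->
  ln (Cabs (g z)) - ln (Cabs (g 0%X)) <= INR q * koebe_log (Cabs z).
Proof.
  intros Hg Zg HV Hz. unfold disk in Hz.
  destruct (Ceq_dec z 0%X) as [-> | Hz0].
  { rewrite Cabs_0. unfold koebe_log. replace ((1 + 0) / (1 - 0)) with 1 by field. rewrite ln_1. lra. }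
  assert (Az := Cabs_pos z Hz0). set (a := Cabs z) in *.
  assert (Na : RtoC a <> 0%X) by (intros E; apply (f_equal Re) in E; simpl in E; lra).
  set (k := (z / RtoC a)%X).
  assert (Ak : Cabs k = 1).
  { unfold k. rewrite Cabs_div by exact Na. rewrite Cabs_RtoC, Rabs_pos_eq by lra. fold a. field. lra. }
  assert (Hk : k <> 0%X) by (apply Cabs_neq0; lra).
  set (gk := fun w => g (k * w)%X).
  assert (DK : forall w, disk 1 w -> disk 1 (k * w)%X) by (unfold disk; intros w Hw; rewrite Cabs_mul, Ak; lra).
  assert (Hgk : holo_on (disk 1) gk).
  { intros w Hw. destruct (Hg _ (DK w Hw)) as [m Hm]. eexists. apply (cderiv_comp g (fun x => (k * x)%X)); [|exact Hm].
    apply (cderiv_mul (fun _ => k) (fun x => x)); [apply cderiv_const | apply cderiv_id]. }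
  assert (Zgk : zerofree gk) by (intros w Hw; apply Zg, DK, Hw).
  assert (Vgk : valent q gk) by (apply valent_scale; auto; lra).
  apply le_epsilon. intros eps He. assert (Q0 := pos_INR q).
  destruct (koebe_log_continuous a ltac:(lra) (eps / (INR q + 1))) as [del [Hd Hdel]]; [apply Rdiv_lt_0_compat; lra|].
  (* The radial bound at [R1 * rho] involves [rho] only. With [rho = x] slightly above [a] and
     [R1 = a / x] below 1, the point is [a] and the excess is at most [eps]. *)
  set (x := a + Rmin del (1 - a) / 2).
  assert (M1 := Rmin_l del (1 - a)). assert (M2 := Rmin_r del (1 - a)). assert (M3 : 0 < Rmin del (1 - a)) by (apply Rmin_pos; lra).
  assert (Hx : a < x < 1) by (unfold x; lra). specialize (Hdel x Hx ltac:(unfold x; lra)).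
  assert (HR : 0 < a / x < 1).
  { split; [apply Rdiv_lt_0_compat; lra|]. apply Rmult_lt_reg_r with x; [lra|]. unfold Rdiv. rewrite Rmult_assoc, Rinv_l by lra. lra. }
  assert (G := growth_radial gk q (a / x) x Hgk Zgk Vgk HR ltac:(lra)).
  replace (a / x * x) with a in G by (field; lra). unfold gk in G.
  replace (k * RtoC a)%X with z in G by (unfold k; field; exact Na).
  replace (k * 0)%X with 0%X in G by ring.
  eapply Rle_trans; [exact G|].
  apply Rle_trans with (INR q * (koebe_log a + eps / (INR q + 1))); [apply Rmult_le_compat_l; lra|].
  rewrite Rmult_plus_distr_l. apply Rplus_le_compat_l.
  apply Rle_trans with ((INR q + 1) * (eps / (INR q + 1))).
  - apply Rmult_le_compat_r; [left; apply Rdiv_lt_0_compat; lra | lra].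
  - apply Req_le. field. lra.
Qed.

(** The upper bound for [g] at [z] and the one for [1 / g] at [w] add up, and the value at 0
    cancels. The 2 in the exponent is the one in [koebe_log]. *)
Lemma growth_compare (g : Cplx -> Cplx) (q : nat) (z w : Cplx) :
  holo_on (disk 1) g -> zerofree g -> valent q g -> disk 1 z -> disk 1 w ->
  Cabs (g z) <= ((1 + Cabs z) / (1 - Cabs z) * ((1 + Cabs w) / (1 - Cabs w))) ^ (2 * q) * Cabs (g w).
Proof.
  intros Hg Zg HV Hz Hw.
  assert (U := growth_upper g q z Hg Zg HV Hz).
  assert (HI : holo_on (disk 1) (fun z => Cinv (g z))).
  { intros x Hx. destruct (Hg x Hx) as [m Hm]. eexists. apply cderiv_inv; [now apply Zg | exact Hm]. }
  assert (D0 : disk 1 0%X) by (unfold disk; rewrite Cabs_0; lra).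
  assert (ZI : zerofree (fun z => Cinv (g z))).
  { intros x Hx. apply Cabs_neq0. rewrite Cabs_inv by now apply Zg. apply Rinv_0_lt_compat, Cabs_pos. now apply Zg. }
  assert (L := growth_upper _ q w HI ZI (valent_inv q g Hg Zg HV) Hw). simpl in L.
  rewrite !Cabs_inv, !ln_Rinv in L by (try apply Cabs_pos; now apply Zg).
  assert (Pw := Cabs_pos _ (Zg w Hw)).
  unfold disk in Hz, Hw. assert (A1 := Cabs_ge0 z). assert (A2 := Cabs_ge0 w).
  set (x := (1 + Cabs z) / (1 - Cabs z)). set (y := (1 + Cabs w) / (1 - Cabs w)).
  assert (Px : 0 < x) by (apply Rdiv_lt_0_compat; lra). assert (Py : 0 < y) by (apply Rdiv_lt_0_compat; lra).
  assert (Pp : 0 < (x * y) ^ (2 * q)) by (apply pow_lt; nra).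
  destruct (Rle_lt_dec (Cabs (g z)) ((x * y) ^ (2 * q) * Cabs (g w))) as [|C]; [assumption|].
  exfalso. apply ln_increasing in C; [|nra].
  rewrite ln_mult, ln_pow_nat, ln_mult, mult_INR in C by (try exact Pp; nra). simpl (INR 2) in C.
  unfold koebe_log in U, L. fold x in U. fold y in L. lra.
Qed.

(** * Cartan's lemma *)

Definition near (c : Cplx) (r : R) (a : Cplx) : bool := if Rle_dec (Cabs (c - a)%X) r then true else false.
Definition cnt (c : Cplx) (r : R) (l : list Cplx) : nat := length (filter (near c r) l).

Lemma near_true (c : Cplx) (r : R) (a : Cplx) : near c r a = true <-> Cabs (c - a)%X <= r.
Proof. unfold near. destruct (Rle_dec _ _); split; intros; try assumption; try discriminate; try reflexivity; contradiction. Qed.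

Lemma cnt_le_length (c : Cplx) (r : R) (l : list Cplx) : (cnt c r l <= length l)%nat.
Proof. unfold cnt. induction l; simpl; [lia|]. destruct (near c r a); simpl; lia. Qed.

Lemma cnt_mono (c : Cplx) (r r' : R) (l : list Cplx) : r <= r' -> (cnt c r l <= cnt c r' l)%nat.
Proof.
  intros H. unfold cnt. induction l as [|a l IH]; simpl; [lia|].
  destruct (near c r a) eqn:E.
  - assert (E' : near c r' a = true) by (apply near_true in E; apply near_true; lra). rewrite E'. simpl; lia.
  - destruct (near c r' a); simpl; lia.
Qed.

Lemma cnt_filter (z c : Cplx) (r r' : R) (l : list Cplx) :
  (forall a, In a l -> near z r a = true -> near c r' a = false) ->
  cnt z r l = cnt z r (filter (fun a => negb (near c r' a)) l).
Proof.
  intros H. unfold cnt. induction l as [|a l IH]; simpl; [reflexivity|].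
  assert (IH' := IH (fun b Hb => H b (or_intror Hb))).
  destruct (near z r a) eqn:E.
  - rewrite (H a (or_introl eq_refl) E). simpl. rewrite E. now rewrite IH'.
  - destruct (near c r' a); simpl; [exact IH'|]. now rewrite E.
Qed.

Lemma length_filter_negb {A : Type} (p : A -> bool) (l : list A) :
  (length (filter p l) + length (filter (fun a => negb (p a)) l) = length l)%nat.
Proof. induction l as [|a l IH]; simpl; [reflexivity|]. destruct (p a); simpl; lia. Qed.

Lemma exists_max (P : nat -> Prop) (N : nat) : (forall k, P k -> (k <= N)%nat) -> (exists k, P k) ->
  exists k, P k /\ forall j, P j -> (j <= k)%nat.
Proof.
  induction N; intros H [k Hk].
  - exists k. split; [exact Hk|]. intros j Hj. apply H in Hj. lia.
  - destruct (excluded_middle_informative (P (S N))) as [HP|HP].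
    + exists (S N). split; [exact HP | exact H].
    + apply IHN; [|now exists k]. intros j Hj. assert (Hj' := H j Hj).
      destruct (Nat.eq_dec j (S N)) as [-> |]; [contradiction | lia].
Qed.

Definition weight (ds : list (Cplx * nat)) : nat := fold_right (fun d acc => (snd d + acc)%nat) O ds.

(* Greedy choice: remove the points of a disk of radius [lam k] containing [k] of them, [k] maximal. *)
Lemma cartan_cover (lam : nat -> R) (n : nat) (l : list Cplx) :
  (forall i j, (1 <= i <= j)%nat -> lam i <= lam j) -> (length l <= n)%nat ->
  exists ds : list (Cplx * nat), Forall (fun d => (1 <= snd d)%nat) ds /\ (weight ds <= length l)%nat /\
    forall z, (forall d, In d ds -> 2 * lam (snd d) < Cabs (z - fst d)%X) ->
      forall j, (1 <= j)%nat -> (cnt z (lam j) l < j)%nat.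
Proof.
  intros Hlam. revert l. induction n as [|n IH]; intros l Hl.
  - exists nil. split; [constructor|]. split; [simpl; lia|]. intros z _ j Hj. assert (H := cnt_le_length z (lam j) l). lia.
  - destruct (excluded_middle_informative (exists k, (1 <= k)%nat /\ exists c, (k <= cnt c (lam k) l)%nat)) as [E|NE].
    + destruct (exists_max (fun k => (1 <= k)%nat /\ exists c, (k <= cnt c (lam k) l)%nat) (length l)) as (k & (Hk1 & c & Hc) & Hmax); [|exact E|].
      { intros k (_ & c & Hc). assert (H := cnt_le_length c (lam k) l). lia. }
      (* More than [k] points would make [k + 1] admissible with the same centre, since [lam] is
         monotone. *)
      assert (Ek : cnt c (lam k) l = k).
      { destruct (Nat.eq_dec (cnt c (lam k) l) k) as [|Hne]; [assumption|]. exfalso.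
        assert (S k <= k)%nat; [|lia]. apply Hmax. split; [lia|]. exists c.
        assert (M := cnt_mono c (lam k) (lam (S k)) l (Hlam k (S k) ltac:(lia))). lia. }
      set (l' := filter (fun a => negb (near c (lam k) a)) l).
      assert (L := length_filter_negb (near c (lam k)) l). fold l' in L. fold (cnt c (lam k) l) in L. rewrite Ek in L.
      destruct (IH l' ltac:(lia)) as (ds & F1 & F2 & F3).
      exists ((c, k) :: ds). split; [constructor; [exact Hk1 | exact F1]|]. split; [simpl; lia|].
      intros z Hz j Hj. destruct (le_lt_dec j (cnt z (lam j) l)) as [C|]; [|assumption]. exfalso.
      assert (Hjk : (j <= k)%nat) by (apply Hmax; split; [exact Hj | now exists z]).
      assert (Hzc := Hz (c, k) (or_introl eq_refl)). simpl in Hzc.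
      rewrite (cnt_filter z c (lam j) (lam k)) in C.
      * fold l' in C. assert (X := F3 z (fun d Hd => Hz d (or_intror Hd)) j Hj). lia.
      (* A removed point within [lam j] of [z] would bring [z] within [lam j + lam k <= 2 * lam k]
         of the centre; so the removal does not affect the counts around [z]. *)
      * intros a _ Ha. apply near_true in Ha. destruct (near c (lam k) a) eqn:Ec; [|reflexivity]. exfalso.
        apply near_true in Ec. rewrite Cabs_sub_sym in Ec. assert (T := Cabs_add (z - a) (a - c)).
        replace (z - a + (a - c))%X with (z - c)%X in T by ring. assert (M := Hlam j k ltac:(lia)). lra.
    + exists nil. split; [constructor|]. split; [simpl; lia|]. intros z _ j Hj.
      destruct (le_lt_dec j (cnt z (lam j) l)) as [C|]; [|assumption]. exfalso. apply NE. exists j. split; [exact Hj | now exists z].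
Qed.

Fixpoint lamprod (lam : nat -> R) (n : nat) : R := match n with O => 1 | S k => lamprod lam k * lam (S k) end.

Lemma Cabs_prodl_app (l1 l2 : list Cplx) (a z : Cplx) :
  Cabs (prodl (l1 ++ a :: l2) z) = Cabs (z - a)%X * Cabs (prodl (l1 ++ l2) z).
Proof.
  induction l1 as [|b l1 IH]; simpl; [apply Cabs_mul|]. rewrite !Cabs_mul, IH. ring.
Qed.

(** Ordered by distance from [z], the [j]-th point lies farther than [lam j]: fewer than [n + 1] of
    the [n + 1] points are within [lam (n + 1)], so one lies beyond, and without it the counts still
    satisfy the hypothesis. *)
Lemma prodl_lower (lam : nat -> R) (z : Cplx) (n : nat) (l : list Cplx) :
  (forall j, 0 < lam j) -> length l = n -> (forall j, (1 <= j)%nat -> (cnt z (lam j) l < j)%nat) ->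
  lamprod lam n <= Cabs (prodl l z).
Proof.
  intros Hp. revert l. induction n as [|n IH]; intros l Hl Hc.
  - destruct l; [|discriminate]. simpl. rewrite Cabs_1. lra.
  - assert (E : exists a, In a l /\ near z (lam (S n)) a = false).
    { apply NNPP. intros C. assert (X := Hc (S n) ltac:(lia)). unfold cnt in X.
      replace (filter (near z (lam (S n))) l) with l in X; [lia|]. symmetry. clear - C.
      induction l as [|b l IH]; simpl; [reflexivity|].
      destruct (near z (lam (S n)) b) eqn:Eb.
      - f_equal. apply IH. intros (a & Ha & E). apply C. exists a. split; [now right | exact E].
      - exfalso. apply C. exists b. split; [now left | exact Eb]. }
    destruct E as (a & Ha & Ea). destruct (in_split _ _ Ha) as (l1 & l2 & ->).
    rewrite Cabs_prodl_app. simpl lamprod. rewrite Rmult_comm.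
    assert (Fa : lam (S n) < Cabs (z - a)%X).
    { destruct (Rle_lt_dec (Cabs (z - a)%X) (lam (S n))) as [C|]; [|assumption]. apply near_true in C. congruence. }
    assert (I : lamprod lam n <= Cabs (prodl (l1 ++ l2) z)).
    { apply IH.
      - rewrite length_app in *. simpl in Hl. lia.
      - intros j Hj. specialize (Hc j Hj). unfold cnt in *. rewrite filter_app, length_app in *. simpl in Hc.
        destruct (near z (lam j) a); simpl in Hc; lia. }
    apply Rmult_le_compat; [left; apply Hp | | lra | exact I].
    clear - Hp. induction n; simpl; [lra|]. apply Rmult_le_pos; [exact IHn | left; apply Hp].
Qed.

(** This is [e * (exp 1 * j / D) ^ (1 / al)]. For disks of total weight at most [D], the sum of the
    powers of order [al] is at most [exp 1] times that power of [e], while the product over [j <= D]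
    is at least [e ^ D]. Written through [exp], it is positive for every [j]. *)
Definition cartan_radius (e al : R) (D j : nat) : R := exp (ln e + / al * (1 + ln (INR j) - ln (INR D))).

(** The logarithm of [m! >= (m / exp 1) ^ m]; the induction step is [m * ln (1 + 1 / m) <= 1]. *)
Lemma sum_ln_lower (m : nat) : INR m * ln (INR m) - INR m <= rsum m (fun j => ln (INR (S j))).
Proof.
  induction m; [simpl; lra|]. cbn [rsum]. destruct m as [|m].
  - simpl. rewrite ln_1. lra.
  - set (x := INR (S m)) in *. assert (Hx : 0 < x) by (apply lt_0_INR; lia).
    replace (INR (S (S m))) with (x + 1) by (unfold x; rewrite (S_INR (S m)); reflexivity).
    assert (L : ln (x + 1) - ln x <= / x).
    { assert (H1 : ln (x + 1) = ln x + ln (1 + / x)).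
      { rewrite <- ln_mult; [f_equal; field; lra | lra | assert (0 < / x) by (now apply Rinv_0_lt_compat); lra]. }
      rewrite H1. assert (0 < / x) by now apply Rinv_0_lt_compat.
      assert (H2 : ln (1 + / x) <= ln (exp (/ x))) by (apply ln_le; [lra | apply exp_ineq1_le]). rewrite ln_exp in H2. lra. }
    assert (x * (ln (x + 1) - ln x) <= 1).
    { apply Rle_trans with (x * / x); [apply Rmult_le_compat_l; lra | rewrite Rinv_r; lra]. }
    lra.
Qed.

Lemma lamprod_cartan (e al : R) (D : nat) : 0 < e -> 0 < al -> e ^ D <= lamprod (cartan_radius e al D) D.
Proof.
  intros He Hal.
  assert (E : forall m, lamprod (cartan_radius e al D) m = exp (INR m * ln e + / al * (INR m * (1 - ln (INR D)) + rsum m (fun j => ln (INR (S j)))))).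
  { induction m; [simpl; rewrite <- exp_0; f_equal; ring|]. cbn [lamprod rsum]. rewrite IHm. unfold cartan_radius.
    rewrite <- exp_plus. f_equal. rewrite (S_INR m). ring. }
  rewrite E, <- (exp_ln (e ^ D)), ln_pow_nat by first [exact He | now apply pow_lt].
  assert (P : 0 < / al) by now apply Rinv_0_lt_compat. assert (S1 := sum_ln_lower D).
  assert (Q : 0 <= / al * (INR D * (1 - ln (INR D)) + rsum D (fun j => ln (INR (S j))))) by (apply Rmult_le_pos; lra).
  destruct Q as [Q | <-]; [left; apply exp_increasing; lra | rewrite Rplus_0_r; apply Rle_refl].
Qed.

(** The factor [5 / 2] exceeds the 2 of [cartan_cover], because covering disks are open, and stays
    below the 3 that the final constant allows, which leaves a strict inequality in
    [exists_large_value]. *)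
Lemma cartan_disks (l : list Cplx) (e al : R) : 0 < e -> 0 < al -> l <> nil ->
  exists cs : list (Cplx * R), (length cs <= length l)%nat /\ Forall (fun c => 0 < snd c) cs /\
    cover_val al cs <= 5 / 2 * e * exp (/ al) /\
    forall z, Cabs (prodl l z) < e ^ length l -> exists c, In c cs /\ ball (fst c) (snd c) z.
Proof.
  intros He Hal Hnil. set (D := length l).
  assert (HD : 0 < INR D) by (apply lt_0_INR; unfold D; destruct l; [contradiction | simpl; lia]).
  set (lam := cartan_radius e al D).
  assert (Pal : 0 < / al) by now apply Rinv_0_lt_compat.
  destruct (cartan_cover lam (length l) l) as (ds & F1 & F2 & F3); [|lia|].
  { intros i j Hij. unfold lam, cartan_radius.
    assert (ln (INR i) <= ln (INR j)) by (apply ln_le; [apply lt_0_INR; lia | apply le_INR; lia]).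
    destruct (Req_dec (ln (INR i)) (ln (INR j))) as [-> |]; [lra|]. left. apply exp_increasing.
    apply Rplus_lt_compat_l, Rmult_lt_compat_l; lra. }
  exists (map (fun d => (fst d, 5 / 2 * lam (snd d))) ds).
  assert (Lp : forall j, 0 < lam j) by (intros; apply exp_pos).
  split; [|split; [|split]].
  - rewrite length_map. eapply Nat.le_trans; [|exact F2]. clear - F1. induction F1; simpl; lia.
  - apply Forall_forall. intros c Hc. apply in_map_iff in Hc. destruct Hc as (d & <- & _). simpl. specialize (Lp (snd d)). lra.
  - assert (SUM : fold_right (fun c acc => Rpower (snd c) al + acc) 0 (map (fun d => (fst d, 5 / 2 * lam (snd d))) ds) =
       exp (al * ln (5 / 2 * e) + 1) * (INR (weight ds) / INR D)).
    { clear F2 F3. induction F1 as [|d ds Hd F IH]; simpl.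
      - unfold Rdiv. ring.
      - rewrite IH, plus_INR.
        assert (Hd' : 0 < INR (snd d)) by (apply lt_0_INR; lia).
        assert (E : Rpower (5 / 2 * lam (snd d)) al = exp (al * ln (5 / 2 * e) + 1) * (INR (snd d) / INR D)).
        { unfold Rpower. rewrite ln_mult by (try apply Lp; lra). unfold lam, cartan_radius. rewrite ln_exp, (ln_mult (5 / 2) e) by lra.
          rewrite <- (exp_ln (INR (snd d) / INR D)) by (apply Rdiv_lt_0_compat; lra). rewrite <- exp_plus. f_equal.
          replace (ln (INR (snd d) / INR D)) with (ln (INR (snd d)) - ln (INR D))
            by (unfold Rdiv; rewrite (ln_mult (INR (snd d))), ln_Rinv by (try apply Rinv_0_lt_compat; lra); ring).
          field. lra. }
        rewrite E. unfold Rdiv. ring. }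
    unfold cover_val. destruct (map (fun d => (fst d, 5 / 2 * lam (snd d))) ds) as [|c0 cs0] eqn:EM.
    + assert (0 < exp (/ al)) by apply exp_pos. nra.
    + rewrite SUM. destruct ds as [|d0 ds0]; [discriminate|].
      assert (W0 : 0 < INR (weight (d0 :: ds0))) by (apply lt_0_INR; inversion F1; simpl; lia).
      assert (W1 : INR (weight (d0 :: ds0)) / INR D <= 1).
      { apply Rmult_le_reg_r with (INR D); [exact HD|]. unfold Rdiv. rewrite Rmult_assoc, Rinv_l by lra.
        rewrite Rmult_1_r, Rmult_1_l. apply le_INR. exact F2. }
      set (W := INR (weight (d0 :: ds0)) / INR D) in *. assert (W2 : 0 < W) by (apply Rdiv_lt_0_compat; lra).
      unfold Rpower. rewrite ln_mult, ln_exp by (try apply exp_pos; exact W2).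
      assert (LW : ln W <= 0) by (rewrite <- ln_1; apply ln_le; lra).
      rewrite <- (exp_ln (5 / 2 * e)) at 2 by lra. rewrite <- exp_plus.
      replace (/ al * (al * ln (5 / 2 * e) + 1 + ln W)) with (ln (5 / 2 * e) + / al + / al * ln W) by (field; lra).
      assert (/ al * ln W <= 0) by nra.
      destruct (Req_dec (/ al * ln W) 0) as [-> |]; [rewrite Rplus_0_r; lra|]. left. apply exp_increasing. lra.
  - intros z Hz. apply NNPP. intros C.
    assert (X : lamprod lam D <= Cabs (prodl l z)).
    { apply prodl_lower; [exact Lp | reflexivity|]. apply F3. intros d Hd.
      destruct (Rlt_le_dec (2 * lam (snd d)) (Cabs (z - fst d)%X)) as [|L]; [assumption|]. exfalso. apply C.
      exists (fst d, 5 / 2 * lam (snd d)). split; [apply in_map_iff; now exists d|]. unfold ball. simpl.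
      specialize (Lp (snd d)). lra. }
    assert (Y := lamprod_cartan e al D He Hal). fold lam in Y. lra.
Qed.

(** * Infima, suprema and the covering quantity *)

Lemma Rinf_is_glb (E : R -> Prop) : (exists x, E x) -> (exists b, forall x, E x -> b <= x) -> is_glb E (Rinf E).
Proof.
  intros [x0 Hx0] [b Hb]. unfold Rinf. destruct (excluded_middle_informative _) as [H|H].
  - exact (proj2_sig (constructive_indefinite_description _ H)).
  - exfalso. apply H. destruct (completeness (fun y => E (- y))) as [m [M1 M2]].
    + exists (- b). intros y Hy. specialize (Hb _ Hy). lra.
    + exists (- x0). now rewrite Ropp_involutive.
    + exists (- m). split.
      * intros x Hx. assert (- x <= m) by (apply M1; now rewrite Ropp_involutive). lra.
      * intros c Hc. assert (m <= - c); [|lra]. apply M2. intros y Hy. specialize (Hc _ Hy). lra.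
Qed.

Lemma Rsup_is_lub (E : R -> Prop) : (exists x, E x) -> bound E -> is_lub E (Rsup E).
Proof.
  intros Hne Hb. unfold Rsup. destruct (excluded_middle_informative _) as [H|H].
  - exact (proj2_sig (constructive_indefinite_description _ H)).
  - exfalso. apply H. destruct (completeness E Hb Hne) as [m Hm]. now exists m.
Qed.

Lemma cover_val_nonneg (al : R) (cs : list (Cplx * R)) : 0 <= cover_val al cs.
Proof. destruct cs; simpl; [lra|]. left. apply exp_pos. Qed.

Lemma c_cap_le (d : nat) (al : R) (Z : Cplx -> Prop) (cs : list (Cplx * R)) :
  (length cs <= d)%nat -> Forall (fun c => 0 < snd c) cs -> covers Z cs -> c_cap d al Z <= cover_val al cs.
Proof.
  intros H1 H2 H3. apply (Rinf_is_glb _).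
  - eexists. exists cs. repeat split; eassumption || reflexivity.
  - exists 0. intros x (cs' & _ & _ & _ & ->). apply cover_val_nonneg.
  - exists cs. repeat split; assumption || reflexivity.
Qed.

(** It ensures that [6 * exp (/ al) / c_cap d al Z] is at least 1, so that the exponent may be
    raised from the number of extracted zeros to [s]. *)
Lemma c_cap_le_1 (d : nat) (al : R) (Z : Cplx -> Prop) :
  (1 <= d)%nat -> (forall z, Z z -> disk 1 z) -> c_cap d al Z <= 1.
Proof.
  intros Hd HZ. eapply Rle_trans; [apply (c_cap_le d al Z ((RtoC 0, 1) :: nil))|].
  - simpl; lia.
  - constructor; [simpl; lra | constructor].
  - intros z Hz. exists (RtoC 0, 1). split; [now left|]. unfold ball. simpl.
    replace (z - 0)%X with z by ring. apply HZ, Hz.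
  - simpl. unfold Rpower. rewrite ln_1, Rmult_0_r, exp_0, Rplus_0_r, ln_1, Rmult_0_r, exp_0. lra.
Qed.

Lemma Cabs_prodl_le (l : list Cplx) (z : Cplx) : Forall (disk 1) l -> disk 1 z -> Cabs (prodl l z) <= 2 ^ length l.
Proof.
  intros Hl Hz. induction Hl as [|a l Ha Hl IH]; simpl; [rewrite Cabs_1; lra|].
  rewrite Cabs_mul. unfold disk in *. assert (S1 := Cabs_sub z a).
  apply Rmult_le_compat; try apply Cabs_ge0; lra.
Qed.

(* The disks of [cartan_disks] have value [5/6 * c_cap], so they cannot cover [Z]. *)
Lemma exists_large_value (l : list Cplx) (s : nat) (al : R) (Z : Cplx -> Prop) :
  (length l <= s)%nat -> 0 < al -> 0 < c_cap s al Z -> (exists z, Z z) ->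
  exists w, Z w /\ (c_cap s al Z / (3 * exp (/ al))) ^ length l <= Cabs (prodl l w).
Proof.
  intros Hl Hal Hc [z0 Hz0]. set (c := c_cap s al Z) in *.
  assert (EP := exp_pos (/ al)).
  assert (He : 0 < c / (3 * exp (/ al))) by (apply Rdiv_lt_0_compat; lra).
  destruct l as [|a l].
  { exists z0. split; [exact Hz0|]. simpl. rewrite Cabs_1. lra. }
  apply NNPP. intros C.
  destruct (cartan_disks (a :: l) _ al He Hal ltac:(discriminate)) as (cs & H1 & H2 & H3 & H4).
  assert (X : c <= cover_val al cs).
  { apply c_cap_le; [lia | exact H2|]. intros w Hw. apply H4.
    destruct (Rlt_le_dec (Cabs (prodl (a :: l) w)) ((c / (3 * exp (/ al))) ^ length (a :: l))) as [|L]; [assumption|].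
    exfalso. apply C. now exists w. }
  replace (5 / 2 * (c / (3 * exp (/ al))) * exp (/ al)) with (5 / 6 * c) in H3 by (field; lra). lra.
Qed.

(** * Combination of the bounds for the polynomial and the zero-free factor *)

Lemma koebe_ratio_mono (x y : R) : 0 <= x -> x <= y -> y < 1 -> 1 <= (1 + x) / (1 - x) <= (1 + y) / (1 - y).
Proof.
  intros H1 H2 H3. split.
  - apply Rmult_le_reg_r with (1 - x); [lra|]. unfold Rdiv. rewrite Rmult_assoc, Rinv_l by lra. lra.
  - apply Rmult_le_compat; [lra | left; apply Rinv_0_lt_compat; lra | lra|]. apply Rinv_le_contravar; lra.
Qed.

Theorem mainTheorem13 (f : Cplx -> Cplx) (s p : nat) (Z : Cplx -> Prop) (Rad : R) :
  analytic_near_closed_unit_disk f ->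
  zeros_exactly f (disk 1) s ->
  sp_valent s p f (disk 1) ->
  (forall z, Z z -> disk 1 z) ->
  (exists z, Z z) ->
  rho Z < 1 ->
  0 < Rad < 1 ->
  match K_const s Z with
  | Some k =>
      forall z, Cabs z <= Rad ->
        Cabs (f z) <= sigma_p p Rad (rho Z) * k *
                      Rsup (fun v => exists w, Z w /\ v = Cabs (f w))
  | None => True
  end.
Proof.
  intros (U & _ & HU & Hf) [_ HZ] HV HZ1 HZne Hrho HRad.
  assert (Hf1 : holo_on (disk 1) f) by (apply (holo_sub_set U); [intros z Hz; apply HU; unfold disk in Hz; lra | exact Hf]).
  destruct (sp_valent_factor f s p Hf1 HZ HV) as (l & g & (Hg & Hl & E) & Hls & Zg & Vg).
  assert (GR : is_glb (fun eta => 0 < eta /\ forall z, Z z -> disk eta z) (rho Z)).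
  { apply Rinf_is_glb; [exists 1; split; [lra | exact HZ1] | exists 0; intros x [Hx _]; lra]. }
  assert (RW : forall w, Z w -> Cabs w <= rho Z).
  { intros w Hw. apply GR. intros x [_ Hx]. left. apply Hx, Hw. }
  assert (R0 : 0 <= rho Z) by (apply GR; intros x [Hx _]; lra).
  set (sig := sigma_p p Rad (rho Z)).
  assert (K1 := koebe_ratio_mono Rad Rad ltac:(lra) ltac:(lra) ltac:(lra)).
  assert (K2 := koebe_ratio_mono (rho Z) (rho Z) ltac:(lra) ltac:(lra) Hrho).
  assert (SG : 1 <= sig) by (unfold sig, sigma_p; apply pow_R1_Rle; nra).
  assert (CMP : forall z w, Cabs z <= Rad -> Z w -> Cabs (g z) <= sig * Cabs (g w)).
  { intros z w Hz Hw. assert (Hw' := RW w Hw).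
    eapply Rle_trans; [apply (growth_compare g p z w Hg Zg Vg); [unfold disk; lra | apply HZ1, Hw]|].
    apply Rmult_le_compat_r; [apply Cabs_ge0|]. apply pow_incr.
    assert (A1 := koebe_ratio_mono (Cabs z) Rad (Cabs_ge0 z) Hz ltac:(lra)).
    assert (A2 := koebe_ratio_mono (Cabs w) (rho Z) (Cabs_ge0 w) Hw' Hrho).
    split; [nra|]. apply Rmult_le_compat; lra. }
  (* [Rsup] takes the value 0 when there is no least upper bound, so boundedness of [|f|] on [Z] has
     to be established; it follows from the growth bound compared with the value at 0. *)
  assert (BD : bound (fun v => exists w, Z w /\ v = Cabs (f w))).
  { exists (2 ^ length l * (((1 + rho Z) / (1 - rho Z) * 1) ^ (2 * p) * Cabs (g 0%X))).
    intros v (w & Hw & ->). rewrite E by (apply HZ1, Hw). rewrite Cabs_mul.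
    apply Rmult_le_compat; try apply Cabs_ge0; [apply Cabs_prodl_le; [exact Hl | apply HZ1, Hw]|].
    eapply Rle_trans; [apply (growth_compare g p w 0%X Hg Zg Vg); [apply HZ1, Hw | unfold disk; rewrite Cabs_0; lra]|].
    rewrite Cabs_0. apply Rmult_le_compat_r; [apply Cabs_ge0|]. apply pow_incr.
    assert (A2 := koebe_ratio_mono (Cabs w) (rho Z) (Cabs_ge0 w) (RW w Hw) Hrho).
    replace ((1 + 0) / (1 - 0)) with 1 by field. lra. }
  assert (LUB := Rsup_is_lub (fun v => exists w, Z w /\ v = Cabs (f w)) ltac:(destruct HZne as [w Hw]; eexists; now exists w) BD).
  set (M := Rsup (fun v => exists w, Z w /\ v = Cabs (f w))) in *.
  assert (MW : forall w, Z w -> Cabs (f w) <= M) by (intros w Hw; apply LUB; now exists w).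
  assert (M0 : 0 <= M) by (destruct HZne as [w Hw]; eapply Rle_trans; [apply Cabs_ge0 | apply MW, Hw]).
  (* The inequality is kept free of division by [|prodl l w|], so that it holds for every [w] in
     [Z]; the point [w] with a large value is chosen only afterwards. *)
  assert (MAIN : forall z w, Cabs z <= Rad -> Z w -> Cabs (f z) * Cabs (prodl l w) <= 2 ^ length l * (sig * M)).
  { intros z w Hz Hw. assert (Dz : disk 1 z) by (unfold disk; lra).
    rewrite (E z Dz), Cabs_mul. assert (C := CMP z w Hz Hw). assert (B := Cabs_prodl_le l z Hl Dz).
    assert (MWw := MW w Hw). rewrite (E w (HZ1 w Hw)), Cabs_mul in MWw.
    assert (P1 := Cabs_ge0 (prodl l w)). assert (P2 := Cabs_ge0 (prodl l z)).
    apply Rle_trans with (Cabs (prodl l z) * (sig * M)); [|apply Rmult_le_compat_r; [nra | exact B]].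
    rewrite Rmult_assoc. apply Rmult_le_compat_l; [exact P2|].
    apply Rle_trans with (sig * Cabs (g w) * Cabs (prodl l w)); [apply Rmult_le_compat_r; assumption|]. nra. }
  unfold K_const. destruct s as [|s'].
  (* Without zeros [f] equals [g] on the disk, and the constant [K_const] is 1. *)
  { intros z Hz. destruct l as [|a l]; [|simpl in Hls; lia]. destruct HZne as [w Hw].
    specialize (MAIN z w Hz Hw). simpl in MAIN. rewrite Cabs_1 in MAIN. lra. }
  destruct (excluded_middle_informative _) as [EX|]; [|exact I].
  set (EE := fun v => exists alpha, 0 < alpha /\ 0 < c_cap (S s') alpha Z /\ v = (6 * exp (/ alpha) / c_cap (S s') alpha Z) ^ S s').
  change (forall z, Cabs z <= Rad -> Cabs (f z) <= sig * Rinf EE * M).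
  assert (EPOS : forall v, EE v -> 0 <= v).
  { intros v (al & Hal & Hc & ->). apply pow_le. assert (EP := exp_pos (/ al)). left. apply Rdiv_lt_0_compat; lra. }
  assert (GK : is_glb EE (Rinf EE)).
  { apply Rinf_is_glb; [|exists 0; exact EPOS]. destruct EX as (al & Hal & Hc). eexists. exists al. split; [exact Hal|]. split; [exact Hc | reflexivity]. }
  intros z Hz.
  assert (ALL : forall v, EE v -> Cabs (f z) <= sig * M * v).
  { intros v (al & Hal & Hc & ->). set (c := c_cap (S s') al Z) in *.
    assert (EP := exp_pos (/ al)).
    destruct (exists_large_value l (S s') al Z Hls Hal Hc HZne) as (w & Hw & LW). fold c in LW.
    specialize (MAIN z w Hz Hw). set (D := length l) in *.
    assert (Q : 0 < (c / (3 * exp (/ al))) ^ D) by (apply pow_lt, Rdiv_lt_0_compat; lra).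
    assert (X : Cabs (f z) * (c / (3 * exp (/ al))) ^ D <= 2 ^ D * (sig * M)).
    { eapply Rle_trans; [|exact MAIN]. apply Rmult_le_compat_l; [apply Cabs_ge0 | exact LW]. }
    assert (Y : Cabs (f z) <= sig * M * (6 * exp (/ al) / c) ^ D).
    { apply Rmult_le_reg_r with ((c / (3 * exp (/ al))) ^ D); [exact Q|].
      replace (sig * M * (6 * exp (/ al) / c) ^ D * (c / (3 * exp (/ al))) ^ D) with (2 ^ D * (sig * M)); [exact X|].
      rewrite Rmult_assoc, <- Rpow_mult_distr. replace (6 * exp (/ al) / c * (c / (3 * exp (/ al)))) with 2 by (field; lra). ring. }
    eapply Rle_trans; [exact Y|]. apply Rmult_le_compat_l; [nra|].
    (* The list [l] may be shorter than [s]; the base is at least 1 because [c <= 1]. *)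
    apply Rle_pow; [|exact Hls].
    assert (C1 := c_cap_le_1 (S s') al Z ltac:(lia) HZ1). fold c in C1.
    assert (1 <= exp (/ al)).
    { rewrite <- exp_0. left. apply exp_increasing. now apply Rinv_0_lt_compat. }
    apply Rmult_le_reg_r with c; [exact Hc|]. unfold Rdiv. rewrite Rmult_assoc, Rinv_l by lra. lra. }
  (* The infimum over [alpha] is reached after division by [sig * M]; if this is 0, a single [alpha]
     already shows that [f z] vanishes. *)
  destruct (Req_dec (sig * M) 0) as [Z0|NZ0].
  - destruct EX as (al & Hal & Hc).
    assert (X := ALL _ ltac:(exists al; split; [exact Hal | split; [exact Hc | reflexivity]])). rewrite Z0, Rmult_0_l in X.
    replace (sig * Rinf EE * M) with (sig * M * Rinf EE) by ring. rewrite Z0, Rmult_0_l. exact X.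
  - assert (P : 0 < sig * M) by (assert (0 <= sig * M) by nra; lra).
    replace (sig * Rinf EE * M) with (sig * M * Rinf EE) by ring.
    apply Rmult_le_reg_l with (/ (sig * M)); [now apply Rinv_0_lt_compat|].
    rewrite <- Rmult_assoc, Rinv_l, Rmult_1_l by lra. apply GK. intros v Hv. specialize (ALL v Hv).
    apply Rmult_le_reg_l with (sig * M); [exact P|]. rewrite <- Rmult_assoc, Rinv_r by lra. lra.
Qed.
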